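(* There is an efficient (polynomial-time, randomized) algorithm which, given any $t$-sparse set system $(V,\mathcal{S})$ on $n$ elements, with high probability finds a coloring $\chi: V\to\{-1,1\}$ such that every set $S\in\mathcal{S}$ satisfies $\left|\sum_{j\in S}\chi(j)\right| = O\big((t\log n\log|S|)^{1/2}\big)$, where the constant in the $O(\cdot)$ is absolute. In particular, the coloring has discrepancy $O\big((t\log n\log s)^{1/2}\big)$, where $s$ is the maximum cardinality of a set in $\mathcal{S}$.
   Context: A set system $(V,\mathcal{S})$ has ground set $V=\{1,\dots,n\}$ and $\mathcal{S}=\{S_1,\dots,S_m\}$ a collection of subsets of $V$. It is $t$-sparse if every element of $V$ lies in at most $t$ of the sets. For a coloring $\chi:V\to\{-1,1\}$, the discrepancy of a set $S$ is $|\sum_{j\in S}\chi(j)|$, and the discrepancy of the coloring is the maximum of this over $S\in\mathcal{S}$.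
   Formalization: The logarithms (base 2) are replaced by max(1, log), because for a set with |S| = 1 the stated bound is 0 while the discrepancy is 1 (and log 0 is undefined for the empty set); for |S| ≥ 2 the bound is the literal one. *)

(* Defs.v *)
From HB Require Import structures.
From mathcomp Require Import all_boot all_order all_algebra.
From mathcomp Require Import boolp reals exp.

Set Implicit Arguments.
Unset Strict Implicit.
Unset Printing Implicit Defensive.

Import Order.TTheory GRing.Theory Num.Theory.

Local Open Scope ring_scope.

(* Model of computation: structured programs for a random-access machine with
   integer cells, unbounded arithmetic charged by bit length (logarithmic cost)
   and fair coin flips.  Up to a polynomial, the running time is that of a
   probabilistic Turing machine.  The memory consists of arrays; the name of the
   array in an access is part of the program text, its index is computed. *)

Definition memory := nat -> int -> int.

Definition write (M : memory) (a : nat) (i v : int) : memory :=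
  fun b j => if (b == a) && (j == i) then v else M b j.

Inductive binop := Add | Sub | Mul | Div | Leq.

Inductive expr :=
  | Const of int
  | Read of nat & expr
  | Op of binop & expr & expr.

Definition eval_op (o : binop) (x y : int) : int :=
  match o with
  | Add => x + y
  | Sub => x - y
  | Mul => x * y
  | Div => (x %/ y)%Z
  | Leq => (x <= y)%R : nat
  end.

Fixpoint eval (M : memory) (e : expr) : int :=
  match e with
  | Const z => z
  | Read a e1 => M a (eval M e1)
  | Op o e1 e2 => eval_op o (eval M e1) (eval M e2)
  end.

(* Number of binary digits of |z|, with the convention that 0 has one digit. *)
Definition bitsize (z : int) : nat := (trunc_log 2 `|z|%N).+1.

(* Every subexpression is charged the bit length of its value, so that each
   operation pays for its operands, its address and its result. *)
Fixpoint ecost (M : memory) (e : expr) : nat :=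
  (bitsize (eval M e) +
   match e with
   | Const _ => 0
   | Read _ e1 => ecost M e1
   | Op _ e1 e2 => ecost M e1 + ecost M e2
   end)%N.

Inductive com :=
  | Skip
  | Assign of nat & expr & expr  (* a[e1] := e2 *)
  | Flip of nat & expr           (* a[e1] := uniformly random bit *)
  | Seq of com & com
  | If of expr & com & com       (* a test succeeds when its value is nonzero *)
  | While of expr & com.

(* The second component is the sequence of coin flips not yet consumed. *)
Definition state : Type := memory * seq bool.

(* [exec c s k s']: started in [s], [c] halts in [s'] at cost [k].  A flip is
   stuck on an empty tape; as it costs at least one unit, a computation of cost
   at most T cannot exhaust a tape of length T. *)
Inductive exec : com -> state -> nat -> state -> Prop :=
  | exec_skip s : exec Skip s 1 s
  | exec_assign a e1 e2 M r :
      exec (Assign a e1 e2) (M, r) (ecost M e1 + ecost M e2).+1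
           (write M a (eval M e1) (eval M e2), r)
  | exec_flip a e (b : bool) M r :
      exec (Flip a e) (M, b :: r) (ecost M e).+1
           (write M a (eval M e) (b : nat), r)
  | exec_seq c1 c2 s1 s2 s3 k1 k2 :
      exec c1 s1 k1 s2 -> exec c2 s2 k2 s3 ->
      exec (Seq c1 c2) s1 (k1 + k2).+1 s3
  | exec_if e c1 c2 s k s' :
      exec (if eval s.1 e != 0 then c1 else c2) s k s' ->
      exec (If e c1 c2) s (ecost s.1 e + k).+1 s'
  | exec_while_stop e c s :
      eval s.1 e = 0 ->
      exec (While e c) s (ecost s.1 e).+1 s
  | exec_while_step e c s1 s2 s3 k1 k2 :
      eval s1.1 e != 0 -> exec c s1 k1 s2 -> exec (While e c) s2 k2 s3 ->
      exec (While e c) s1 (ecost s1.1 e + k1 + k2).+1 s3.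

Definition halts_within (A : com) (M : memory) (T : nat) : Prop :=
  forall r : T.-tuple bool,
    exists k s', (k <= T)%N /\ exec A (M, r : seq bool) k s'.

(* Probability, over T independent fair coin flips, that [A] started in [M]
   halts with a final memory satisfying [E]. *)
Definition Pr (R : realType) (A : com) (M : memory) (T : nat)
    (E : memory -> Prop) : R :=
  #|[set r : T.-tuple bool |
      `[< exists k s', exec A (M, r : seq bool) k s' /\ E s'.1 >]]|%:R / 2 ^+ T.

Section SetSystem.
Variables n m : nat.
Implicit Types (sys : m.-tuple {set 'I_n}) (chi : 'I_n -> int) (S : {set 'I_n}).

Definition sparse (t : nat) sys : Prop :=
  forall j : 'I_n, (count (fun S : {set 'I_n} => j \in S) sys <= t)%N.

Definition is_coloring chi : Prop := forall j, chi j = 1 \/ chi j = -1.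

Definition set_disc chi S : nat := `|(\sum_(j in S) chi j)%R|%N.

Definition disc chi sys : nat := (\max_(S <- sys) set_disc chi S)%N.

Definition max_set_card sys : nat := (\max_(S <- sys) #|S|)%N.

(* Array 0 holds n and m; array 1 holds the m x n incidence matrix, row by row;
   all other cells are 0. *)
Definition input_mem sys : memory := fun a i =>
  match a, i with
  | 0, Posz 0 => n
  | 0, Posz 1 => m
  | 1, Posz k =>
      [exists j : 'I_n,
        (j == k %% n :> nat)%N && (j \in nth set0 sys (k %/ n)%N)] : nat
  | _, _ => 0
  end.

Definition output_coloring (M : memory) : 'I_n -> int := fun j => M 2 (j : nat).

End SetSystem.

Lemma input_mem_incidence n m (sys : m.-tuple {set 'I_n}) (i : 'I_m) (j : 'I_n) :
  input_mem sys 1 (i * n + j)%N = (j \in tnth sys i : nat).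
Proof.
have n0 : (0 < n)%N by apply: leq_ltn_trans (ltn_ord j).
rewrite /input_mem divnMDl // divn_small // addn0 modnMDl modn_small //.
rewrite (tnth_nth set0); congr (Posz (nat_of_bool _)).
apply/existsP/idP => [[j' /andP[/eqP/val_inj -> //]]|jS].
by exists j; rewrite eqxx.
Qed.

(* Binary logarithm, replaced by 1 at arguments below 2: for |S| = 1 the
   discrepancy is 1 while log |S| = 0.  For |S| >= 2 (hence n >= 2) it is the
   logarithm itself. *)
Definition log2 (R : realType) (x : nat) : R := Num.max 1 (ln x%:R / ln 2).

(* Main.v *)
Require Import Defs.
From mathcomp Require Import all_boot all_order all_algebra.
From mathcomp Require Import boolp reals exp.
From mathcomp Require Import zify ring lra.

(* A deterministic walk, derandomized by a potential, moves x in [-X, X]^n from 0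
   to (almost) a vertex of the cube.  Coordinates near the boundary are frozen.
   A set with more than 8t alive elements is big; sparsity leaves at most one
   big set per eight alive elements.  A small set has the energy
     U_i = c^2 X^2 + (sum_S x)^2 + c sum_S (X^2 - x_j^2),   c ~ p ~ log n,
   and the potential is sum_i U_i^p - h sum_j x_j^2, with a constant for big sets.

   The step direction is, up to rounding, a column j of the inverse of a Gram
   matrix G = I + sum_r c_r v_r v_r^T whose forms v_r penalize the coordinates
   (weighted by their load 16 sum_{i : j in S_i} U_i^(p-1)), the sums over big
   sets, and the first-order changes of the energies of small sets.  Comparing
   the trace n of G G^-1 with the bound 1 on the leverage of each form yields an
   alive j such that 2 D_j (G^-1)_jj >= 1, where D_j = 1 + load_j.  For this column
   the squared first-order changes, weighted by U_i^(p-2), are at most D_j delta_j^2,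
   hence paid for by the decrease of c sum_S (X^2 - x_j^2), and the big sets stay
   balanced.  With the right sign the potential drops by a fixed fraction of
   h E^2, E being the largest entry of a step, so after polynomially many steps
   all coordinates are frozen.

   Then U_i^p <= n (t + 1) (u X^2)^p with u = O(p (t + p)), which for t >= p gives
   |sum_S chi|^2 = O(t p), stronger than required.  If t < p one uses instead the
   Beck-Fiala bound O(t), an invariant of the walk, and if t >= n^2 there is
   nothing to prove.  All computations are exact in integers of polynomial length,
   the adjugate of G being obtained by rank-one updates; no coin is flipped. *)

Set Implicit Arguments.
Unset Strict Implicit.
Unset Printing Implicit Defensive.

Import Order.TTheory GRing.Theory Num.Theory.

Local Open Scope ring_scope.

(** * Rank-one updates and the Gram form *)

(** How the parameters fit: the second-order error of [U_i^p] is about [p^2 U_i^(p-2)] times the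
    squared first-order change. For the pivot column the sum of these errors compares with [p^2]
    times the sum of [U_i^(p-1) dl_j^2] over incident pairs, while the last term of the energy gains
    [p c] times the same sum; so [c] is a large multiple of [p]. The term [c^2 X^2] bounds each
    squared partial derivative by a multiple of [U_i] and keeps [p] times the change of [U_i] below
    [U_i]. With [p] of order log n a [p]-th root turns the power sum into the maximum up to a
    constant, and a set turns small with energy of order [(p^2 + p t) X^2]. The other obstacle is
    integrality: directions are floored, so each form errs by up to the sum of its absolute
    coefficients. [E] is a polynomial so large that the gain from [h sum_j x_j^2] pays for these
    errors. Since [X = (n + 1) E] and a frozen coordinate is within [E] of the boundary, the final
    rounding to signs costs at most [X] per set. *)

Section RankOne.
Variables (R : idomainType) (n : nat) (A : 'M[R]_n) (u : 'cV[R]_n) (v : 'rV[R]_n).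
Hypothesis A0 : \det A != 0.

(** The matrix determinant lemma without division. Eliminate the block matrix [B] in two ways: on
    the right its Schur complement is [A + u v]; on the left the multiplier is scaled by [\adj A]
    and [d], which costs a factor [d ^+ n] that can be cancelled. *)
Lemma det_rank1 : \det (A + u *m v) = \det A + (v *m \adj A *m u) 0 0.
Proof.
set d := \det A; set q := (v *m \adj A *m u) 0 0.
have hq : v *m \adj A *m u = q%:M by rewrite [LHS]mx11_scalar.
pose B := block_mx A u (- v) (1%:M : 'M_1).
have dB : \det B = \det (A + u *m v).
  have : \det (B *m block_mx 1%:M 0 v 1%:M) = \det (A + u *m v).
    rewrite mulmx_block !mulmx1 !mulmx0 mul1mx !add0r addNr.
    by rewrite det_ublock det1 mulr1.
  by rewrite det_mulmx det_lblock !det1 !mulr1.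
have : \det (block_mx (\adj A) 0 (v *m \adj A) (d%:M : 'M_1) *m B)
     = d ^+ n * (d + q).
  rewrite mulmx_block !mul0mx !addr0 mul_adj_mx -/d -mulmxA mul_adj_mx -/d.
  rewrite mul_mx_scalar mul_scalar_mx scalerN subrr hq mulmx1 -raddfD /= addrC.
  by rewrite det_ublock !det_scalar [in X in X * _]/= addrC expr1.
rewrite det_mulmx det_lblock dB det_scalar1 => h.
have ad : \det (\adj A) * d = d ^+ n.
  by rewrite -det_mulmx mul_adj_mx det_scalar.
rewrite ad in h.
exact: (mulfI (expf_neq0 n A0) h).
Qed.

(** Sherman-Morrison with denominators cleared: the right-hand side times [A'] is the scalar matrix
    [d' * d], and multiplying by [\adj A'] leaves a factor [d'] to cancel. *)
Lemma adj_rank1 : \det (A + u *m v) != 0 ->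
  \det A *: \adj (A + u *m v) =
  \det (A + u *m v) *: \adj A - (\adj A *m u) *m (v *m \adj A).
Proof.
set d := \det A; set A' := A + u *m v; set d' := \det A' => d'0.
have e : A' *m (d' *: \adj A - (\adj A *m u) *m (v *m \adj A)) = (d' * d)%:M.
  set q := (v *m \adj A *m u) 0 0.
  have hq : v *m \adj A *m u = q%:M by rewrite [LHS]mx11_scalar.
  have hd' : d' = d + q by rewrite /d' det_rank1.
  rewrite mulmxBr -scalemxAr !mulmxA.
  have -> : A' *m \adj A = d%:M + u *m (v *m \adj A).
    by rewrite mulmxDl mul_mx_adj mulmxA.
  have -> : (d%:M + u *m (v *m \adj A)) *m u = d' *: u.
    by rewrite mulmxDl -mulmxA hq mul_mx_scalar mul_scalar_mx -scalerDl hd'.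
  by rewrite -!scalemxAl -scalerBr mulmxA addrK scale_scalar_mx.
have : \adj A' *m (A' *m (d' *: \adj A - (\adj A *m u) *m (v *m \adj A)))
     = \adj A' *m (d' * d)%:M by rewrite e.
rewrite mulmxA mul_adj_mx -/d' mul_scalar_mx mul_mx_scalar -scalerA => h.
apply/matrixP => i j; apply: (mulfI d'0).
by move/matrixP/(_ i j): h; rewrite !mxE.
Qed.

End RankOne.

Section Gram.
Variables (n : nat) (c : nat -> int) (v : nat -> 'I_n -> int).

Definition gram r : 'M[int]_n :=
  \matrix_(i, j) ((i == j)%:R + \sum_(q < r) c q * (v q i * v q j)).
Definition gdet r := \det (gram r).
Definition gadj r := \adj (gram r).
(** The solution of [G y = w] scaled by the determinant, so that all estimates stay among
    integers. *)
Definition gsol r (w : 'I_n -> int) i := \sum_j gadj r i j * w j.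

Lemma gram_sym r : (gram r)^T = gram r.
Proof.
apply/matrixP => i j; rewrite !mxE eq_sym; congr (_ + _).
by apply: eq_bigr => q _; rewrite [v q j * _]mulrC.
Qed.

Lemma gadj_sym r i j : gadj r i j = gadj r j i.
Proof. by rewrite /gadj -[in LHS](gram_sym r) -trmx_adj mxE. Qed.

Lemma gram_gsol r w i : \sum_j gram r i j * gsol r w j = gdet r * w i.
Proof.
rewrite /gsol; under eq_bigr => j _ do rewrite mulr_sumr.
rewrite exchange_big /=.
transitivity (\sum_k (\sum_j gram r i j * gadj r j k) * w k).
  by apply: eq_bigr => k _; rewrite mulr_suml; apply: eq_bigr => j _; rewrite mulrA.
have E k : \sum_j gram r i j * gadj r j k = gdet r *+ (i == k).
  by have /matrixP/(_ i k) := mul_mx_adj (gram r); rewrite !mxE.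
rewrite (bigD1 i) //= E eqxx big1 ?addr0 // => k ki.
by rewrite E eq_sym (negPf ki) mul0r.
Qed.

Lemma gram_form r (z : 'I_n -> int) :
  \sum_i z i * (\sum_j gram r i j * z j) =
  \sum_i z i ^+ 2 + \sum_(q < r) c q * (\sum_i v q i * z i) ^+ 2.
Proof.
transitivity (\sum_i \sum_j (z i * (i == j)%:R * z j) +
              \sum_i \sum_j \sum_(q < r) c q * ((v q i * z i) * (v q j * z j))).
  rewrite -big_split; apply: eq_bigr => i _ /=.
  rewrite -big_split mulr_sumr; apply: eq_bigr => j _ /=.
  rewrite !mxE mulrDl mulrDr mulrA; congr (_ + _).
  rewrite mulr_suml mulr_sumr; apply: eq_bigr => q _; ring.
congr (_ + _).
  apply: eq_bigr => i _; rewrite (bigD1 i) //= eqxx mulr1 big1 ?addr0 //.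
  by move=> j ji; rewrite eq_sym (negPf ji) mulr0 mul0r.
rewrite (eq_bigr (fun i => \sum_(q < r) \sum_j c q * (v q i * z i * (v q j * z j)))); last first.
  by move=> i _; rewrite exchange_big.
rewrite exchange_big /=; apply: eq_bigr => q _.
rewrite expr2 mulr_suml mulr_sumr; apply: eq_bigr => i _.
by rewrite -mulr_sumr -mulr_sumr.
Qed.

(** Evaluate the quadratic form of G at [y = adj(G) w], where [G y = det(G) w]. Dropping terms on
    the right gives all the leverage and size bounds below. *)
Lemma gsol_form r w :
  gdet r * (\sum_i w i * gsol r w i) =
  \sum_i gsol r w i ^+ 2 + \sum_(q < r) c q * (\sum_i v q i * gsol r w i) ^+ 2.
Proof.
rewrite -gram_form mulr_sumr; apply: eq_bigr => i _.
by rewrite gram_gsol; ring.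
Qed.

Lemma gram0 : gram 0 = 1%:M.
Proof. by apply/matrixP => i j; rewrite !mxE big_ord0 addr0. Qed.

Lemma gdet0 : gdet 0 = 1.
Proof. by rewrite /gdet gram0 det1. Qed.

Lemma gadj0 i j : gadj 0 i j = (i == j)%:R.
Proof. by rewrite /gadj gram0 adj1 mxE. Qed.

Hypothesis c0 : forall q, 0 <= c q.

Lemma gram_psd r (z : 'I_n -> int) :
  0 <= \sum_(q < r) c q * (\sum_i v q i * z i) ^+ 2.
Proof. by apply: sumr_ge0 => q _; rewrite mulr_ge0 ?sqr_ge0. Qed.

Let gramS r : gram r.+1 =
  gram r + (c r *: \col_i v r i) *m (\row_i v r i).
Proof.
apply/matrixP => i j; rewrite !mxE big_ord1 !mxE big_ord_recr /= addrA.
by rewrite mulrA.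
Qed.

(** The rank-one formula needs a nonzero determinant, and positivity of the determinant is proved
    with this formula; the hypothesis breaks the circle and is removed in [gdetS]. *)
Lemma gdetS_aux r : gdet r != 0 ->
  gdet r.+1 = gdet r + c r * \sum_i v r i * gsol r (v r) i.
Proof.
move=> h; rewrite /gdet gramS det_rank1 //; congr (_ + _).
rewrite -mulmxA -scalemxAr -scalemxAr !mxE; congr (_ * _); apply: eq_bigr => i _.
by rewrite !mxE; congr (_ * _); apply: eq_bigr => j _; rewrite !mxE.
Qed.

Lemma gsol_ge0 r w : 0 < gdet r -> 0 <= \sum_i w i * gsol r w i.
Proof.
move=> h; rewrite -(pmulr_rge0 _ h) gsol_form addr_ge0 ?gram_psd //.
by apply: sumr_ge0 => i _; rewrite sqr_ge0.
Qed.

Lemma gdet_gt0 r : 0 < gdet r.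
Proof.
elim: r => [|r ih]; first by rewrite gdet0.
rewrite gdetS_aux ?gt_eqF // ltr_pwDl // mulr_ge0 //; exact: gsol_ge0.
Qed.

Lemma gdetS r : gdet r.+1 = gdet r + c r * \sum_i v r i * gsol r (v r) i.
Proof. by rewrite gdetS_aux // gt_eqF ?gdet_gt0. Qed.

(** The floor division is exact because the new adjugate is again an integer matrix. So the program
    can update the adjugate entrywise without fractions, and no common factors accumulate. *)
Lemma gadjS r i j : gadj r.+1 i j =
  ((gdet r.+1 * gadj r i j - c r * gsol r (v r) i * gsol r (v r) j) %/ gdet r)%Z.
Proof.
have d0 s : gdet s != 0 by rewrite gt_eqF ?gdet_gt0.
suff -> : gdet r.+1 * gadj r i j - c r * gsol r (v r) i * gsol r (v r) j =
  gdet r * gadj r.+1 i j by rewrite mulKz.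
have := @adj_rank1 _ n (gram r) (c r *: \col_i v r i) (\row_i v r i) (d0 r).
rewrite -gramS => /(_ (d0 r.+1))/matrixP/(_ i j);
rewrite [X in X = _]mxE [X in _ = X]mxE [X in _ = X + _]mxE [X in _ = _ + X]mxE.
rewrite [X in _ = _ - X]mxE big_ord1 => ->.
congr (_ - _); rewrite -scalemxAr mxE -mulrA -mulrA; congr (_ * _).
have e1 k : (gadj r *m \col_i v r i) k 0 = gsol r (v r) k.
  by rewrite mxE; apply: eq_bigr => l _; rewrite [X in _ * X]mxE.
rewrite e1; congr (_ * _); rewrite mxE; apply: eq_bigr => l _.
rewrite [X in _ = X * _]mxE [RHS]mulrC; congr (_ * _); exact: gadj_sym.
Qed.

(** The inverse of G is at most the identity. For column [j] of the adjugate, [gsol_form] bounds the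
    squared length by [gdet r * gadj r j j]; the entry [j] itself then gives
    [gadj r j j <= gdet r]. *)
Lemma gadj_le r i j : `|gadj r i j| <= gdet r.
Proof.
have d0 := gdet_gt0 r.
have e k : gsol r (fun l => (l == j)%:R) k = gadj r k j.
  rewrite /gsol (bigD1 j) //= eqxx mulr1 big1 ?addr0 // => l lj.
  by rewrite (negPf lj) mulr0.
have := gsol_form r (fun l => (l == j)%:R).
have -> : \sum_i (i == j)%:R * gsol r (fun l => (l == j)%:R) i = gadj r j j.
  by rewrite (bigD1 j) //= eqxx mul1r e big1 ?addr0 // => l lj; rewrite (negPf lj) mul0r.
have := gram_psd r (gsol r (fun l => (l == j)%:R)).
set P := \sum_(q < r) _ => P0.
under eq_bigr => k _ do rewrite e.
move=> h.
have hk k : gadj r k j ^+ 2 <= gdet r * gadj r j j.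
  rewrite h (bigD1 k) //= -addrA lerDl addr_ge0 // sumr_ge0 // => l _.
  by rewrite sqr_ge0.
have hj := hk j; have hi := hk i.
have jd : gadj r j j <= gdet r.
  rewrite leNgt; apply/negP => l; move: hj; rewrite expr2 leNgt ltr_pM2r ?l //.
  exact: lt_trans l.
have j0 : 0 <= gadj r j j.
  rewrite -(pmulr_rge0 _ d0); apply: le_trans hj; exact: sqr_ge0.
have h2 : gadj r i j ^+ 2 <= gdet r ^+ 2.
  by apply: le_trans hi _; rewrite expr2 ler_pM2l.
rewrite -ler_sqr ?nnegrE ?normr_ge0 //; last exact: ltW.
by rewrite real_normK ?num_real.
Qed.

(** Again that the inverse of G is at most the identity: combine [2 d w_i y_i <= d^2 w_i^2 + y_i^2]
    with the bound on the squared length of [y] from [gsol_form]. *)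
Lemma gsol_le r w :
  \sum_i w i * gsol r w i <= gdet r * \sum_i w i ^+ 2.
Proof.
have d0 := gdet_gt0 r.
have := gsol_form r w; have := gram_psd r (gsol r w).
set P := \sum_(q < r) _; set y := gsol r w; set W := \sum_i w i * _.
move=> P0 h.
have : gdet r * (2 * W) <= gdet r ^+ 2 * (\sum_i w i ^+ 2) + \sum_i y i ^+ 2.
  rewrite !mulr_sumr -big_split /=; apply: ler_sum => i _.
  have := sqr_ge0 (gdet r * w i - y i); nia.
move=> h2; rewrite -(ler_pM2l d0); nia.
Qed.

Lemma gdetS_le r :
  gdet r.+1 <= gdet r * (1 + c r * \sum_i v r i ^+ 2).
Proof.
rewrite gdetS mulrDr mulr1 lerD2l mulrCA ler_wpM2l //; exact: gsol_le.
Qed.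

Lemma gram_trace r :
  \sum_i gadj r i i + \sum_(q < r) c q * \sum_i v q i * gsol r (v q) i =
  n%:R * gdet r.
Proof.
have /(congr1 mxtrace) := mul_mx_adj (gram r).
rewrite mxtrace_scalar -/(gdet r) -[RHS]mulr_natl => <-; rewrite /mxtrace.
under [RHS]eq_bigr => i _.
  rewrite mxE; under eq_bigr => j _ do rewrite mxE mulrDl mulr_suml -/(gadj r).
  rewrite big_split /= (bigD1 i) //= eqxx mul1r big1 ?addr0; last first.
    by move=> j ji; rewrite eq_sym (negPf ji) mul0r.
  over.
rewrite big_split /=; congr (_ + _).
under [RHS]eq_bigr => i _ do rewrite exchange_big.
rewrite exchange_big /=; apply: eq_bigr => q _.
rewrite mulr_sumr; apply: eq_bigr => i _.
rewrite !mulr_sumr; apply: eq_bigr => j _.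
by rewrite gadj_sym; ring.
Qed.

End Gram.

(** * Existence of an alive coordinate of large leverage *)

Section Leverage.
Variables (n : nat) (I : finType) (J : 'I_n -> 'I_n -> int) (d : int).
Variables (D : 'I_n -> int) (c : I -> int) (v : I -> 'I_n -> int).
Variables (A : pred 'I_n) (heavy : pred I).
Let y (w : 'I_n -> int) i := \sum_j J i j * w j.
Hypothesis d_gt0 : 0 < d.
Hypothesis D_gt0 : forall i, 0 < D i.
Hypothesis c_ge0 : forall q, 0 <= c q.
Hypothesis form : forall w,
  d * \sum_i w i * y w i =
  \sum_i D i * y w i ^+ 2 + \sum_q c q * (\sum_i v q i * y w i) ^+ 2.
Hypothesis trace :
  \sum_i D i * J i i + \sum_q c q * \sum_i v q i * y (v q) i = n%:R * d.
Hypothesis v_dead : forall q i, ~~ A i -> v q i = 0.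
Hypothesis light : forall i, A i ->
  16 * \sum_(q | ~~ heavy q) c q * v q i ^+ 2 <= 3 * D i.
Hypothesis few : (8 * #|heavy| <= #|A|)%N.

Let qf_ge0 (z : 'I_n -> int) : 0 <= \sum_q c q * (\sum_i v q i * z i) ^+ 2.
Proof. by apply: sumr_ge0 => q _; rewrite mulr_ge0 ?sqr_ge0. Qed.

Let dq_ge0 (z : 'I_n -> int) : 0 <= \sum_i D i * z i ^+ 2.
Proof. by apply: sumr_ge0 => i _; rewrite mulr_ge0 ?sqr_ge0 ?ltW. Qed.

(** With [a = v_q . y], the term of index [q] in [form] gives [c_q a^2 <= d a]; divide by [a]. *)
Let le1 q : c q * (\sum_i v q i * y (v q) i) <= d.
Proof.
set a := \sum_i _.
have h : c q * a ^+ 2 <= d * a.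
  rewrite /a form (bigD1 q) //= addrCA lerDl addr_ge0 ?dq_ge0 //.
  by apply: sumr_ge0 => k _; rewrite mulr_ge0 ?sqr_ge0.
have [a0|a0] := ltP 0 a; last by apply: le_trans (ltW d_gt0); rewrite mulr_ge0_le0.
by rewrite -(ler_pM2r a0) -mulrA -expr2.
Qed.

Let dead_le i : D i * J i i <= d.
Proof.
pose w j := ((j == i)%:R : int).
have e k : y w k = J k i.
  rewrite /y (bigD1 i) //= /w eqxx mulr1 big1 ?addr0 // => j ji.
  by rewrite (negPf ji) mulr0.
have := form w; rewrite (bigD1 i) //= big1 => [|j ji]; last first.
  by rewrite /w (negPf ji) mul0r.
rewrite /w eqxx mul1r addr0 e => h.
have h2 : D i * J i i ^+ 2 <= d * J i i.
  rewrite h (bigD1 i) //= e -addrA lerDl addr_ge0 //.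
  by apply: sumr_ge0 => k _; rewrite mulr_ge0 ?sqr_ge0 ?ltW.
have [a0|a0] := ltP 0 (J i i); last first.
  by apply: le_trans (ltW d_gt0); rewrite mulr_ge0_le0 // ltW.
by rewrite -(ler_pM2r a0) -mulrA -expr2.
Qed.

(** G dominates its diagonal part D, so [v G^-1 v <= v D^-1 v]: add up [2 v_i z_i <= d v_i^2 / D_i +
    D_i z_i^2 / d] and absorb the last sum by [form]. Rationals serve only to write the quotients by
    [D i]. *)
Let light_le q :
  ((c q * \sum_i v q i * y (v q) i)%:~R : rat) <=
  d%:~R * \sum_(i | A i) (c q * v q i ^+ 2)%:~R / (D i)%:~R.
Proof.
have d0 : (0 : rat) < d%:~R by rewrite ltr0z.
have D0 i : (0 : rat) < (D i)%:~R by rewrite ltr0z.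
rewrite intrM; under [X in _ <= _ * X]eq_bigr => i _ do rewrite intrM -mulrA.
rewrite -mulr_sumr mulrCA ler_wpM2l ?ler0z //.
set z := y (v q); set a := \sum_i _.
have ha : \sum_i D i * z i ^+ 2 <= d * a.
  by rewrite form lerDl qf_ge0.
have h2 : 2 * a%:~R <= d%:~R * (\sum_(i | A i) (v q i ^+ 2)%:~R / (D i)%:~R)
     + (\sum_i D i * z i ^+ 2)%:~R / d%:~R :> rat.
  have -> : a = \sum_(i | A i) v q i * z i.
    by rewrite /a (bigID A) /= [X in _ + X]big1 ?addr0 // => i /v_dead->; rewrite mul0r.
  rewrite !raddf_sum /= mulr_suml [X in _ <= X + _]mulr_sumr.
  rewrite [X in _ <= _ + X](bigID A) /= addrA.
  apply: (@le_trans _ _ (\sum_(i | A i) d%:~R * ((v q i ^+ 2)%:~R / (D i)%:~R)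
    + \sum_(i | A i) (D i * z i ^+ 2)%:~R / d%:~R)); last first.
    rewrite lerDl; apply: sumr_ge0 => i _; rewrite divr_ge0 ?(ltW d0) //.
    by rewrite ler0z mulr_ge0 ?sqr_ge0 ?ltW.
  rewrite -big_split /= mulr_sumr; apply: ler_sum => i _.
  rewrite (intrM _ (D i)) (intrM _ (v q i)) !rmorphXn /=.
  have Di := D0 i.
  have := sqr_ge0 (d%:~R * (v q i)%:~R - (D i)%:~R * (z i)%:~R : rat).
  set X := d%:~R; set V := (v q i)%:~R; set Y := (D i)%:~R; set Z := (z i)%:~R.
  move=> h; rewrite -subr_ge0.
  have -> : X * (V ^+ 2 / Y) + Y * Z ^+ 2 / X - 2 * (V * Z) =
            (X * V - Y * Z) ^+ 2 / (X * Y).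
    by field; rewrite !gt_eqF.
  by rewrite divr_ge0 // mulr_ge0 // ltW.
have h3 : (\sum_i D i * z i ^+ 2)%:~R / d%:~R <= a%:~R :> rat.
  by rewrite ler_pdivrMr // mulrC -intrM ler_int.
lra.
Qed.

(** Otherwise the trace [n d] would be less than the sum of [|A| d / 2] (alive diagonal),
    [(n - |A|) d] (dead diagonal), [|A| d / 8] (heavy forms, at most [d] each) and [3 |A| d / 16]
    (light forms); but 1/2 + 1/8 + 3/16 is below 1. *)
Lemma leverage : (0 < #|A|)%N -> exists2 j, A j & d <= 2 * D j * J j j.
Proof.
move=> A0; have [/existsP[j /andP[Aj hj]]|] :=
  boolP [exists j, A j && (d <= 2 * D j * J j j)]; first by exists j.
rewrite negb_exists => /forallP no; exfalso.
have {}no j : A j -> 2 * (D j * J j j) < d.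
  by move=> Aj; move: (no j); rewrite Aj /= -ltNge mulrA.
have d0 : (0 : rat) < d%:~R by rewrite ltr0z.
have hA : 2 * (\sum_(i | A i) D i * J i i) < #|A|%:R * d.
  rewrite mulr_sumr -sum1_card natr_sum mulr_suml.
  under [X in _ < X]eq_bigr => i _ do rewrite mul1r.
  have /card_gt0P[j Aj] := A0; rewrite (bigD1 j) // [X in _ < X](bigD1 j) //=.
  rewrite ltr_leD ?no //; apply: ler_sum => i /andP[Ai _].
  exact/ltW/no.
have hB : \sum_(i | ~~ A i) D i * J i i <= (n%:R - #|A|%:R) * d.
  have -> : n%:R - #|A|%:R = #|[predC A]|%:R :> int.
    have h := cardC A; rewrite card_ord in h.
    by rewrite -[in X in X - _]h natrD addrC addKr.
  rewrite -sum1_card natr_sum mulr_suml; apply: ler_sum => i _.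
  by rewrite mul1r dead_le.
have hH : 8 * (\sum_(q | heavy q) c q * \sum_i v q i * y (v q) i) <= #|A|%:R * d.
  apply: (@le_trans _ _ (8 * (#|heavy|%:R * d))).
    rewrite ler_wpM2l // -sum1_card natr_sum mulr_suml; apply: ler_sum => q _.
    by rewrite mul1r le1.
  rewrite mulrA ler_pM2r // -natrM ler_nat; exact: few.
have hL : 16 * (\sum_(q | ~~ heavy q) c q * \sum_i v q i * y (v q) i)
    <= 3 * #|A|%:R * d.
  rewrite -(ler_int rat) !intrM raddf_sum /=.
  apply: (@le_trans _ _ (16 * \sum_(q | ~~ heavy q)
     (d%:~R * \sum_(i | A i) (c q * v q i ^+ 2)%:~R / (D i)%:~R))).
    by apply: (ler_wpM2l (ler0n _ 16)); apply: ler_sum => q _; exact: light_le.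
  rewrite -mulr_sumr exchange_big /= mulrCA mulrC (ler_pM2r d0).
  rewrite -sum1_card natr_sum raddf_sum /= !mulr_sumr.
  apply: ler_sum => i Ai; have Di : (0 : rat) < (D i)%:~R by rewrite ltr0z.
  rewrite -mulr_suml mulrA (ler_pdivrMr _ _ Di).
  rewrite -raddf_sum /= mulr1.
  have := light Ai; rewrite -(ler_int rat) !intrM; exact.
move: trace; rewrite (bigID A) (bigID heavy) /=.
have a0 : 0 < #|A|%:R * d by rewrite mulr_gt0 // ltr0n.
move: hA hB hH hL a0; rewrite mulrBl -(mulrA 3).
move: (#|A|%:R * d) (n%:R * d) (\sum_(i | A i) _) (\sum_(i | ~~ A i) _).
move: (\sum_(q | heavy q) _) (\sum_(q | ~~ heavy q) _) => *; lia.
Qed.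
End Leverage.

(** * The potential *)

(** Second-order Taylor bound with the generous coefficient [p^2], [p] being the exponent. In the
    induction the surplus is [V D^2 ((q + 1) U - q (q D))], nonnegative since [q D <= U]. *)
Lemma pow_increment (k : nat) (U D : int) : 0 < U -> k.+2%:R * `|D| <= U ->
  (U + D) ^+ k.+2 <=
  U ^+ k.+2 + k.+2%:R * (U ^+ k.+1 * D) + k.+2%:R ^+ 2 * (U ^+ k * D ^+ 2).
Proof.
move=> U0; elim: k => [|k ih] h.
  rewrite !expr0 mul1r; have := sqr_ge0 D; rewrite !expr1; nia.
have Dk : k.+2%:R * `|D| <= U.
  by apply: le_trans h; rewrite ler_wpM2r // ler_nat.
have UD : 0 <= U + D.
  have : `|D| <= U by apply: le_trans Dk; rewrite ler_peMl // ler1n.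
  by move=> /ler_normlP[]; lia.
rewrite exprS; apply: le_trans (ler_wpM2l UD (ih Dk)) _.
have e : k.+3%:R = k.+2%:R + 1 :> int by rewrite -(natrD _ _ 1) addn1.
have q2 : (2 : int) <= k.+2%:R by rewrite ler_nat.
have qD : k.+2%:R * D <= U.
  by apply: le_trans Dk; rewrite ler_wpM2l // ler_norm.
rewrite e !(exprS U k.+2) !(exprS U k.+1) !(exprS U k).
have := exprn_ge0 k (ltW U0); move: (U ^+ k) => V V0.
move: q2 qD; move: (k.+2%:R : int) => q q2 qD.
rewrite -subr_ge0.
have -> : U * (U * (U * V)) + (q + 1) * (U * (U * V) * D) + (q + 1) ^+ 2 * (U * V * D ^+ 2)
  - (U + D) * (U * (U * V) + q * (U * V * D) + q ^+ 2 * (V * D ^+ 2))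
  = V * D ^+ 2 * ((q + 1) * U - q * (q * D)) by ring.
apply: mulr_ge0; first by rewrite mulr_ge0 ?sqr_ge0.
nia.
Qed.

(** Here [D] is the squared length of a step, [y] the square of its pivot entry and [W] the total
    weight. What the small sets do not pay themselves is paid by [h D]: [h] is at least [E ^ 2],
    which beats [p ^ 2] times three factors n + m + 1, two for the [n ^ 2] of the rounding error and
    one for [W]. *)
Lemma step_budget (n m : nat) (p E X h W y D : int) :
  2 <= p -> 64 * p * (n + m + 1)%:R ^+ 3 <= E -> E <= X -> X ^+ 2 <= h ->
  0 <= W -> W <= (n + m)%:R * h -> y <= D -> E ^+ 2 <= D ->
  96 * p ^+ 2 * y + 24 * p ^+ 2 * (4 + (64 + 6 * n%:R ^+ 2) * W)
    + h * E ^+ 2 <= 2 * (h * D).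
Proof.
move=> p2 hE EX hX W0 Wh yD ED.
have : (1 : int) <= (n + m + 1)%:R by rewrite ler1n addn1.
have : n%:R + m%:R + 1 = (n + m + 1)%:R :> int by rewrite !natrD.
move: hE; move: ((n + m + 1)%:R : int) => s hE sE s1.
have n0 : (0 : int) <= n%:R by []; have m0 : (0 : int) <= m%:R by [].
have p0 : 0 <= p by lra.
have pp : 0 <= p ^+ 2 by exact: sqr_ge0.
have s0 : 0 <= s by lra.
have s3 : 1 <= s ^+ 3 by rewrite exprn_ege1.
have Z0 : 0 <= s ^+ 3 by rewrite exprn_ge0.
have E0 : 0 <= E.
  by apply: le_trans hE; do 2!apply: mulr_ge0 => //; rewrite ler0n.
have X0 := le_trans E0 EX.
have PZ : 0 <= p ^+ 2 * s ^+ 3 by rewrite mulr_ge0.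
have EP : 4096 * (p ^+ 2 * s ^+ 3) <= E ^+ 2.
  apply: (@le_trans _ _ ((64 * p * s ^+ 3) ^+ 2)).
    have : p ^+ 2 * s ^+ 3 <= p ^+ 2 * s ^+ 3 * s ^+ 3 by rewrite ler_peMr.
    by move: (s ^+ 3) => Z; lra.
  by rewrite ler_pXn2r ?nnegrE // mulr_ge0 // mulr_ge0.
have P1 : p ^+ 2 <= p ^+ 2 * s ^+ 3 by rewrite ler_peMr.
have EX2 : E ^+ 2 <= X ^+ 2 by rewrite ler_pXn2r.
have Eh := le_trans EX2 hX.
have h0 : 0 <= h by apply: le_trans hX; exact: sqr_ge0.
have D0 : 0 <= D by apply: le_trans ED; exact: sqr_ge0.
have b1 : 4096 * p ^+ 2 * D <= h * D.
  apply: (ler_wpM2r D0); apply: le_trans Eh.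
  by apply: le_trans EP; apply: (ler_wpM2l _ P1); rewrite ler0n.
have b2 : p ^+ 2 * y <= p ^+ 2 * D by exact: ler_wpM2l.
have b3 : h * E ^+ 2 <= h * D by exact: ler_wpM2l.
have n2 : (n%:R : int) ^+ 2 <= s ^+ 2 by rewrite ler_pXn2r ?nnegrE // -sE; clear - n0 m0; lra.
have s2 : 1 <= s ^+ 2 by rewrite exprn_ege1.
have b4 : (64 + 6 * n%:R ^+ 2) * W <= 70 * (s ^+ 3 * h).
  apply: (@le_trans _ _ ((70 * s ^+ 2) * (s * h))); last first.
    by rewrite [s ^+ 3]exprSr -!mulrA.
  apply: ler_pM;
    [by have := sqr_ge0 (n%:R : int); clear; lra|by []|by clear - n2 s2; lra|].
  apply: le_trans Wh _; rewrite natrD -sE; apply: ler_wpM2r => //; clear; lra.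
have h1 : 1 <= h.
  apply: le_trans Eh; rewrite exprn_ege1 //; apply: le_trans hE.
  apply: (@le_trans _ _ (64 * p)); first by clear - p2; lra.
  by rewrite ler_peMr // mulr_ge0.
have b5 : 4 + (64 + 6 * n%:R ^+ 2) * W <= 74 * (s ^+ 3 * h).
  have q : 1 * 1 <= s ^+ 3 * h by apply: ler_pM.
  clear - q b4; lra.
have b6 := ler_wpM2l pp b5.
have b7 := ler_wpM2l h0 EP.
have b8 : 0 <= h * (p ^+ 2 * s ^+ 3) by exact: mulr_ge0.
clear - b1 b2 b3 b6 b7 b8 ED h0; lra.
Qed.

(* [u * X ^+ 2] bounds the energy of a set at the moment it becomes small, and the
   constant [h * X ^+ 2] by which big sets enter the potential is its [p]-th power. *)
Record params (n m t k : nat) (E X c u h p : int) : Prop := Params {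
  par_p : p = k.+2%:R;
  par_E : 64 * p * (n + m + 1)%:R ^+ 3 <= E;
  par_X : X = (n%:R + 1) * E;
  par_c : c = 1024 * p;
  par_u : u = (c + 1) ^+ 2 + 8 * c * t%:R;
  par_h : h = (u * X ^+ 2) ^+ k.+1 * u
}.

Module Potential.
Section Potential.
Variables (n m : nat) (sys : m.-tuple {set 'I_n}) (t k : nat).
Variables E X c u h p : int.
Implicit Types (x dl : 'I_n -> int) (i : 'I_m) (j : 'I_n).
Local Notation S := (tnth sys).

Definition psum x i := \sum_(j in S i) x j.
Definition ener x i := c ^+ 2 * X ^+ 2 + psum x i ^+ 2 + c * \sum_(j in S i) (X ^+ 2 - x j ^+ 2).
Definition alive x j := `|x j| + E < X.
Definition small x i := (#|[set j in S i | alive x j]| <= 8 * t)%N.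
Definition wgt x i := if small x i then ener x i ^+ k.+1 else 0.
Definition wgt0 x i := if small x i then ener x i ^+ k else 0.
Definition ind x i j : int := (alive x j && (j \in S i))%:R.
(** Half the gradient of the energy of set [i], cut down to alive coordinates. *)
Definition vec x i j : int := ind x i j * (psum x i - c * x j).
(** The factor 16 serves the hypothesis [light] of [leverage]: at an element a small set contributes
    at most its weight through [ind] and twice its weight through [vec], three weights in all. *)
Definition load x j : int := 16 * (\sum_(i | alive x j && (j \in S i)) wgt x i).
(** [E ^ 2] times the trace of the diagonal part of the Gram matrix: large enough that the pivot
    column, scaled to have largest entry [E], changes the sum over a big set by at most 1 before
    rounding. *)
Definition bigw x := E ^+ 2 * \sum_j (load x j + 1).
(** Without the empty sets at most [n * t] terms remain, whatever [m] is. A big set is charged in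
    advance the most it can have on becoming small, so that this transition never raises the
    potential. *)
Definition pot x := \sum_(i | S i != set0) (if small x i then ener x i ^+ k.+2 else h * X ^+ 2).
Definition psi x := pot x - h * \sum_j x j ^+ 2.

(** [gd_form] bounds the second-order part of the potential by the pivot; the [+ 1] and the term in
    [n ^ 2] are the price of integral entries. The sum in [gd_sign] is half the derivative of [psi]
    along [dl]. *)
Record good_dir x dl : Prop := GoodDir {
  gd_dead : forall j, ~~ alive x j -> dl j = 0;
  gd_le : forall j, `|dl j| <= E;
  gd_full : exists j, `|dl j| = E;
  gd_form : exists j,
    \sum_i (wgt x i * (\sum_(j in S i) dl j) ^+ 2
           + wgt0 x i * (\sum_j vec x i j * dl j) ^+ 2) <=
    4 * ((load x j + 1) * (dl j ^+ 2 + 1))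
      + 6 * n%:R ^+ 2 * \sum_(i | S i != set0) wgt x i;
  gd_big : forall i, ~~ small x i -> `|\sum_(j in S i) dl j| <= (n + 1)%:R;
  gd_sign : \sum_j dl j * (p * (\sum_i wgt x i * vec x i j) - h * x j) <= 0
}.

Hypothesis P : params n m t k E X c u h p.
Let p_eq := par_p P.
Let E_ge := par_E P.
Let X_eq := par_X P.
Let c_eq := par_c P.
Let u_eq := par_u P.
Let h_eq := par_h P.

Lemma p_ge2 : 2 <= p. Proof. by rewrite p_eq ler_nat. Qed.

Lemma s_ge1 : (1 : int) <= (n + m + 1)%:R. Proof. by rewrite ler1n addn1. Qed.

Lemma E_ge64p : 64 * p <= E.
Proof.
apply: le_trans E_ge; have := p_ge2 => p2.
by rewrite ler_peMr ?exprn_ege1 ?s_ge1 //; lra.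
Qed.

Lemma E_gt0 : 0 < E. Proof. have := E_ge64p; have := p_ge2; lra. Qed.

Lemma X_ge : n%:R * E + E <= X. Proof. by rewrite X_eq mulrDl mul1r. Qed.

Lemma X_geE : E <= X.
Proof.
have := X_ge; have : 0 <= n%:R * E by rewrite mulr_ge0 ?ler0n // ltW ?E_gt0.
lra.
Qed.

Lemma X_gt0 : 0 < X. Proof. have := X_geE; have := E_gt0; lra. Qed.

Lemma c_gt0 : 0 < c. Proof. rewrite c_eq; have := p_ge2; lra. Qed.

Lemma u_ge1 : 1 <= u.
Proof.
have c0 := c_gt0; have c2 := sqr_ge0 c.
have : 0 <= c * t%:R by rewrite mulr_ge0 ?ler0n // ltW.
rewrite u_eq -mulrA sqrrD1; move: (c * t%:R) (c ^+ 2) c2 => T U; lra.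
Qed.

Lemma hX : h * X ^+ 2 = (u * X ^+ 2) ^+ k.+2.
Proof. by rewrite h_eq [RHS]exprSr mulrA. Qed.

Lemma h_geX : X ^+ 2 <= h.
Proof.
have u1 := u_ge1; have X0 := X_gt0.
have X1 : 1 <= X ^+ 2 by rewrite exprn_ege1 // -gtz0_ge1.
have uX : X ^+ 2 <= u * X ^+ 2 by rewrite ler_peMl // sqr_ge0.
have uX1 := le_trans X1 uX.
rewrite h_eq; apply: (@le_trans _ _ ((u * X ^+ 2) ^+ k.+1)).
  by rewrite [_ ^+ k.+1]exprS; apply: le_trans uX _; rewrite ler_peMr ?exprn_ege1 // (le_trans _ uX1).
by rewrite ler_peMr // exprn_ge0 //; lra.
Qed.

Section Box.
Variable x : 'I_n -> int.
Hypothesis xX : forall j, `|x j| <= X.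

Lemma sq_le j : x j ^+ 2 <= X ^+ 2.
Proof. have := xX j; have := X_gt0; rewrite ler_norml => ? /andP[]; nia. Qed.

Lemma card_le i (f : 'I_n -> int) b : (forall j, f j <= b) -> 0 <= b ->
  \sum_(j in S i) f j <= n%:R * b.
Proof.
move=> fb b0; apply: (@le_trans _ _ (\sum_(j in S i) b)).
  by apply: ler_sum => j _; exact: fb.
rewrite sumr_const -[b *+ _]mulr_natl ler_wpM2r // ler_nat.
by apply: leq_trans (max_card _) _; rewrite card_ord.
Qed.

Lemma ener_ge i : c ^+ 2 * X ^+ 2 + psum x i ^+ 2 <= ener x i.
Proof.
rewrite /ener lerDl mulr_ge0 ?(ltW c_gt0) // sumr_ge0 // => j _.
by rewrite subr_ge0 sq_le.
Qed.

Lemma ener_geX i : c ^+ 2 * X ^+ 2 <= ener x i.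
Proof. by apply: le_trans (ener_ge i); rewrite lerDl sqr_ge0. Qed.

Lemma ener_ge_X2 i : X ^+ 2 <= ener x i.
Proof.
apply: le_trans (ener_geX i); have := c_gt0; have := X_gt0 => *.
by rewrite ler_peMl ?sqr_ge0 // exprn_ege1 // -gtz0_ge1.
Qed.

Lemma ener_gt0 i : 0 < ener x i.
Proof. by apply: lt_le_trans (ener_ge_X2 i); rewrite exprn_gt0 ?X_gt0. Qed.

Lemma wgt_ge0 i : 0 <= wgt x i.
Proof. by rewrite /wgt; case: ifP => // _; rewrite exprn_ge0 ?(ltW (ener_gt0 i)). Qed.

Lemma wgt0_ge0 i : 0 <= wgt0 x i.
Proof. by rewrite /wgt0; case: ifP => // _; rewrite exprn_ge0 ?(ltW (ener_gt0 i)). Qed.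

Lemma wgtE i : wgt x i = wgt0 x i * ener x i.
Proof. by rewrite /wgt /wgt0; case: ifP; rewrite ?mul0r // exprSr. Qed.

Lemma load_ge0 j : 0 <= load x j.
Proof. by rewrite mulr_ge0 // sumr_ge0 // => i _; exact: wgt_ge0. Qed.

(** This is what the term [c ^ 2 X ^ 2] of the energy is for: it covers [c ^ 2 x_j ^ 2]. *)
Lemma vec_sq_le i j : (psum x i - c * x j) ^+ 2 <= 2 * ener x i.
Proof.
have := ener_ge i; have := sq_le j; have := sqr_ge0 (psum x i + c * x j).
set y := x j; set s := psum x i; set e := ener x i => h1 h2 h3.
have h4 : c ^+ 2 * y ^+ 2 <= c ^+ 2 * X ^+ 2 by rewrite ler_wpM2l ?sqr_ge0.
lra.
Qed.

(* One step of a single small set; [a], [s], [e] are the first-order change,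
   the change of the partial sum and the energy of the direction on the set. *)
Lemma set_increment i dl :
  (forall j, ~~ alive x j -> dl j = 0) -> (forall j, `|dl j| <= E) ->
  forall a s e U,
  a = \sum_j vec x i j * dl j -> s = \sum_(j in S i) dl j ->
  e = \sum_(j in S i) dl j ^+ 2 -> U = ener x i ->
  ener (fun j => x j + dl j) i ^+ k.+2 <=
  U ^+ k.+2 + 2 * p * (U ^+ k.+1 * a)
  + 12 * p ^+ 2 * (U ^+ k.+1 * s ^+ 2 + U ^+ k * a ^+ 2)
  - 824 * p ^+ 2 * (U ^+ k.+1 * e).
Proof.
move=> dd dE a s e U adef sdef edef Udef.
have aE : a = psum x i * s - c * \sum_(j in S i) x j * dl j.
  rewrite adef sdef !mulr_sumr -sumrB (bigID (mem (S i))) /= [X in _ + X]big1 ?addr0.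
    apply: eq_bigr => j jS; rewrite /vec /ind jS andbT.
    have [al|/dd->] := boolP (alive x j); last by rewrite !mulr0 subr0.
    by rewrite mul1r; ring.
  by move=> j /negPf jS; rewrite /vec /ind jS andbF !mul0r.
have DU : ener (fun j => x j + dl j) i = U + (2 * a + s ^+ 2 - c * e).
  rewrite Udef /ener /psum big_split /= -sdef -/(psum x i) aE.
  have -> : \sum_(j in S i) (X ^+ 2 - (x j + dl j) ^+ 2) =
     \sum_(j in S i) (X ^+ 2 - x j ^+ 2) - 2 * (\sum_(j in S i) x j * dl j) - e.
    rewrite edef mulr_sumr -!sumrB; apply: eq_bigr => j _; ring.
  by ring.
have E0 := E_gt0; have c0 := c_gt0; have X0 := X_gt0; have p2 := p_ge2.
have n0 : (0 : int) <= n%:R by rewrite ler0n.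
have nE : n%:R * E <= X by have := X_ge; lra.
have sE : `|s| <= X.
  rewrite sdef.  apply: le_trans (ler_norm_sum _ _ _) _; apply: le_trans nE.
  by apply: card_le => //; exact: ltW.
have e0 : 0 <= e by rewrite edef; apply: sumr_ge0 => j _; rewrite sqr_ge0.
have eE : e <= X ^+ 2.
  rewrite edef.  apply: (@le_trans _ _ (n%:R * E ^+ 2)).
    apply: card_le => [j|]; last exact: sqr_ge0.
    have := dE j; rewrite ler_norml => /andP[]; nra.
  rewrite X_eq; nra.
have aX : `|a| <= X * (`|psum x i| + c * X).
  rewrite adef.  apply: (@le_trans _ _ (n%:R * (E * (`|psum x i| + c * X)))).
    apply: le_trans (ler_norm_sum _ _ _) _.
    apply: (@le_trans _ _ (\sum_(j < n) (E * (`|psum x i| + c * X)))); last first.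
      by rewrite sumr_const card_ord mulr_natl.
    apply: ler_sum => j _; rewrite normrM mulrC; apply: ler_pM => //.
    rewrite /vec normrM; apply: (@le_trans _ _ (1 * `|psum x i - c * x j|)).
      by rewrite ler_wpM2r // /ind; case: (_ && _).
    rewrite mul1r; apply: le_trans (ler_normB _ _) _; rewrite lerD2l normrM.
    by rewrite (gtr0_norm c0) ler_wpM2l // ltW.
  rewrite mulrA ler_wpM2r // addr_ge0 // mulr_ge0 ?ltW //.
have U0 : 0 < U by rewrite Udef; exact: ener_gt0 i.
have UX : c ^+ 2 * X ^+ 2 <= U by rewrite Udef; exact: ener_geX i.
have Us : c ^+ 2 * X ^+ 2 + psum x i ^+ 2 <= U by rewrite Udef; exact: ener_ge i.
have ps : `|psum x i| ^+ 2 = psum x i ^+ 2 by rewrite real_normK ?num_real.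
set D := 2 * a + s ^+ 2 - c * e.
have s2 : s ^+ 2 <= X ^+ 2.
  move: sE; rewrite ler_norml => /andP[]; nra.
have cp := c_eq.
(* The factor 1024 turns [p] into [c], so that every term compares with [c ^ 2 X ^ 2 + psum ^ 2],
   which is at most [U]; the total is 5 [U]. *)
have pD : p * `|D| <= U.
  have h1 : `|D| <= 2 * `|a| + s ^+ 2 + c * e.
    rewrite /D; apply: le_trans (ler_normB _ _) _.
    rewrite [`|c * e|]ger0_norm ?mulr_ge0 ?(ltW c0) // lerD2r.
    apply: le_trans (ler_normD _ _) _; rewrite normrM [`|2|]ger0_norm //.
    by rewrite [`|s ^+ 2|]ger0_norm ?sqr_ge0.
  have h2 : 1024 * (p * `|D|) <= c * (2 * (X * (`|psum x i| + c * X)) + X ^+ 2 + c * X ^+ 2).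
    rewrite mulrA -cp ler_wpM2l ?(ltW c0) //; apply: le_trans h1 _.
    have : c * e <= c * X ^+ 2 by rewrite ler_wpM2l // ltW.
    lra.
  have h3 : 2 * (c * X * `|psum x i|) <= c ^+ 2 * X ^+ 2 + psum x i ^+ 2.
    have := sqr_ge0 (c * X - `|psum x i|); rewrite -ps; lra.
  have h4 : c * X ^+ 2 <= c ^+ 2 * X ^+ 2 by rewrite ler_wpM2r ?sqr_ge0 //; nra.
  have h5 : c * (2 * (X * (`|psum x i| + c * X)) + X ^+ 2 + c * X ^+ 2) =
     2 * (c * X * `|psum x i|) + 3 * (c ^+ 2 * X ^+ 2) + c * X ^+ 2 by ring.
  move: h2; rewrite h5; lra.
rewrite DU; rewrite p_eq in pD; apply: le_trans (pow_increment U0 pD) _.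
rewrite -p_eq -/D.
have V0 : 0 <= U ^+ k by rewrite exprn_ge0 // ltW.
have V10 : 0 <= U ^+ k.+1 by rewrite exprn_ge0 // ltW.
have VV : U ^+ k.+1 = U ^+ k * U by rewrite exprSr.
have D2 : D ^+ 2 <= 3 * (4 * a ^+ 2 + s ^+ 2 * s ^+ 2 + c ^+ 2 * e ^+ 2).
  have := sqr_ge0 (2 * a - s ^+ 2); have := sqr_ge0 (2 * a + c * e).
  have := sqr_ge0 (s ^+ 2 + c * e); rewrite /D; nra.
have t1 : p ^+ 2 * (s ^+ 2 * s ^+ 2) <= U * s ^+ 2.
  rewrite mulrA ler_wpM2r ?sqr_ge0 //.
  apply: (@le_trans _ _ (p ^+ 2 * X ^+ 2)); first by rewrite ler_wpM2l ?sqr_ge0.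
  by apply: le_trans UX; rewrite ler_wpM2r ?sqr_ge0 //; nra.
have t2 : 3 * (c ^+ 2 * e ^+ 2) <= 3 * (U * e).
  rewrite ler_wpM2l // expr2 mulrA ler_wpM2r //.
  by apply: le_trans UX; rewrite ler_wpM2l ?sqr_ge0.
have F : p ^+ 2 * (U ^+ k * D ^+ 2) <=
   12 * p ^+ 2 * (U ^+ k * a ^+ 2) + 3 * (U ^+ k.+1 * s ^+ 2)
   + 3 * p ^+ 2 * (U ^+ k.+1 * e).
  apply: (@le_trans _ _ (U ^+ k * (p ^+ 2 * (3 * (4 * a ^+ 2 + s ^+ 2 * s ^+ 2 + c ^+ 2 * e ^+ 2))))).
    by rewrite mulrCA ler_wpM2l // ler_wpM2l ?sqr_ge0.
  rewrite VV.
  have -> : 12 * p ^+ 2 * (U ^+ k * a ^+ 2) + 3 * (U ^+ k * U * s ^+ 2)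
   + 3 * p ^+ 2 * (U ^+ k * U * e) = U ^+ k * (12 * p ^+ 2 * a ^+ 2 + 3 * (U * s ^+ 2) + p ^+ 2 * (3 * (U * e))) by ring.
  apply: ler_wpM2l => //.
  have : p ^+ 2 * (3 * (c ^+ 2 * e ^+ 2)) <= p ^+ 2 * (3 * (U * e)).
    by rewrite ler_wpM2l ?sqr_ge0.
  lra.
have We : 0 <= U ^+ k.+1 * e by rewrite mulr_ge0.
have Ws : 0 <= U ^+ k.+1 * s ^+ 2 by rewrite mulr_ge0 ?sqr_ge0.
(* The term [- c e] of [D] yields the 1024, of which [F] takes back 3. The 824 of the statement is a
   safe remainder, and [psi_step] will need 12 * 64 = 768. *)
have -> : p * (U ^+ k.+1 * D) = 2 * p * (U ^+ k.+1 * a) + p * (U ^+ k.+1 * s ^+ 2)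
   - 1024 * p ^+ 2 * (U ^+ k.+1 * e) by rewrite /D cp; ring.
have g1 : (p + 3) * (U ^+ k.+1 * s ^+ 2) <= 12 * p ^+ 2 * (U ^+ k.+1 * s ^+ 2).
  by rewrite ler_wpM2r //; nra.
have g2 : 0 <= p ^+ 2 * (U ^+ k.+1 * e) by rewrite mulr_ge0 ?sqr_ge0.
move: F g1 g2; rewrite mulrDl mulrDr.
move: (U ^+ k * _) (U ^+ k.+1 * s ^+ 2) (U ^+ k.+1 * e) (U ^+ k.+1 * a) => A1 A2 A3 A4.
lra.
Qed.


(** The origin of [u]. At most [8 t] alive elements have gap at most [X ^ 2] each; a frozen one has
    gap at most [2 X E], which adds up to at most [2 X ^ 2]. The total is [c ^ 2 + 1 + c (8 t + 2)]
    times [X ^ 2]. *)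
Lemma ener_entry i : small x i -> `|psum x i| <= X -> ener x i <= u * X ^+ 2.
Proof.
move=> sm ps; have X0 := X_gt0; have E0 := E_gt0; have c0 := c_gt0.
have h1 : \sum_(j in S i) (X ^+ 2 - x j ^+ 2) <= (8 * t)%:R * X ^+ 2 + n%:R * (2 * X * E).
  apply: (@le_trans _ _ (\sum_(j in S i) ((alive x j)%:R * X ^+ 2 + 2 * X * E))).
    apply: ler_sum => j _; have := sqr_ge0 (x j).
    have [al|] := boolP (alive x j); first by have := mulr_gt0 X0 E0 => /=; lra.
    rewrite /alive -leNgt mul0r add0r => hd _.
    have := xX j; rewrite -(@real_normK _ (x j)) ?num_real //; nra.
  rewrite big_split /= lerD //.
    rewrite -mulr_suml ler_wpM2r ?sqr_ge0 // -natr_sum ler_nat.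
    apply: leq_trans sm; rewrite -sum1dep_card [X in (_ <= X)%N]big_mkcond /=.
    rewrite big_mkcond /=; apply: leq_sum => j _.
    by case: (j \in S i); case: (alive x j).
  apply: card_le => //; rewrite mulr_ge0 ?ltW //; lra.
have nE : n%:R * E <= X by have := X_ge; lra.
have h2 : n%:R * (2 * X * E) <= 2 * X ^+ 2.
  have -> : n%:R * (2 * X * E) = 2 * X * (n%:R * E) by ring.
  by have := ler_wpM2l (ltW X0) nE; lra.
have h3 : psum x i ^+ 2 <= X ^+ 2.
  by move: ps; rewrite ler_norml => /andP[]; nra.
have h4 := le_trans h1 (lerD (lexx _) h2).
have h5 := ler_wpM2l (ltW c0) h4.
rewrite natrM in h5.
rewrite /ener u_eq; move: h5; set q := \sum_(j in _) _; lra.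
Qed.

End Box.

Section Step.
Variables (x dl : 'I_n -> int).
Hypothesis xX : forall j, `|x j| <= X.
Hypothesis gd : good_dir x dl.
Let x' j := x j + dl j.

Lemma alive_step j : alive x' j -> alive x j.
Proof. by apply: contraLR => hd; rewrite /alive /x' (gd_dead gd hd) addr0. Qed.

Lemma small_step i : small x i -> small x' i.
Proof.
apply: leq_trans; apply: subset_leq_card; apply/subsetP => j.
by rewrite !inE => /andP[-> /alive_step].
Qed.

Lemma box_step j : `|x' j| <= X.
Proof.
have [al|hd] := boolP (alive x j); last by rewrite /x' (gd_dead gd hd) addr0.
apply: le_trans (ler_normD _ _) _; apply: le_trans (ltW al).
by rewrite lerD2l (gd_le gd).
Qed.

Hypothesis drift : forall i, ~~ small x i -> `|psum x' i| <= X.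

Let W := \sum_(i | S i != set0) wgt x i.
Let a i := \sum_j vec x i j * dl j.
Let s i := \sum_(j in S i) dl j.
Let e i := \sum_(j in S i) dl j ^+ 2.

Lemma empty_sum i (f : 'I_n -> int) : S i = set0 -> \sum_(j in S i) f j = 0.
Proof. by move=> ->; rewrite big_set0. Qed.

(** A small set stays small and obeys [set_increment]; a set that stays big is constant; a set that
    turns small has partial sum at most [X] by [drift], hence at most the energy it was charged
    for. *)
Lemma pot_increment : pot x' <= pot x + 2 * p * (\sum_i wgt x i * a i)
  + 12 * p ^+ 2 * (\sum_i (wgt x i * s i ^+ 2 + wgt0 x i * a i ^+ 2))
  - 824 * p ^+ 2 * (\sum_i wgt x i * e i).
Proof.
have ne (f : 'I_m -> int) : (forall i, S i = set0 -> f i = 0) ->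
    \sum_i f i = \sum_(i | S i != set0) f i.
  move=> f0; rewrite (bigID (fun i => S i != set0)) /= [X in _ + X]big1 ?addr0 //.
  by move=> i /negPn/eqP/f0.
have a0 i : S i = set0 -> a i = 0.
  by move=> h0; rewrite /a big1 // => j _; rewrite /vec /ind h0 inE andbF !mul0r.
rewrite (ne (fun i => wgt x i * a i)) => [|i /a0->]; last by rewrite mulr0.
rewrite (ne (fun i => wgt x i * e i)) => [|i h0]; last by rewrite /e empty_sum ?mulr0.
rewrite (ne (fun i => wgt x i * s i ^+ 2 + wgt0 x i * a i ^+ 2)) => [|i h0]; last first.
  by rewrite a0 // /s empty_sum // !expr0n !mulr0 addr0.
rewrite /pot !mulr_sumr -!big_split -sumrB /=; apply: ler_sum => i _.
have [sm|bg] := boolP (small x i).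
  rewrite (small_step sm) /wgt /wgt0 sm.
  exact: (set_increment xX (gd_dead gd) (gd_le gd)).
rewrite /wgt /wgt0 (negPf bg) !(mul0r, mulr0, addr0, subr0).
case: ifP => // sm; rewrite hX.
rewrite ler_pXn2r ?nnegrE //.
- by apply: ener_entry => //; [exact: box_step|exact: drift].
- by apply/ltW/ener_gt0; exact: box_step.
by rewrite mulr_ge0 ?sqr_ge0 //; apply: le_trans u_ge1.
Qed.

(** The first-order part is settled by [gd_sign]. The pivot satisfies
    [load * dl_j ^ 2 <= 16 sum_i wgt_i e_i], because the sets counted in its load contain it; so the
    main second-order error is absorbed by the decrease of the energies, and [step_budget] covers
    the rest. *)
Lemma psi_step : pot x <= (n + m)%:R * (h * X ^+ 2) ->
  2 * psi x' + h * E ^+ 2 <= 2 * psi x.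
Proof.
move=> hpot.
have E0 := E_gt0; have X0 := X_gt0; have p2 := p_ge2.
have hX2 := h_geX.
have W0 : 0 <= W by apply: sumr_ge0 => i _; exact: (wgt_ge0 xX).
have WX : W * X ^+ 2 <= pot x.
  rewrite /W /pot mulr_suml; apply: ler_sum => i _.
  rewrite /wgt; case: ifP => _; last first.
    by rewrite mul0r mulr_ge0 ?sqr_ge0 // (le_trans (sqr_ge0 X)).
  rewrite [X in _ <= X]exprSr ler_wpM2l ?(ener_ge_X2 xX) // exprn_ge0 // ltW //.
  exact: (ener_gt0 xX).
have Wh : W <= (n + m)%:R * h.
  rewrite -(@ler_pM2r _ (X ^+ 2)) ?exprn_gt0 // -mulrA; exact: le_trans hpot.
have [j0 hform] := gd_form gd; rewrite -/W in hform.
set y := dl j0 ^+ 2 in hform.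
have y0 : 0 <= y by exact: sqr_ge0.
have yE : y <= \sum_j dl j ^+ 2.
  by rewrite (bigD1 j0) //= lerDl sumr_ge0 // => j _; rewrite sqr_ge0.
have EE : E ^+ 2 <= \sum_j dl j ^+ 2.
  have [j1 <-] := gd_full gd; rewrite real_normK ?num_real //.
  by rewrite (bigD1 j1) //= lerDl sumr_ge0 // => j _; rewrite sqr_ge0.
have l1 : load x j0 <= 16 * W.
  rewrite /load ler_wpM2l // big_mkcond [X in _ <= X]big_mkcond /=.
  apply: ler_sum => i _; case: ifP => [/andP[_ jS]|_]; last first.
    by case: ifP => // _; exact: (wgt_ge0 xX).
  by case: eqP => // h0; rewrite h0 inE in jS.
have l2 : load x j0 * y <= 16 * (\sum_i wgt x i * e i).
  rewrite /load -mulrA ler_wpM2l // mulr_suml big_mkcond; apply: ler_sum => i _.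
  case: ifP => [/andP[_ jS]|_]; last first.
    by rewrite mulr_ge0 ?(wgt_ge0 xX) // sumr_ge0 // => j _; rewrite sqr_ge0.
  rewrite ler_wpM2l ?(wgt_ge0 xX) // /e (bigD1 j0) //= lerDl sumr_ge0 // => j _.
  exact: sqr_ge0.
have := pot_increment.
have : 2 * (p * (\sum_i wgt x i * a i)) - 2 * h * (\sum_j x j * dl j) <= 0.
  have := gd_sign gd.
  have -> : \sum_j dl j * (p * (\sum_i wgt x i * vec x i j) - h * x j) =
    p * (\sum_i wgt x i * a i) - h * (\sum_j x j * dl j).
    rewrite !mulr_sumr.
    under [X in _ = X - _]eq_bigr => i _ do rewrite /a !mulr_sumr.
    rewrite exchange_big -sumrB; apply: eq_bigr => j _ /=.
    rewrite mulrBr !mulr_sumr; congr (_ - _); last by ring.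
    by apply: eq_bigr => i _; ring.
  lra.
have -> : psi x' = pot x' - h * \sum_j x j ^+ 2 - 2 * h * (\sum_j x j * dl j)
    - h * \sum_j dl j ^+ 2.
  rewrite /psi !mulr_sumr -!addrA -!opprD -!big_split /=; congr (_ - _).
  by apply: eq_bigr => j _; rewrite /x'; ring.
rewrite /psi.
have hmain : 96 * p ^+ 2 * y + 24 * p ^+ 2 * (4 + (64 + 6 * n%:R ^+ 2) * W)
    + h * E ^+ 2 <= 2 * (h * \sum_j dl j ^+ 2).
  apply: (@step_budget n m p E X h W y _ p2 E_ge X_geE hX2 W0 Wh yE EE).
have p20 : 0 <= p ^+ 2 by exact: sqr_ge0.
have we0 : 0 <= \sum_i wgt x i * e i.
  by apply: sumr_ge0 => i _; rewrite mulr_ge0 ?(wgt_ge0 xX) // sumr_ge0 // => j _; exact: sqr_ge0.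
have f1 : 12 * p ^+ 2 * (\sum_i (wgt x i * s i ^+ 2 + wgt0 x i * a i ^+ 2)) <=
   12 * p ^+ 2 * (64 * (\sum_i wgt x i * e i) + 4 * y + 4 + (64 + 6 * n%:R ^+ 2) * W).
  rewrite ler_wpM2l //; first by lra.
  apply: le_trans hform _; lra.
have f2 : 0 <= p ^+ 2 * (\sum_i wgt x i * e i) by rewrite mulr_ge0.
move: hmain f1 f2.
move: (\sum_i wgt x i * e i) (\sum_i wgt x i * a i) (\sum_j x j * dl j).
move: (\sum_j dl j ^+ 2) (\sum_j x j ^+ 2) (\sum_i _) => A1 A2 A3 A4 A5 A6.
lra.
Qed.
End Step.
End Potential.
End Potential.
Export Potential.

(** * The pivot direction *)

Lemma sqr_sum_abs n (f : 'I_n -> int) (b : int) :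
  (forall j, f j ^+ 2 <= b) -> (\sum_j `|f j|) ^+ 2 <= n%:R ^+ 2 * b.
Proof.
move=> fb; elim: n f fb => [|n ih] f fb.
  by rewrite big_ord0 !expr0n mul0r.
rewrite big_ord_recl; have := ih (fun j => f (lift ord0 j)) (fun j => fb _).
set s := \sum_(i < n) _ => hs; have := fb ord0; set y := `|f ord0| => hy.
have y0 : 0 <= y by rewrite normr_ge0.
have s0 : 0 <= s by rewrite sumr_ge0.
have {}hy : y ^+ 2 <= b by rewrite real_normK ?num_real.
have b0 := le_trans (sqr_ge0 _) hy.
have n0 : (0 : int) <= n%:R by [].
have -> : n.+1%:R = 1 + n%:R :> int by rewrite -(natrD _ 1) add1n.
move: (n%:R : int) n0 hs => N N0 hs.
have h1 : (y * s) ^+ 2 <= (N * b) ^+ 2.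
  rewrite !exprMn; apply: (@le_trans _ _ (b * (N ^+ 2 * b))).
    by apply: ler_pM => //; exact: sqr_ge0.
  lra.
have : y * s <= N * b by rewrite -ler_sqr ?nnegrE // mulr_ge0.
lra.
Qed.

(* The effect of rounding [E z / mu] down to an integer vector [dl] on a linear form. *)
Lemma round_form n (l z dl : 'I_n -> int) (E mu : int) : 0 < mu ->
  (forall k, l k != 0 -> 0 <= E * z k - mu * dl k <= mu) ->
  mu ^+ 2 * (\sum_k l k * dl k) ^+ 2 <=
  2 * (E ^+ 2 * (\sum_k l k * z k) ^+ 2) + 2 * (mu ^+ 2 * (\sum_k `|l k|) ^+ 2).
Proof.
move=> mu0 h; set a := \sum_k l k * dl k; set y := \sum_k l k * z k.
set L := \sum_k _.
have : `|E * y - mu * a| <= mu * L.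
  rewrite /y /a /L !mulr_sumr -sumrB; apply: le_trans (ler_norm_sum _ _ _) _.
  apply: ler_sum => k _.
  have -> : E * (l k * z k) - mu * (l k * dl k) = l k * (E * z k - mu * dl k) by ring.
  rewrite normrM mulrC; have [->|lk] := eqVneq (l k) 0; first by rewrite normr0 !mulr0.
  rewrite ler_wpM2r //; have /andP[h1 h2] := h k lk.
  by rewrite ger0_norm.
have L0 : 0 <= L by apply: sumr_ge0.
set q := E * y - mu * a => hq.
have : q ^+ 2 <= (mu * L) ^+ 2.
  rewrite -[q ^+ 2]real_normK ?num_real // ler_pXn2r ?nnegrE //.
  by rewrite mulr_ge0 // ltW.
have := sqr_ge0 (2 * (E * y) - mu * a); rewrite /q -!exprMn.
move: (E * y) (mu * a) (mu * L) => A1 A2 A3; lra.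
Qed.

Module Direction.
Section Direction.
Variables (n m : nat) (sys : m.-tuple {set 'I_n}) (t k : nat).
Variables E X c u h p : int.
Local Notation S := (tnth sys).
Hypothesis P : params n m t k E X c u h p.
Variable x : 'I_n -> int.
Hypothesis xX : forall j, `|x j| <= X.

Local Notation alive := (alive E X x).
Local Notation small := (small sys t E X x).
Local Notation wgt := (wgt sys t k E X c x).
Local Notation wgt0 := (wgt0 sys t k E X c x).
Local Notation ind := (ind sys E X x).
Local Notation vec := (vec sys E X c x).
Local Notation load := (load sys t k E X c x).
Local Notation bigw := (bigw sys t k E X c x).
Local Notation ener := (ener sys X c x).

(** The rank-one terms are numbered as the program stores them: elements, indicators of sets,
    gradients of energies. The diagonal weights are written as forms too, so the Gram matrix starts
    from the identity and arises by rank-one updates alone. *)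
Definition coef (q : nat) : int :=
  if insub q is Some j then load j else
  if insub (q - n)%N is Some i then (if small i then wgt i else bigw) else
  if insub (q - n - m)%N is Some i then wgt0 i else 0.

Definition lform (q : nat) (l : 'I_n) : int :=
  if insub q is Some j then (l == j)%:R else
  if insub (q - n)%N is Some i then ind i l else
  if insub (q - n - m)%N is Some i then vec i l else 0.

Lemma coef_elt (j : 'I_n) : coef j = load j.
Proof. by rewrite /coef valK. Qed.
Lemma form_elt (j l : 'I_n) : lform j l = (l == j)%:R.
Proof. by rewrite /lform valK. Qed.
Lemma coef_set (i : 'I_m) : coef (n + i) = if small i then wgt i else bigw.
Proof. by rewrite /coef insubF ?addKn ?valK // ltnNge leq_addr. Qed.
Lemma form_set (i : 'I_m) l : lform (n + i) l = ind i l.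
Proof. by rewrite /lform insubF ?addKn ?valK // ltnNge leq_addr. Qed.
Lemma coef_vec (i : 'I_m) : coef (n + m + i) = wgt0 i.
Proof.
rewrite /coef insubF; last by rewrite ltnNge -addnA leq_addr.
rewrite -addnA addKn insubF; last by rewrite ltnNge leq_addr.
by rewrite addKn valK.
Qed.
Lemma form_vec (i : 'I_m) l : lform (n + m + i) l = vec i l.
Proof.
rewrite /lform insubF; last by rewrite ltnNge -addnA leq_addr.
rewrite -addnA addKn insubF; last by rewrite ltnNge leq_addr.
by rewrite addKn valK.
Qed.

Let wgt_ge0' i : 0 <= wgt i := wgt_ge0 sys P xX i.
Let wgt0_ge0' i : 0 <= wgt0 i := wgt0_ge0 sys P xX i.
Let load_ge0' j : 0 <= load j := load_ge0 sys P xX j.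
Let E_gt0' : 0 < E := E_gt0 P.

Lemma bigw_ge0 : 0 <= bigw.
Proof.
rewrite /bigw mulr_ge0 ?sqr_ge0 // sumr_ge0 // => j _; rewrite addr_ge0 //.
Qed.

Lemma coef_ge0 q : 0 <= coef q.
Proof.
rewrite /coef; case: insub => [j|]; first exact: load_ge0'.
case: insub => [i|]; last by case: insub.
by case: ifP => // _; exact: bigw_ge0.
Qed.

Definition forms := (n + m + m)%N.

Lemma sum_forms (F : int -> ('I_n -> int) -> int) :
  (forall a f g, f =1 g -> F a f = F a g) ->
  \sum_(q < forms) F (coef q) (lform q) =
  \sum_j F (load j) (fun l => (l == j)%:R)
  + \sum_i F (if small i then wgt i else bigw) (ind i)
  + \sum_i F (wgt0 i) (vec i).
Proof.
move=> FE; rewrite /forms big_split_ord big_split_ord /=.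
congr (_ + _ + _); apply: eq_bigr => i _ /=.
- by rewrite coef_elt; apply: FE => l; rewrite form_elt.
- by rewrite coef_set; apply: FE => l; rewrite form_set.
- by rewrite coef_vec; apply: FE => l; rewrite form_vec.
Qed.

Lemma sum_delta (z : 'I_n -> int) j : \sum_l (l == j)%:R * z l = z j.
Proof.
rewrite (bigD1 j) //= eqxx mul1r big1 ?addr0 // => l lj.
by rewrite (negPf lj) mul0r.
Qed.

Let J := gadj coef lform forms.
Let d := gdet coef lform forms.
Let d0 : 0 < d := gdet_gt0 _ coef_ge0 _.

(** The coordinate forms merge with the identity into the diagonal [load j + 1], the [D] of
    [leverage]. *)
Lemma quad_form w (z := gsol coef lform forms w) :
  d * (\sum_i w i * z i) = \sum_j (load j + 1) * z j ^+ 2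
  + (\sum_i (if small i then wgt i else bigw) * (\sum_l ind i l * z l) ^+ 2
  + \sum_i wgt0 i * (\sum_l vec i l * z l) ^+ 2).
Proof.
rewrite gsol_form -/z (sum_forms (F := fun a f => a * (\sum_l f l * z l) ^+ 2)).
  rewrite !addrA; congr (_ + _ + _); rewrite -big_split; apply: eq_bigr => j _ /=.
  by rewrite sum_delta; ring.
by move=> a f g fg; congr (_ * _ ^+ 2); apply: eq_bigr => l _; rewrite fg.
Qed.

Hypothesis tS : sparse t sys.

Lemma alive_pair_count :
  (\sum_i #|[set j in S i | alive j]| <= #|[pred j | alive j]| * t)%N.
Proof.
under eq_bigr => i _ do rewrite -sum1dep_card big_mkcond.
rewrite exchange_big /= -sum_nat_const [X in (_ <= X)%N]big_mkcond.
apply: leq_sum => j _; case: ifP; rewrite inE => al; last by rewrite big1 // => i _; rewrite al andbF.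
apply: leq_trans (tS j); rewrite -sum1_count big_tuple big_mkcond [X in (_ <= X)%N]big_mkcond.
by apply: leq_sum => i _; rewrite al andbT.
Qed.

(** Double counting of alive incidences. The case [t = 0] is apart because [t] is cancelled; then no
    set has an alive element. *)
Lemma big_few : (8 * #|[pred i | ~~ small i]| <= #|[pred j | alive j]|)%N.
Proof.
have [t0|t0] := posnP t.
  have sm i : small i.
    have := alive_pair_count; rewrite [X in (_ * X)%N]t0 muln0 leqn0 sum_nat_eq0.
    by move=> /forallP/(_ i)/eqP; rewrite /Potential.small => ->.
  by rewrite eq_card0 // => i; rewrite !inE sm.
rewrite -(@leq_pmul2r t) // mulnAC mulnC.
apply: leq_trans alive_pair_count.
rewrite -sum_nat_const big_mkcond /=; apply: leq_sum => i _.
case: ifP => //; rewrite inE /Potential.small -ltnNge => /ltnW //.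
Qed.

Lemma pivot_exists : (exists j, alive j) ->
  exists2 j, alive j & d <= 2 * (load j + 1) * J j j.
Proof.
move=> [j0 al0].
pose C (q : 'I_m + 'I_m) := match q with
  | inl i => if small i then wgt i else bigw | inr i => wgt0 i end.
pose V (q : 'I_m + 'I_m) := match q with inl i => ind i | inr i => vec i end.
pose heavy := [pred q : 'I_m + 'I_m | if q is inl i then ~~ small i else false].
have sumC (F : 'I_m + 'I_m -> int) : \sum_q F q = \sum_i F (inl i) + \sum_i F (inr i).
  by rewrite big_sumType.
have D0 j : 0 < load j + 1 by rewrite ltr_wpDl.
apply: (@leverage n _ J d (fun j => load j + 1) C V [pred j | alive j] heavy) => //.
- by case=> i /=; [case: ifP => // _; exact: bigw_ge0|].
- by move=> w; rewrite sumC /=; exact: quad_form.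
- rewrite sumC /=.
  have := gram_trace coef lform forms.
  rewrite (sum_forms (F := fun a f => a * (\sum_l f l * gsol coef lform forms f l))).
    rewrite !addrA -big_split /= => <-; congr (_ + _ + _); apply: eq_bigr => j _.
    rewrite sum_delta mulrDl mul1r addrC.
    congr (_ * _ + _).
    by rewrite /gsol; under eq_bigr => l _ do rewrite mulrC; rewrite sum_delta.
  move=> a f g fg; congr (_ * _); apply: eq_bigr => l _; rewrite fg; congr (_ * _).
  by apply: eq_bigr => l' _; rewrite fg.
- by case=> i l /negPf al /=; rewrite /Potential.vec /Potential.ind [alive l]al //= mul0r.
- move=> j al; rewrite [X in 16 * X](_ : _ =
    \sum_i (wgt i * ind i j ^+ 2 + wgt0 i * vec i j ^+ 2)).
    rewrite mulr_sumr.
    apply: (@le_trans _ _ (3 * load j)); last by rewrite ler_wpM2l // lerDl.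
    rewrite /Potential.load mulrA mulr_sumr [X in _ <= X]big_mkcond /=.
    apply: ler_sum => i _; rewrite /Potential.vec /Potential.ind [alive j]al /=.
    case: (j \in S i) => /=; last by rewrite mul0r expr0n !mulr0.
    rewrite mul1r expr1n mulr1.
    have := ler_wpM2l (wgt0_ge0' i) (vec_sq_le sys P xX i j).
    rewrite (mulrCA _ 2) -(wgtE sys _ _ _ _ _ _ i).
    move: (wgt i) (wgt_ge0' i) => w w0; lra.
  rewrite big_mkcond sumC big_split /=; congr (_ + _); apply: eq_bigr => i _.
  by rewrite negbK /Potential.wgt; case: (small i); rewrite ?mul0r.
- apply: leq_trans big_few; rewrite leq_mul2l /=.
  rewrite -!sum1_card big_sumType /= [X in (_ + X)%N]big1 ?addn0 //.
by apply/card_gt0P; exists j0.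
Qed.

Section Pivot.
Variables (j : 'I_n) (mu sg : int) (dl : 'I_n -> int).
Let z l := J l j.
Hypothesis piv : d <= 2 * (load j + 1) * z j.
Hypothesis alj : alive j.
Hypothesis mu_ge : forall l, alive l -> `|z l| <= mu.
Hypothesis mu_ex : exists2 l, alive l & `|z l| = mu.
Hypothesis dlE : forall l, dl l = if alive l then (E * z l %/ mu)%Z else 0.
Hypothesis sg1 : sg = 1 \/ sg = -1.
Hypothesis sgP :
  sg * (\sum_l (p * (\sum_i wgt i * vec i l) - h * x l) * dl l) <= 0.

Let pivot_gt0 : 0 < z j.
Proof.
rewrite ltNge; apply/negP => zj; have := lt_le_trans d0 piv.
by rewrite ltNge mulr_ge0_le0 // mulr_ge0 // addr_ge0 // load_ge0'.
Qed.

Let mu_gt0 : 0 < mu.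
Proof. by apply: lt_le_trans (mu_ge alj); rewrite normr_gt0 gt_eqF. Qed.

Let mu_neq0 : mu != 0. Proof. by rewrite gt_eqF. Qed.

Let rounding l : alive l -> 0 <= E * z l - mu * dl l <= mu.
Proof.
move=> al; rewrite dlE al {1 3}(divz_eq (E * z l) mu) mulrC addrAC subrr add0r.
by rewrite modz_ge0 //= ltW // ltz_pmod.
Qed.

(** For column [j] the quadratic identity reads: [d z_j] equals [D_j z_j ^ 2], plus other squares,
    plus the forms, where [D_j = load j + 1]. The pivot inequality makes the left side at most twice
    [D_j z_j ^ 2], so one copy remains to bound the forms. *)
Let form_bound : \sum_i (if small i then wgt i else bigw) * (\sum_l ind i l * z l) ^+ 2
  + \sum_i wgt0 i * (\sum_l vec i l * z l) ^+ 2 <= (load j + 1) * z j ^+ 2.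
Proof.
pose w l := ((l == j)%:R : int).
have gz l : gsol coef lform forms w l = z l.
  by rewrite /gsol; under eq_bigr => l' _ do rewrite mulrC; rewrite sum_delta.
have := quad_form w; cbv zeta; rewrite [\sum_i w i * _]sum_delta gz.
under eq_bigr => l _ do rewrite gz.
under [X in _ + (X + _)]eq_bigr => i _ do under eq_bigr => l _ do rewrite gz.
under [X in _ + (_ + X)]eq_bigr => i _ do under eq_bigr => l _ do rewrite gz.
rewrite (bigD1 j) //=; set r := \sum_(l < n | _) _.
have r0 : 0 <= r.
  by apply: sumr_ge0 => l _; rewrite mulr_ge0 ?sqr_ge0 ?addr_ge0 // load_ge0'.
have := ler_wpM2r (ltW pivot_gt0) piv.
by move=> h1 h2; move: h1; rewrite h2; lra.
Qed.

Let pivot_round : E ^+ 2 * z j ^+ 2 <= 2 * mu ^+ 2 * (dl j ^+ 2 + 1).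
Proof.
have := rounding alj; set y := E * z j - _ => /andP[y0 ymu].
have -> : E ^+ 2 * z j ^+ 2 = (mu * dl j + y) ^+ 2 by rewrite /y; ring.
have : y ^+ 2 <= mu ^+ 2 by rewrite ler_pXn2r ?nnegrE // ltW.
have := sqr_ge0 (mu * dl j - y); lra.
Qed.

Let sum_ind i : \sum_l ind i l * dl l = \sum_(l in S i) dl l.
Proof.
rewrite [RHS]big_mkcond; apply: eq_bigr => l _; rewrite /Potential.ind.
have [al|al] := boolP (alive l); last by rewrite dlE (negPf al) mulr0 if_same.
by rewrite /=; case: ifP => _; rewrite ?mul1r ?mul0r.
Qed.

Lemma dl_le l : `|dl l| <= E.
Proof.
rewrite dlE; case: ifP => [al|_]; last by rewrite normr0 ltW.
have := mu_ge al; rewrite !ler_norml => /andP[h1 h2].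
apply/andP; split.
  rewrite lez_divRL //; have := ler_wpM2l (ltW E_gt0') h1; lra.
rewrite -(ler_pM2r mu_gt0); apply: le_trans (lez_floor _ mu_neq0) _.
by rewrite ler_wpM2l // ltW.
Qed.

(** At an entry of modulus [mu] the division is exact, so flooring does not shorten the step. *)
Lemma dl_full : exists l, `|dl l| = E.
Proof.
have [l al zl] := mu_ex; exists l; rewrite dlE al.
have [z0|z0] := leP 0 (z l).
  have -> : z l = mu by rewrite -zl ger0_norm.
  by rewrite mulzK // gtr0_norm.
have -> : E * z l = - E * mu by rewrite -zl ltr0_norm //; ring.
by rewrite mulzK // normrN gtr0_norm.
Qed.

(** [bigw] contains the factor [E ^ 2 D] with [D] at least [load j + 1], and [|z j| <= mu]; so
    [form_bound] gives [|E y| <= mu] for the unrounded sum [y]. Flooring adds at most [mu] per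
    element. *)
Lemma big_balanced i : ~~ small i -> `|\sum_(l in S i) dl l| <= (n + 1)%:R.
Proof.
move=> bg; rewrite -sum_ind.
have hB : bigw * (\sum_l ind i l * z l) ^+ 2 <= (load j + 1) * z j ^+ 2.
  apply: le_trans form_bound.
  rewrite (bigD1 i) //= (negPf bg) -addrA lerDl addr_ge0 //.
    apply: sumr_ge0 => i' _; rewrite mulr_ge0 ?sqr_ge0 //.
    by case: ifP => // _; exact: bigw_ge0.
  by apply: sumr_ge0 => i' _; rewrite mulr_ge0 ?sqr_ge0.
have zmu : z j ^+ 2 <= mu ^+ 2.
  have := mu_ge alj; rewrite gtr0_norm // => h1.
  by rewrite ler_pXn2r ?nnegrE // ltW.
pose D := \sum_l (load l + 1).
have jD : load j + 1 <= D.
  rewrite /D (bigD1 j) //= lerDl sumr_ge0 // => l _.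
  by rewrite addr_ge0 // load_ge0'.
have D0 : 0 < D by apply: lt_le_trans jD; rewrite ltr_wpDl // load_ge0'.
set y := \sum_l ind i l * z l in hB.
have yE : `|E * y| <= mu.
  rewrite -ler_sqr ?nnegrE ?(ltW mu_gt0) // real_normK ?num_real // exprMn.
  rewrite -(ler_pM2l D0) mulrA [D * _]mulrC; apply: le_trans hB _.
  apply: ler_pM => //; [|exact: sqr_ge0].
  by rewrite addr_ge0 // load_ge0'.
have hr : `|E * y - mu * (\sum_l ind i l * dl l)| <= mu * n%:R.
  rewrite /y !mulr_sumr -sumrB; apply: le_trans (ler_norm_sum _ _ _) _.
  apply: (@le_trans _ _ (\sum_(l < n) mu)); last first.
    by rewrite sumr_const card_ord mulr_natr.
  apply: ler_sum => l _.
  have -> : E * (ind i l * z l) - mu * (ind i l * dl l) = ind i l * (E * z l - mu * dl l) by ring.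
  rewrite /Potential.ind; have [al|al] := boolP (alive l); last first.
    by rewrite /= mul0r normr0 ltW.
  rewrite /=; case: (l \in S i); rewrite ?mul0r ?normr0 ?(ltW mu_gt0) //.
  by have /andP[h1 h2] := rounding al; rewrite mul1r ger0_norm.
rewrite -(ler_pM2l mu_gt0) -{1}(gtr0_norm mu_gt0) -normrM natrD mulrDr mulr1.
move: (mu * \sum_l _) hr => q; move: (mu * n%:R) (E * y) yE => N Y.
by rewrite !ler_norml => /andP[? ?] /andP[? ?]; apply/andP; split; lra.
Qed.

(** The 4 is 2 from [round_form] times 2 from [pivot_round]. The 6 is twice the sum of 1, the bound
    on squared entries of [ind], and 2, since the squared entries of [vec] are at most [2 ener] and
    [wgt0 * ener = wgt]. *)
Lemma form_small :
  \sum_i (wgt i * (\sum_(l in S i) dl l) ^+ 2 + wgt0 i * (\sum_l vec i l * dl l) ^+ 2) <=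
  4 * ((load j + 1) * (dl j ^+ 2 + 1)) + 6 * n%:R ^+ 2 * \sum_(i | S i != set0) wgt i.
Proof.
have mu2 : 0 < mu ^+ 2 by rewrite exprn_gt0.
rewrite -(ler_pM2l mu2).
have rnd (l : 'I_n -> int) b : (forall a, l a != 0 -> alive a) ->
    (forall a, l a ^+ 2 <= b) ->
    mu ^+ 2 * (\sum_a l a * dl a) ^+ 2 <=
    2 * (E ^+ 2 * (\sum_a l a * z a) ^+ 2) + 2 * (mu ^+ 2 * (n%:R ^+ 2 * b)).
  move=> la lb; apply: le_trans (round_form (E := E) (z := z) mu_gt0 _) _.
    by move=> a /la; exact: rounding.
  by rewrite lerD2l ler_wpM2l // ler_wpM2l ?(ltW mu2) // sqr_sum_abs.
have ind_al i a : ind i a != 0 -> alive a.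
  by rewrite /Potential.ind; case: (Potential.alive _ _ _ _).
have vec_al i a : vec i a != 0 -> alive a.
  by rewrite /Potential.vec mulf_eq0 negb_or => /andP[/ind_al].
apply: (@le_trans _ _ (2 * (E ^+ 2 * ((load j + 1) * z j ^+ 2))
   + 6 * (mu ^+ 2 * (n%:R ^+ 2 * \sum_(i | S i != set0) wgt i)))); last first.
  have := ler_wpM2l (_ : 0 <= load j + 1) pivot_round.
  rewrite addr_ge0 ?load_ge0' // => /(_ isT).
  move: (mu ^+ 2) (E ^+ 2) (z j ^+ 2) (n%:R ^+ 2) (\sum_(i | _) _) => *; lra.
apply: (@le_trans _ _ (\sum_i (wgt i * (2 * (E ^+ 2 * (\sum_a ind i a * z a) ^+ 2))
   + wgt0 i * (2 * (E ^+ 2 * (\sum_a vec i a * z a) ^+ 2))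
   + 6 * (mu ^+ 2 * (n%:R ^+ 2 * (if S i != set0 then wgt i else 0)))))).
  rewrite mulr_sumr; apply: ler_sum => i _.
  have [Se|Sn] := eqVneq (S i) set0.
    rewrite -sum_ind big1 => [|a _]; last by rewrite /Potential.ind Se inE andbF mul0r.
    rewrite big1 => [|a _]; last by rewrite /Potential.vec /Potential.ind Se inE andbF !mul0r.
    rewrite expr0n /= !(mulr0, addr0).
    by apply: addr_ge0; apply: mulr_ge0 => //; apply: mulr_ge0 => //;
      apply: mulr_ge0; exact: sqr_ge0.
  have ind1 a : ind i a ^+ 2 <= 1 by rewrite /Potential.ind; case: (_ && _).
  have vec1 a : vec i a ^+ 2 <= 2 * ener i.
    rewrite /Potential.vec exprMn; apply: le_trans (vec_sq_le sys P xX i a).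
    by rewrite -[X in _ <= X]mul1r ler_wpM2r ?sqr_ge0.
  have h1 := ler_wpM2l (wgt_ge0' i) (rnd (ind i) 1 (ind_al i) ind1).
  have h2 := ler_wpM2l (wgt0_ge0' i) (rnd (vec i) (2 * ener i) (vec_al i) vec1).
  rewrite /= -sum_ind; move: h1 h2; rewrite (wgtE sys _ _ _ _ _ _ i).
  move: (wgt0 i) (ener i) (mu ^+ 2) (E ^+ 2) (n%:R ^+ 2) => A1 A2 A3 A4 A5.
  move: ((\sum_a ind i a * dl a) ^+ 2) ((\sum_a vec i a * dl a) ^+ 2) => A6 A7.
  move: ((\sum_a ind i a * z a) ^+ 2) ((\sum_a vec i a * z a) ^+ 2) => A8 A9.
  lra.
rewrite big_split /= -!mulr_sumr -big_mkcond lerD2r.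
apply: (@le_trans _ _ (2 * (E ^+ 2 * (\sum_i wgt i * (\sum_a ind i a * z a) ^+ 2
  + \sum_i wgt0 i * (\sum_a vec i a * z a) ^+ 2)))).
  rewrite mulrDr mulrDr !mulr_sumr -big_split /= le_eqVlt; apply/orP; left.
  by apply/eqP/eq_bigr => i _; ring.
rewrite ler_wpM2l // ler_wpM2l ?sqr_ge0 //; apply: le_trans form_bound.
rewrite lerD2r; apply: ler_sum => i _; case: ifP => // sm.
rewrite {1}/Potential.wgt sm mul0r mulr_ge0 ?sqr_ge0 //; exact: bigw_ge0.
Qed.

Lemma pivot_good_dir : good_dir sys t k E X c h p x (fun l => sg * dl l).
Proof.
have sgn : `|sg| = 1 by case: sg1 => ->; rewrite ?normrN normr1.
have sg2 : sg ^+ 2 = 1 by case: sg1 => ->; rewrite ?sqrrN expr1n.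
split.
- by move=> l /negPf al; rewrite dlE al mulr0.
- by move=> l; rewrite normrM sgn mul1r dl_le.
- by have [l hl] := dl_full; exists l; rewrite normrM sgn mul1r.
- exists j; rewrite exprMn sg2 mul1r; apply: le_trans form_small.
  apply: ler_sum => i _; rewrite -mulr_sumr exprMn sg2 mul1r.
  rewrite [X in wgt0 i * X ^+ 2](_ : _ = sg * \sum_l vec i l * dl l).
    by rewrite exprMn sg2 mul1r.
  by rewrite mulr_sumr; apply: eq_bigr => l _; ring.
- by move=> i /big_balanced; rewrite -mulr_sumr normrM sgn mul1r.
apply: le_trans sgP; rewrite mulr_sumr le_eqVlt; apply/orP; left.
by apply/eqP/eq_bigr => l _; ring.
Qed.

End Pivot.
End Direction.
End Direction.
Export Direction.

(** * The walk *)

Section Walk.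
Variables (n m : nat) (sys : m.-tuple {set 'I_n}) (t k : nat).
Variables E X c u h p : int.
Local Notation S := (tnth sys).
Hypothesis P : params n m t k E X c u h p.
Hypothesis tS : sparse t sys.
Implicit Types x : 'I_n -> int.

Local Notation alive := (alive E X).
Local Notation small := (small sys t E X).
Local Notation psum := (psum sys).
Local Notation psi := (psi sys t k E X c h).
Local Notation pot := (pot sys t k E X c h).
Local Notation ener := (ener sys X c).

Let E_gt0 : 0 < E := E_gt0 P.
Let X_gt0 : 0 < X := X_gt0 P.
Let X2_gt0 : 0 < X ^+ 2. Proof. by rewrite exprn_gt0. Qed.
Let h_gt0 : 0 < h. Proof. by apply: lt_le_trans (h_geX P). Qed.

(** The second case is an idle step: the main loop has a fixed length and may go on after everything
    is frozen. *)
Definition walk_step x x' :=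
  (exists2 dl, good_dir sys t k E X c h p x dl & forall j, x' j = x j + dl j) \/
  ((forall j, ~~ alive x j) /\ x' =1 x).

Definition nonempty := #|[pred i | S i != set0]|.

(* The last field is the Beck-Fiala bound: outside at most [8 t] elements, a
   set that has become small has settled with a small sum. *)
Record walk_inv (q : nat) x : Prop := WalkInv {
  wi_box : forall j, `|x j| <= X;
  wi_psi : psi x <= nonempty%:R * (h * X ^+ 2);
  wi_prog : (exists j, alive x j) ->
    2 * psi x + q%:R * (h * E ^+ 2) <= 2 * (nonempty%:R * (h * X ^+ 2));
  wi_big : forall i, ~~ small x i -> `|psum x i| <= q%:R * (n%:R + 1);
  wi_small : forall i, small x i -> exists A0 : {set 'I_n},
    [/\ (#|A0| <= 8 * t)%N, forall j, j \in S i -> alive x j -> j \in A0 &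
        `|\sum_(j in S i | j \notin A0) x j| <= X + (8 * t)%:R * X]
}.

Lemma walk_inv0 : walk_inv 0 (fun=> 0).
Proof.
have x0 (j : 'I_n) : `|0 : int| <= X by rewrite normr0 ltW.
have ps0 i : psum (fun=> 0) i = 0 by rewrite /Potential.psum big1.
have hpsi : psi (fun=> 0) <= nonempty%:R * (h * X ^+ 2).
  rewrite /Potential.psi [\sum_j _]big1 ?mulr0 ?subr0; last by move=> j _; rewrite expr0n.
  rewrite /nonempty -sum1_card natr_sum mulr_suml /Potential.pot; apply: ler_sum => i _.
  rewrite mul1r; case: ifP => // sm; rewrite (hX P).
  rewrite ler_pXn2r ?nnegrE //.
  - by apply: (ener_entry P x0) => //; rewrite ps0 normr0 ltW.
  - exact/ltW/(ener_gt0 sys P x0).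
  by rewrite mulr_ge0 ?(ltW X2_gt0) // (le_trans _ (u_ge1 P)).
split=> //.
- by move=> _; rewrite mul0r addr0 ler_wpM2l.
- by move=> i _; rewrite ps0 normr0 mul0r.
move=> i sm; exists [set j in S i | alive (fun=> 0) j]; split=> //.
  by move=> j jS al; rewrite inE jS.
by rewrite big1 // normr0 addr_ge0 ?mulr_ge0 // ltW.
Qed.

Lemma psi_ge x : (forall j, `|x j| <= X) -> - (n%:R * (h * X ^+ 2)) <= psi x.
Proof.
move=> xX; have : 0 <= pot x.
  apply: sumr_ge0 => i _; case: ifP => _; last by rewrite mulr_ge0 // ltW.
  exact/exprn_ge0/ltW/(ener_gt0 sys P xX).
have : h * (\sum_j x j ^+ 2) <= n%:R * (h * X ^+ 2).
  rewrite mulrCA ler_wpM2l ?(ltW h_gt0) //.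
  apply: (@le_trans _ _ (\sum_(j < n) X ^+ 2)); last by rewrite sumr_const card_ord mulr_natl.
  by apply: ler_sum => j _; exact: (sq_le P xX).
rewrite /Potential.psi; move: (h * \sum_j _) => q; lra.
Qed.

Lemma nonempty_le_m : (nonempty <= m)%N.
Proof. by apply: leq_trans (max_card _) _; rewrite card_ord. Qed.

Lemma nonempty_le_nt : (nonempty <= n * t)%N.
Proof.
apply: (@leq_trans (\sum_i #|S i|)%N).
  rewrite /nonempty -sum1_card big_mkcond; apply: leq_sum => i _.
  by case: ifP => //; rewrite inE card_gt0.
under eq_bigr => i _ do rewrite -sum1_card big_mkcond.
rewrite exchange_big /= -[X in (_ <= X * _)%N]card_ord -sum_nat_const.
apply: leq_sum => j _.
by apply: leq_trans (tS j); rewrite -sum1_count big_tuple [X in (_ <= X)%N]big_mkcond.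
Qed.

Lemma pot_le q x : walk_inv q x -> pot x <= (nonempty + n)%:R * (h * X ^+ 2).
Proof.
move=> I; have := wi_psi I.
have : h * (\sum_j x j ^+ 2) <= n%:R * (h * X ^+ 2).
  rewrite mulrCA ler_wpM2l ?(ltW h_gt0) //.
  apply: (@le_trans _ _ (\sum_(j < n) X ^+ 2)); last by rewrite sumr_const card_ord mulr_natl.
  by apply: ler_sum => j _; exact: (sq_le P (wi_box I)).
rewrite natrD mulrDl /Potential.psi; move: (h * \sum_j _) => ?; lra.
Qed.

(** Big sets drift by at most [n + 1] per step; [qX] keeps the total below [X], as required when a
    set turns small. *)
Lemma walk_inv_step q x x' : (q.+1)%:R * (n%:R + 1) <= X ->
  walk_inv q x -> walk_step x x' -> walk_inv q.+1 x'.
Proof.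
move=> qX I [[dl gd xE]|[dead /funext->]]; last first.
  split; [exact: wi_box I|exact: wi_psi I| | |exact: wi_small I].
    by move=> [j]; rewrite (negPf (dead j)).
  move=> i /(wi_big I) H; apply: le_trans H _; rewrite ler_wpM2r ?addr_ge0 //.
  by rewrite ler_nat.
have -> : x' = fun j => x j + dl j by apply/funext.
have box := wi_box I.
have drift i : ~~ small x i -> `|psum (fun j => x j + dl j) i| <= q.+1%:R * (n%:R + 1).
  move=> bg; rewrite /Potential.psum big_split /= -addn1 natrD mulrDl mul1r.
  apply: le_trans (ler_normD _ _) _; apply: lerD; first exact: wi_big I _ bg.
  by have := gd_big gd bg; rewrite natrD.
have driftX i (bg : ~~ small x i) := le_trans (drift i bg) qX.
have hpot : pot x <= (n + m)%:R * (h * X ^+ 2).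
  apply: le_trans (pot_le I) _; apply: ler_wpM2r.
    by apply: mulr_ge0; [exact: ltW|exact: sqr_ge0].
  by rewrite ler_nat addnC leq_add2l nonempty_le_m.
have ps := psi_step P box gd driftX hpot.
have hE : 0 < h * E ^+ 2 by rewrite mulr_gt0 // exprn_gt0.
split.
- by move=> j; exact: (box_step box gd).
- have := wi_psi I; move: (nonempty%:R * _) => N; lra.
- move=> [j al]; have al' := alive_step gd al.
  have := wi_prog I (ex_intro _ j al'); have -> : q.+1%:R = q%:R + 1 :> int by rewrite -natr1.
  move: ps; move: (psi x) (psi (fun j => x j + dl j)) (nonempty%:R * _) (h * E ^+ 2).
  by move=> a1 a2 a3 a4; move: (q%:R : int) => Q; lra.
- move=> i bg; apply: drift; apply: contra bg; exact: (small_step gd).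
move=> i sm; have [sx|bx] := boolP (small x i).
  have [A0 [cA aA sA]] := wi_small I sx; exists A0; split=> //.
    by move=> j jS /(alive_step gd); exact: aA.
  rewrite (eq_bigr x) // => j /andP[jS jA].
  by rewrite (gd_dead gd) ?addr0 //; apply: contra jA; exact: aA.
(* The set turns small in this step: [A0] is what is alive in it now, and the sum outside [A0] is
   the whole sum, at most [X] by the drift, minus at most [8 t] terms. *)
set y := fun j => x j + dl j in sm *.
exists [set j in S i | alive y j]; split=> //.
  by move=> j jS al; rewrite inE jS.
have -> : \sum_(j in S i | j \notin [set j in S i | alive y j]) y j =
    psum y i - \sum_(j in [set j in S i | alive y j]) y j.
  rewrite /Potential.psum [X in _ = X - _](bigID (mem [set j in S i | alive y j])) /=.
  rewrite [X in X + _ - _](eq_bigl (mem [set j in S i | alive y j])).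
    by rewrite addrAC subrr add0r.
  by move=> j; rewrite !inE andbA andbb.
apply: le_trans (ler_normB _ _) _; apply: lerD; first exact: driftX.
apply: le_trans (ler_norm_sum _ _ _) _.
apply: (@le_trans _ _ (\sum_(j in [set j in S i | alive y j]) X)).
  by apply: ler_sum => j _; exact: (box_step box gd).
by rewrite sumr_const -[X in X <= _]mulr_natl ler_wpM2r ?(ltW X_gt0) // ler_nat.
Qed.

(** While something is alive, each step lowers [psi] by [h E ^ 2 / 2], and [psi] ranges between
    [- n h X ^ 2] and [m h X ^ 2], where [X ^ 2 = (n + 1) ^ 2 E ^ 2]. *)
Lemma walk_frozen q x : (2 * (n + 1) ^ 2 * (m + n) < q)%N -> walk_inv q x ->
  forall j, ~~ alive x j.
Proof.
move=> hq I j; apply/negP => al.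
have := wi_prog I (ex_intro _ j al); have := psi_ge (wi_box I).
rewrite (par_X P) exprMn => h1 h2.
have hE : 0 < h * E ^+ 2 by rewrite mulr_gt0 // exprn_gt0.
have : q%:R * (h * E ^+ 2) <= (2 * (n + 1) ^ 2 * (m + n))%:R * (h * E ^+ 2).
  have -> : (2 * (n + 1) ^ 2 * (m + n))%:R = 2 * (n%:R + 1) ^+ 2 * (m%:R + n%:R) :> int.
    by rewrite !(natrM, natrX, natrD).
  have : nonempty%:R <= m%:R :> int by rewrite ler_nat nonempty_le_m.
  have := sqr_ge0 (n%:R + 1 : int).
  move: (q%:R * _) h1 h2 => Q h1 h2 g1 g2.
  have := ler_wpM2r (mulr_ge0 g1 (ltW hE)) g2.
  move: h1 h2; move: ((n%:R + 1) ^+ 2) (E ^+ 2) (psi x) => N E2 ps; lra.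
by rewrite ler_pM2r // ler_nat leqNgt hq.
Qed.

Definition sgn x (j : 'I_n) : int := if 0 <= x j then 1 else -1.

Section Final.
Variables (q : nat) (x : 'I_n -> int).
Hypothesis I : walk_inv q x.
Hypothesis frozen : forall j, ~~ alive x j.

Lemma round_le i : `|\sum_(j in S i) sgn x j| * X <= `|psum x i| + X.
Proof.
have nE : n%:R * E <= X by apply: le_trans (X_ge P); rewrite lerDl ltW.
have : `|\sum_(j in S i) (sgn x j * X - x j)| <= X.
  apply: le_trans (ler_norm_sum _ _ _) _; apply: le_trans nE.
  apply: card_le; last exact: ltW.
  move=> j; have := frozen j; rewrite /Potential.alive -leNgt /sgn.
  have := wi_box I j; case: (leP 0 (x j)) => hx.
    rewrite ger0_norm // => h1 h2; rewrite mul1r ger0_norm; lra.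
  rewrite ltr0_norm // => h1 h2; rewrite mulN1r ler0_norm; lra.
rewrite sumrB -mulr_suml -/(psum x i) => H.
rewrite -{1}(gtr0_norm X_gt0) -normrM.
have := ler_normD (psum x i) ((\sum_(j in S i) sgn x j) * X - psum x i).
rewrite addrC subrK; move: H; move: (`|_ - _|) => ?; lra.
Qed.

Let all_small i : small x i.
Proof.
rewrite /Potential.small (_ : [set j in S i | alive x j] = set0) ?cards0 //.
by apply/setP => j; rewrite !inE (negPf (frozen j)) andbF.
Qed.

(** In units of [X]: 1 for the drift, [8 t] for the elements split off when the set turned small,
    [8 t] for their present values, and 1 for rounding to signs. *)
Lemma beck_fiala i : `|\sum_(j in S i) sgn x j| <= 16 * t%:R + 2.
Proof.
rewrite -(ler_pM2r X_gt0); apply: le_trans (round_le i) _.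
have [A0 [cA _ sA]] := wi_small I (all_small i).
have : `|psum x i| <= X + (8 * t)%:R * X + (8 * t)%:R * X.
  rewrite /Potential.psum (bigID (mem A0)) /= addrC; apply: le_trans (ler_normD _ _) _.
  apply: lerD => //; apply: le_trans (ler_norm_sum _ _ _) _.
  apply: (@le_trans _ _ (\sum_(j in A0) X)).
    rewrite big_mkcond [X in _ <= X]big_mkcond; apply: ler_sum => j _.
    case: (j \in A0); rewrite ?andbF // andbT.
    by case: ifP => _; [exact: wi_box I j|exact: ltW].
  by rewrite sumr_const -[X in X <= _]mulr_natl ler_wpM2r ?(ltW X_gt0) // ler_nat.
rewrite natrM; lra.
Qed.

(** One energy to the power [p] is at most the whole potential, that is at most [n t + n] copies of
    the cap [(u X ^ 2) ^ p]; the hypothesis makes the [p]-th root of the number of copies at most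
    8. *)
Lemma ener_final i : S i != set0 -> (n * (t + 1) <= 8 ^ k.+2)%N ->
  ener x i <= 8 * u * X ^+ 2.
Proof.
move=> Si hn; have u1 := u_ge1 P.
have uX : 0 <= u * X ^+ 2 by rewrite mulr_ge0 ?sqr_ge0 // (le_trans _ u1).
rewrite -mulrA; set y := u * X ^+ 2 in uX *.
have y8 : 0 <= 8 * y by rewrite mulr_ge0.
rewrite -(@ler_pXn2r _ k.+2) ?nnegrE ?(ltW (ener_gt0 sys P (wi_box I) i)) //.
apply: (@le_trans _ _ (pot x)).
  rewrite /Potential.pot (bigD1 i) //= all_small lerDl sumr_ge0 // => i' _.
  rewrite all_small; exact/exprn_ge0/ltW/(ener_gt0 sys P (wi_box I)).
apply: le_trans (pot_le I) _; rewrite (hX P) -/y [(8 * y) ^+ _]exprMn.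
rewrite ler_wpM2r ?exprn_ge0 // -natrX ler_nat; apply: leq_trans hn.
by rewrite mulnDr muln1 leq_add2r nonempty_le_nt.
Qed.

Lemma sharp_bound i : S i != set0 -> (n * (t + 1) <= 8 ^ k.+2)%N ->
  (\sum_(j in S i) sgn x j) ^+ 2 <= 16 * u + 2.
Proof.
move=> Si hn; have h1 := ener_final Si hn.
have h2 : psum x i ^+ 2 <= 8 * u * X ^+ 2.
  apply: le_trans h1; apply: le_trans (ener_ge sys P (wi_box I) i).
  by rewrite lerDr mulr_ge0 ?sqr_ge0.
have h3 := round_le i.
rewrite -[X in X <= _]real_normK ?num_real //.
move: h3; move: (`|\sum_(j in _) _|) (normr_ge0 (\sum_(j in S i) sgn x j)) => Y Y0 h3.
have u1 := u_ge1 P.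
have [Y1|Y1] := leP Y 1; first by nra.
have : ((Y - 1) * X) ^+ 2 <= 8 * u * X ^+ 2.
  apply: le_trans h2; rewrite -[psum x i ^+ 2]real_normK ?num_real //.
  have Yb : 0 <= (Y - 1) * X by apply: mulr_ge0; [lra|exact: ltW].
  rewrite ler_pXn2r ?nnegrE //; lra.
(* [Y ^ 2 <= 2 (Y - 1) ^ 2 + 2] is the square of [Y - 2] being nonnegative. *)
rewrite exprMn ler_pM2r // => h4; have := sqr_ge0 (Y - 2); lra.
Qed.
End Final.
End Walk.

(** * Running programs *)

Fixpoint esize (e : expr) : nat :=
  match e with
  | Const _ => 1
  | Read _ e1 => (esize e1).+1
  | Op _ e1 e2 => (esize e1 + esize e2).+1
  end.

Fixpoint small_consts (e : expr) : bool :=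
  match e with
  | Const z => (`|z| < 2 ^ 8)%N
  | Read _ e1 => small_consts e1
  | Op _ e1 e2 => small_consts e1 && small_consts e2
  end.

(** Syntactic limits met by every expression of the program and checked by computation; they give
    all elementary commands one common cost bound. *)
Definition eok (e : expr) := (esize e <= 60)%N && small_consts e.

Lemma esize_gt0 e : (0 < esize e)%N. Proof. by case: e. Qed.

Section Bits.
Variable b : nat.
Hypothesis b8 : (8 <= b)%N.

Definition bounded (M : memory) := forall a i, (`|M a i| < 2 ^ b)%N.

Lemma bitsize_le z k : (0 < k)%N -> (`|z| < 2 ^ k)%N -> (bitsize z <= k)%N.
Proof.
move=> k0 h; rewrite /bitsize; have [->|z0] := posnP `|z|%N; first by rewrite trunc_log0.
rewrite -(@ltn_exp2l 2) //; apply: leq_ltn_trans h; exact: trunc_logP.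
Qed.

(** Each operation at most multiplies the bounds of its operands, up to a factor [2 ^ b], so the
    exponent counts nodes. *)
Lemma eval_bound M e : bounded M -> small_consts e ->
  (`|eval M e| < 2 ^ (b * esize e))%N.
Proof.
move=> hM; elim: e => [z|a e ih|o e1 ih1 e2 ih2] /=.
- by move=> h; rewrite muln1; apply: leq_trans h _; rewrite leq_exp2l.
- by move=> _; apply: leq_trans (hM _ _) _; rewrite leq_exp2l // leq_pmulr.
move=> /andP[/ih1 {}ih1 /ih2 {}ih2]; rewrite mulnS mulnDr !expnD.
have h1 := ltn0Sn 1; have g0 k : (0 < 2 ^ k)%N by rewrite expn_gt0.
have hb : (2 <= 2 ^ b)%N by rewrite -{1}(expn1 2) leq_exp2l //; lia.
move: ih1 ih2 hb (g0 (b * esize e1)%N) (g0 (b * esize e2)%N).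
move: (2 ^ (b * esize e1))%N (2 ^ (b * esize e2))%N (2 ^ b)%N => p q B.
move: (eval M e1) (eval M e2) => x y hx hy hB p0 q0.
have pq : (p + q <= 2 * (p * q))%N by nia.
have pqB : (2 * (p * q) <= B * (p * q))%N by rewrite leq_mul2r hB orbT.
case: o => /=.
- by apply: leq_trans pqB; lia.
- by apply: leq_trans pqB; lia.
- by rewrite abszM; apply: leq_trans pqB; nia.
- by apply: leq_ltn_trans (lez_div _ _) _; nia.
- by case: (x <= y) => /=; nia.
Qed.

Lemma ecost_le M e : bounded M -> small_consts e ->
  (ecost M e <= b * esize e ^ 2)%N.
Proof.
move=> hM; have b0 : (0 < b)%N by lia.
have hb e' : small_consts e' -> (bitsize (eval M e') <= b * esize e')%N.
  move=> h; apply: bitsize_le; first by rewrite muln_gt0 b0 esize_gt0.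
  exact: eval_bound.
elim: e => [z|a e ih|o e1 ih1 e2 ih2] h.
- have := hb _ h; rewrite /=; lia.
- have := hb _ h; have := ih h => /=; nia.
have := hb _ h; have /andP[/ih1 {}ih1 /ih2 {}ih2] := h => /=; nia.
Qed.

(** An assignment evaluates two expressions, each of cost at most [b * 60 ^ 2] by [ecost_le]. *)
Definition unit_cost := (b * 60 ^ 2 * 2).+2.

(* Reaching [M'] from [M] is bounded by [K] elementary steps, each of which is
   cheap as long as all cells stay below [2 ^ b]. *)
Definition runs (c : com) (M M' : memory) (K : nat) :=
  bounded M -> bounded M' /\
  forall r, exists2 k, (k <= K * unit_cost)%N & exec c (M, r) k (M', r).

(** As [runs] passes boundedness of the cells along, the rules only have to check the values that
    are stored; values of subexpressions may be larger. *)
Definition wp c K (Q : memory -> Prop) M := exists2 M', runs c M M' K & Q M'.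

Lemma wp_mono c K K' (Q Q' : memory -> Prop) M :
  (K <= K')%N -> (forall M', Q M' -> Q' M') -> wp c K Q M -> wp c K' Q' M.
Proof.
move=> KK QQ [M' h q]; exists M'; last exact: QQ.
move=> /h[h1 h2]; split=> // r; have [k kK e] := h2 r; exists k => //.
by apply: leq_trans kK _; rewrite leq_mul2r KK orbT.
Qed.

Lemma wp_skip (Q : memory -> Prop) M : Q M -> wp Skip 1 Q M.
Proof.
move=> q; exists M => // hM; split=> // r; exists 1%N; last exact: exec_skip.
by rewrite mul1n.
Qed.

Lemma wp_assign a e1 e2 (Q : memory -> Prop) M :
  eok e1 -> eok e2 -> (`|eval M e2| < 2 ^ b)%N ->
  Q (write M a (eval M e1) (eval M e2)) -> wp (Assign a e1 e2) 1 Q M.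
Proof.
move=> /andP[s1 c1] /andP[s2 c2] h q; eexists; last exact: q.
move=> hM; split; first by move=> a' i; rewrite /write; case: ifP.
move=> r; eexists; last exact: exec_assign.
have := ecost_le hM c1; have := ecost_le hM c2.
have h1 : (b * esize e1 ^ 2 <= b * 60 ^ 2)%N by rewrite leq_mul2l leq_exp2r ?s1 ?orbT.
have h2 : (b * esize e2 ^ 2 <= b * 60 ^ 2)%N by rewrite leq_mul2l leq_exp2r ?s2 ?orbT.
rewrite /unit_cost mul1n; move: h1 h2; move: (b * 60 ^ 2)%N => z; lia.
Qed.

Lemma wp_seq c1 c2 K1 K2 (Q : memory -> Prop) M :
  wp c1 K1 (wp c2 K2 Q) M -> wp (Seq c1 c2) (K1 + K2).+1 Q M.
Proof.
move=> [M1 h1 [M2 h2 q]]; exists M2 => // /h1[b1 e1].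
have [b2 e2] := h2 b1; split=> // r.
have [k1 l1 x1] := e1 r; have [k2 l2 x2] := e2 r.
eexists; last exact: exec_seq x1 x2.
by rewrite mulSn mulnDl -addn1 addnC leq_add // leq_add.
Qed.

Lemma wp_if e c1 c2 K (Q : memory -> Prop) M :
  eok e -> wp (if eval M e != 0 then c1 else c2) K Q M ->
  wp (If e c1 c2) K.+1 Q M.
Proof.
move=> /andP[s1 h1] [M' h q]; exists M' => // hM; have [b' x] := h hM.
split=> // r; have [k kK ex] := x r; eexists; last exact: (@exec_if e c1 c2 (M, r) _ _ ex).
have := ecost_le hM h1.
have h2 : (b * esize e ^ 2 <= b * 60 ^ 2)%N by rewrite leq_mul2l leq_exp2r ?s1 ?orbT.
move: h2 kK; rewrite mulSn /unit_cost /=; move: (b * 60 ^ 2)%N => z; lia.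
Qed.

Definition Var a := Read a (Const 0).
Definition Set_ a e := Assign a (Const 0) e.
Definition For i N body :=
  Seq (Set_ i (Const 0))
   (While (Op Leq (Op Add (Var i) (Const 1)) N)
     (Seq body (Set_ i (Op Add (Var i) (Const 1))))).

Definition eq_off (l : seq nat) (M M' : memory) :=
  forall a, a \notin l -> M' a = M a.

Lemma eq_off_trans l M1 M2 M3 : eq_off l M1 M2 -> eq_off l M2 M3 -> eq_off l M1 M3.
Proof. by move=> h1 h2 a al; rewrite h2 // h1. Qed.

Lemma eq_off_sub l l' M1 M2 : {subset l <= l'} -> eq_off l M1 M2 -> eq_off l' M1 M2.
Proof. by move=> h1 h2 a al; apply: h2; apply: contra al => /h1. Qed.

Lemma eq_off_write l M1 M2 a i z : a \in l -> eq_off l M1 M2 ->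
  eq_off l M1 (write M2 a i z).
Proof.
move=> al h a' al'; rewrite -h //; apply/funext => j; rewrite /write.
by case: eqP => // e; rewrite e al in al'.
Qed.

Lemma wp_for i N body Nn K (I : nat -> memory -> Prop) M (Q : memory -> Prop) :
  (esize N <= 50)%N -> small_consts N -> (Nn < 2 ^ b)%N ->
  (forall k M', I k M' -> M' i 0 = k /\ eval M' N = Nn) ->
  I 0 (write M i 0 0) ->
  (forall k M', (k < Nn)%N -> I k M' ->
     wp body K (fun M2 => M2 i 0 = k /\ I k.+1 (write M2 i 0 k.+1)) M') ->
  (forall M', I Nn M' -> Q M') ->
  wp (For i N body) (Nn * (K + 3) + 3) Q M.
Proof.
move=> sN cN Nb hI h0 hS hQ.
have b2 : (2 ^ 8 <= 2 ^ b)%N by rewrite leq_exp2l.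
set test := Op Leq (Op Add (Var i) (Const 1)) N.
have okt : eok test by rewrite /eok /= cN !andbT /Var /=; lia.
suff loop j : forall k M1, (k + j = Nn)%N -> I k M1 ->
    wp (While test (Seq body (Set_ i (Op Add (Var i) (Const 1))))) (j * (K + 3) + 1) Q M1.
  apply: (@wp_mono _ (1 + (Nn * (K + 3) + 1)).+1 _ Q); [lia|by []|].
  apply: wp_seq; apply: wp_assign => //.
  by apply: leq_trans b2.
  exact: (loop Nn 0%N).
have costt M1 : bounded M1 -> (ecost M1 test <= b * 60 ^ 2)%N.
  have /andP[s1 s2] := okt.
  move=> hM; apply: leq_trans (ecost_le hM s2) _.
  by rewrite leq_mul2l leq_exp2r ?s1 ?orbT.
elim: j => [|j ih] k M1 kj Ik.
  have kN : k = Nn by rewrite -kj addn0.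
  exists M1; last by apply: hQ; rewrite -kN.
  move=> hM; split=> // r; eexists; last first.
    apply: exec_while_stop => /=; have [-> ->] := hI _ _ Ik.
    by rewrite kN -PoszD lez_nat addn1 ltnn.
  have := costt _ hM; rewrite /unit_cost [(M1, r).1]/=; move: (ecost M1 test) => u; move: (b * 60 ^ 2)%N => z; lia.
have kN : (k < Nn)%N by lia.
have [M2 r2 [Mi I2]] := hS k M1 kN Ik.
have [M3 r3 Q3] := ih k.+1 _ ltac:(lia) I2.
exists M3 => // hM; have [bM2 ex2] := r2 hM.
have bM2' : bounded (write M2 i 0 k.+1).
  move=> a' i'; rewrite /write; case: ifP => // _; apply: leq_ltn_trans Nb.
  by rewrite absz_nat.
have [bM3 ex3] := r3 bM2'; split=> // r.
have [k2 l2 e2] := ex2 r; have [k3 l3 e3] := ex3 r.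
have ea : exec (Set_ i (Op Add (Var i) (Const 1))) (M2, r)
   (ecost M2 (Const 0) + ecost M2 (Op Add (Var i) (Const 1))).+1
   (write M2 i 0 k.+1, r).
  have -> : write M2 i 0 k.+1 =
      write M2 i (eval M2 (Const 0)) (eval M2 (Op Add (Var i) (Const 1))).
    by rewrite /= Mi -PoszD addn1.
  exact: exec_assign.
eexists; last first.
  apply: exec_while_step; [|exact: exec_seq e2 ea|exact: e3].
  by rewrite /=; have [-> ->] := hI _ _ Ik; rewrite -PoszD lez_nat addn1 kN.
have h1 := costt _ hM.
have h2 : (ecost M2 (Const 0) <= b * 60 ^ 2)%N.
  apply: leq_trans (ecost_le bM2 _) _ => //; rewrite leq_mul2l; apply/orP; right.
  by [].
have h3 : (ecost M2 (Op Add (Var i) (Const 1)) <= b * 60 ^ 2)%N.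
  apply: leq_trans (ecost_le bM2 _) _ => //; rewrite leq_mul2l; apply/orP; right.
  by [].
move: h1 h2 h3 l2 l3; rewrite /unit_cost.
move: (ecost M2 (Const 0)) (ecost M2 (Op Add (Var i) (Const 1))) => u1 u2.
rewrite [(M1, r).1]/=.
move: (ecost M1 test) (b * 60 ^ 2)%N => u3 z; nia.
Qed.

Definition Sum a i N e := Seq (Set_ a (Const 0)) (For i N (Set_ a (Op Add (Var a) e))).

Lemma wp_sum a i N e Nn (f : nat -> int) M (Q : memory -> Prop) :
  a != i -> (esize N <= 50)%N -> (esize e <= 50)%N -> small_consts N ->
  small_consts e -> (Nn < 2 ^ b)%N ->
  (forall M', eq_off [:: a; i] M M' -> eval M' N = Nn) ->
  (forall k M', (k < Nn)%N -> eq_off [:: a; i] M M' -> M' i 0 = k ->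
     eval M' e = f k) ->
  (forall k, (k <= Nn)%N -> (`|(\sum_(j < k) f j)%R| < 2 ^ b)%N) ->
  (forall M', eq_off [:: a; i] M M' -> M' a 0 = \sum_(j < Nn) f j -> Q M') ->
  wp (Sum a i N e) (Nn * 4 + 5) Q M.
Proof.
move=> ai sN se cN ce Nb hN he hf hQ.
apply: (@wp_mono _ (1 + (Nn * (1 + 3) + 3)).+1 _ Q); [lia|by []|].
have g0 : (0 < 2 ^ b)%N by rewrite expn_gt0.
apply: wp_seq; apply: wp_assign => //=.
apply: (@wp_for _ _ _ _ _ (fun k M' =>
  [/\ eq_off [:: a; i] M M', M' i 0 = k & M' a 0 = \sum_(j < k) f j])) => //.
- by move=> k M' [h1 h2 h3]; split=> //; exact: hN.
- split; first by do 2!(apply: eq_off_write; first by rewrite !inE eqxx ?orbT).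
  by rewrite /write !eqxx.
  by rewrite /write (negPf ai) /= !eqxx big_ord0.
- move=> k M' kN [h1 h2 h3]; have E : M' a 0 + eval M' e = \sum_(j < k.+1) f j.
    by rewrite big_ord_recr /= h3 (he k).
  apply: wp_assign => //=.
  + by rewrite /eok /= ce andbT; lia.
  + by rewrite E hf.
  split; first by rewrite /write eq_sym (negPf ai).
  split; first by do 2!(apply: eq_off_write; first by rewrite !inE eqxx ?orbT).
    by rewrite /write !eqxx.
  by rewrite /write (negPf ai) /= !eqxx E.
by move=> M' [h1 h2 h3]; exact: hQ.
Qed.

End Bits.

Lemma writeE M a i v j : write M a i v a j = if j == i then v else M a j.
Proof. by rewrite /write eqxx. Qed.

Lemma write_off M a i v a' : a' != a -> write M a i v a' = M a'.
Proof. by move=> h; apply/funext => j; rewrite /write (negPf h). Qed.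

(* Number of elementary steps when every loop makes at most [L] iterations. *)
Fixpoint steps (L : nat) (c : com) : nat :=
  match c with
  | Seq c1 c2 | If _ c1 c2 => (steps L c1 + steps L c2).+1
  | While _ c1 => L * (steps L c1).+1 + 1
  | _ => 1
  end.

Lemma eq_off_incl l l' M M' : all (mem l') l -> eq_off l M M' -> eq_off l' M M'.
Proof. by move=> /allP h; apply: eq_off_sub. Qed.

Lemma eq_off_chain l l1 M M1 M2 : eq_off l1 M1 M2 -> all (mem l) l1 ->
  eq_off l M M1 -> eq_off l M M2.
Proof. by move=> o2 h o1; apply: eq_off_trans o1 _; exact: eq_off_incl o2. Qed.

(** * Proof rules for loops, sums and the filling of arrays *)

Section Loops.
Variables b L s : nat.
Hypothesis b8 : (8 <= b)%N.
Hypothesis Lb : (L < 2 ^ b)%N.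

(** The budget is read off the program text, so specifications compose without step counts. *)
Definition spec c (Q : memory -> Prop) M := wp b c (steps L c) Q M.

Lemma spec_mono c (Q Q' : memory -> Prop) M :
  (forall M', Q M' -> Q' M') -> spec c Q M -> spec c Q' M.
Proof. by move=> h; apply: wp_mono. Qed.

Lemma spec_skip (Q : memory -> Prop) M : Q M -> spec Skip Q M.
Proof. exact: wp_skip. Qed.

Lemma spec_assign a e1 e2 (Q : memory -> Prop) M :
  eok e1 -> eok e2 -> (`|eval M e2| < 2 ^ b)%N ->
  Q (write M a (eval M e1) (eval M e2)) -> spec (Assign a e1 e2) Q M.
Proof. exact: wp_assign. Qed.

Lemma spec_seq c1 c2 (Q : memory -> Prop) M :
  spec c1 (spec c2 Q) M -> spec (Seq c1 c2) Q M.
Proof. exact: wp_seq. Qed.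

Lemma spec_if e c1 c2 (Q : memory -> Prop) M :
  eok e -> (eval M e != 0 -> spec c1 Q M) -> (eval M e = 0 -> spec c2 Q M) ->
  spec (If e c1 c2) Q M.
Proof.
move=> oke h1 h2; apply: wp_if => //.
by case: eqP => [/h2|/eqP/h1] H; apply: (wp_mono _ _ H) => //=;
  rewrite ?leq_addl ?leq_addr.
Qed.

Lemma spec_for i N body Nn (I : nat -> memory -> Prop) M (Q : memory -> Prop) :
  (esize N <= 50)%N -> small_consts N -> (Nn <= L)%N ->
  (forall k M', I k M' -> M' i 0 = k /\ eval M' N = Nn) ->
  I 0 (write M i 0 0) ->
  (forall k M', (k < Nn)%N -> I k M' ->
     spec body (fun M2 => M2 i 0 = k /\ I k.+1 (write M2 i 0 k.+1)) M') ->
  (forall M', I Nn M' -> Q M') ->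
  spec (For i N body) Q M.
Proof.
move=> sN cN NL hI h0 hS hQ; rewrite /spec /=.
apply: (@wp_mono _ _ (Nn * (steps L body + 3) + 3) _ Q) => //.
  have : (Nn * (steps L body + 3) <= L * (steps L body + 3))%N by rewrite leq_mul2r NL orbT.
  by move: (steps L body) => K; nia.
by apply: (@wp_for _ b8 i N body Nn _ I) => //; exact: leq_ltn_trans NL Lb.
Qed.

Lemma spec_sum a i N e Nn (f : 'I_Nn -> int) (B : nat) M (Q : memory -> Prop) :
  a != i -> (esize N <= 50)%N -> (esize e <= 50)%N -> small_consts N ->
  small_consts e -> (Nn <= s)%N -> (s <= L)%N -> (s * B < 2 ^ b)%N ->
  (forall M', eq_off [:: a; i] M M' -> eval M' N = Nn) ->
  (forall (l : 'I_Nn) M', eq_off [:: a; i] M M' -> M' i 0 = l -> eval M' e = f l) ->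
  (forall l, (`|f l| <= B)%N) ->
  (forall M', eq_off [:: a; i] M M' -> M' a 0 = \sum_l f l -> Q M') ->
  spec (Sum a i N e) Q M.
Proof.
move=> ai sN se cN ce Ns sL Bb hN he hf hQ; rewrite /spec.
have NL := leq_trans Ns sL.
pose g k := if insub k is Some l then f l else 0 : int.
have gE (l : 'I_Nn) : g l = f l by rewrite /g valK.
apply: (@wp_mono _ _ (Nn * 4 + 5) _ Q) => //; first by rewrite /=; lia.
apply: (@wp_sum _ b8 a i N e Nn g) => //.
- exact: leq_ltn_trans NL Lb.
- move=> k M' kN h1 h2; rewrite (he (Ordinal kN) _ h1 h2).
  by rewrite -gE.
- move=> k kN; apply: leq_ltn_trans Bb.
  apply: (@leq_trans (\sum_(j < k) B)%N); last first.
    by rewrite sum_nat_const card_ord leq_mul2r (leq_trans kN) ?orbT.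
  elim/big_ind2: _ => // [x1 x2 y1 y2 h1 h2|j _]; first by lia.
  by rewrite /g; case: insub.
move=> M' h1 h2; apply: hQ => //; rewrite h2.
by apply: eq_bigr => l _; rewrite gE.
Qed.

(** The second clause allows one array to be filled in several ranges, as happens for the
    coefficients and the forms. *)
Definition filled (a off Nn : nat) (f : 'I_Nn -> int) (M M' : memory) :=
  (forall l : 'I_Nn, M' a (off + l)%N = f l) /\
  (forall z, (forall l, (l < Nn)%N -> z <> (off + l)%N) -> M' a z = M a z).

(** The body may assume that its target cell still has its initial value, which permits updates in
    place. *)
Lemma spec_fill (i a off : nat) scr N body Nn (f : 'I_Nn -> int) M (Q : memory -> Prop) :
  (esize N <= 50)%N -> small_consts N -> (Nn <= L)%N ->
  a != i -> a \notin scr -> i \notin scr ->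
  (forall M', eq_off [:: a, i & scr] M M' -> eval M' N = Nn) ->
  (forall (l : 'I_Nn) M', eq_off [:: a, i & scr] M M' -> M' i 0 = l ->
     M' a (off + l)%N = M a (off + l)%N ->
     spec body (fun M2 => exists2 M1, eq_off scr M' M1 &
        M2 = write M1 a (off + l)%N (f l)) M') ->
  (forall M', eq_off [:: a, i & scr] M M' -> filled a off f M M' -> Q M') ->
  spec (For i N body) Q M.
Proof.
move=> sN cN Ns ai anS inS hN hb hQ.
apply: (@spec_for i N body Nn (fun k M' =>
  [/\ eq_off [:: a, i & scr] M M', M' i 0 = k,
      forall l : 'I_Nn, (l < k)%N -> M' a (off + l)%N = f l &
      forall z, (forall l, (l < k)%N -> z <> (off + l)%N) -> M' a z = M a z])) => //.
- by move=> k M' [h1 h2 _ _]; split=> //; exact: hN.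
- split.
  + by apply: eq_off_write; rewrite ?inE ?eqxx ?orbT.
  + by rewrite writeE eqxx.
  + by [].
  + by move=> z _; rewrite write_off.
- move=> k M' kN [h1 h2 h3 h4].
  have := hb (Ordinal kN) M' h1 h2.
  rewrite (h4 (off + k)%N); last by move=> l lk; lia.
  move=> /(_ erefl); apply: spec_mono => // M2 [M1 o1 ->] /=.
  have aM1 : M1 a = M' a by exact: o1.
  have iM1 : M1 i = M' i by exact: o1.
  split; first by rewrite write_off 1?eq_sym // iM1.
  split.
  + apply: eq_off_write; first by rewrite !inE eqxx orbT.
    apply: eq_off_write; first by rewrite !inE eqxx.
    by apply: eq_off_trans h1 _; apply: eq_off_sub o1 => a'; rewrite !inE => ->; rewrite !orbT.
  + by rewrite writeE eqxx.
  + move=> l lk; rewrite write_off // writeE; case: eqP => [[]/addnI e|ne].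
      by congr f; apply: val_inj.
    rewrite aM1; apply: h3; rewrite ltn_neqAle -ltnS lk andbT.
    by apply/eqP => e; apply: ne; rewrite e.
  + move=> z hz; rewrite write_off // writeE; case: eqP => [e|_].
      by case: e => e; have := hz k (ltnSn k) e.
    by rewrite aM1; apply: h4 => l lk; apply: hz; exact: leqW.
by move=> M' [h1 h2 h3 h4]; apply: hQ => //; split=> // l; exact: h3.
Qed.

Lemma spec_store (a l : nat) scr M0 e1 e2 v M :
  eok e1 -> eok e2 -> eval M e1 = l -> eval M e2 = v -> (`|v| < 2 ^ b)%N ->
  eq_off scr M0 M ->
  spec (Assign a e1 e2)
    (fun M2 => exists2 M1, eq_off scr M0 M1 & M2 = write M1 a l v) M.
Proof.
by move=> ok1 ok2 h1 h2 hv o; apply: spec_assign; rewrite ?h2 //; exists M; rewrite ?h1.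
Qed.

Lemma spec_set (a : nat) e v M (Q : memory -> Prop) :
  eok e -> eval M e = v -> (`|v| < 2 ^ b)%N ->
  (forall M', eq_off [:: a] M M' -> M' a 0 = v -> Q M') ->
  spec (Set_ a e) Q M.
Proof.
move=> ok1 h1 hv hQ; apply: spec_assign; rewrite ?h1 //; apply: hQ.
  by apply: eq_off_write; rewrite ?inE.
by rewrite writeE.
Qed.

Definition filled2 (a off N1 n : nat) (f : 'I_N1 -> 'I_n -> int) (M M' : memory) :=
  (forall (l : 'I_N1) (j : 'I_n), M' a ((off + l) * n + j)%N = f l j) /\
  (forall z, (forall l j, (l < N1)%N -> (j < n)%N -> z <> ((off + l) * n + j)%N) ->
     M' a z = M a z).

Lemma spec_fill2 (i j a off : nat) N1 N2 ei e n1 n (f : 'I_n1 -> 'I_n -> int) M (Q : memory -> Prop) :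
  (esize N1 <= 50)%N -> small_consts N1 -> (esize N2 <= 50)%N -> small_consts N2 ->
  eok ei -> eok e -> (n1 <= L)%N -> (n <= L)%N ->
  uniq [:: a; i; j] ->
  (forall M', eq_off [:: a; i; j] M M' -> eval M' N1 = n1 /\ eval M' N2 = n) ->
  (forall (l : 'I_n1) (q : 'I_n) M', eq_off [:: a; i; j] M M' -> M' i 0 = l -> M' j 0 = q ->
     M' a ((off + l) * n + q)%N = M a ((off + l) * n + q)%N ->
     eval M' ei = ((off + l) * n + q)%N /\ eval M' e = f l q) ->
  (forall l q, (`|f l q| < 2 ^ b)%N) ->
  (forall M', eq_off [:: a; i; j] M M' -> filled2 a off f M M' -> Q M') ->
  spec (For i N1 (For j N2 (Assign a ei e))) Q M.
Proof.
move=> sN1 cN1 sN2 cN2 oki oke n1s ns un hN hb hf hQ.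
have [ai aj ij] : [/\ a != i, a != j & i != j].
  by move: un; rewrite /= !inE !negb_or andbT => /andP[/andP[-> ->] ->].
apply: (@spec_for i N1 _ n1 (fun k M' =>
  [/\ eq_off [:: a; i; j] M M', M' i 0 = k,
      forall (l : 'I_n1) (q : 'I_n), (l < k)%N -> M' a ((off + l) * n + q)%N = f l q &
      forall z, (forall l q, (l < k)%N -> (q < n)%N -> z <> ((off + l) * n + q)%N) ->
        M' a z = M a z])) => //.
- by move=> k M' [h1 h2 _ _]; split=> //; have [] := hN M' h1.
- split.
  + by apply: eq_off_write; rewrite ?inE ?eqxx ?orbT.
  + by rewrite writeE eqxx.
  + by [].
  + by move=> z _; rewrite write_off.
- move=> k M' kN [h1 h2 h3 h4].
  have sub M2 : eq_off [:: a; j] M' M2 -> eq_off [:: a; i; j] M M2.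
    move=> o; apply: eq_off_trans h1 _; apply: eq_off_sub o => a'.
    by rewrite !inE => /orP[]->; rewrite ?orbT.
  apply: (@spec_fill j a ((off + k) * n)%N [::] N2 _ n (f (Ordinal kN))) => //.
  + by move=> M2 /sub/hN[].
  + move=> q M2 o2 jq hcell.
    have iM2 : M2 i = M' i by apply: o2; rewrite !inE negb_or eq_sym ai ij.
    have [] := hb (Ordinal kN) q M2 (sub _ o2) _ jq _ => /=; first by rewrite iM2.
      rewrite hcell; apply: h4 => l q' lk q'n e1.
      by have := ltn_ord q; move: e1 lk q'n; nia.
    move=> e1 e2; apply: spec_assign => //; first by rewrite e2.
    by exists M2 => //; rewrite e1 e2.
  move=> M2 o2 [g1 g2].
  have iM2 : M2 i = M' i by apply: o2; rewrite !inE negb_or eq_sym ai ij.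
  split; first by rewrite iM2.
  split.
  + by apply: eq_off_write; [rewrite !inE eqxx orbT|exact: sub].
  + by rewrite writeE eqxx.
  + move=> l q lk; rewrite write_off //.
    have [lk'|lk'] := eqVneq (l : nat) k.
      have -> : l = Ordinal kN by apply: val_inj.
      by rewrite -g1 /=.
    rewrite g2; first by apply: h3; rewrite ltn_neqAle lk' -ltnS.
    by move=> q' q'n e1; have := ltn_ord q; move: e1 lk lk' q'n; nia.
  + move=> z hz; rewrite write_off // g2; last by move=> q qn; apply: hz.
    by apply: h4 => l q lk qn; apply: hz => //; exact: leqW.
by move=> M' [h1 h2 h3 h4]; apply: hQ => //; split=> // l q; exact: h3.
Qed.

End Loops.

Arguments spec_store [b L] b8 [a l scr M0 e1 e2 v M] _ _ _ _ _ _.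
Arguments spec_set [b L] b8 [a e v M Q] _ _ _ _.
Arguments spec_assign [b L] b8 [a e1 e2 Q M] _ _ _ _.

(** * The program *)

Module ProgramText.
(* Arrays: 0 and 1 the input, 2 the position x (finally the coloring), 3-5 and 7
   loop counters, 6, 8, 9 scratch, 10 t, 11 k, 12 a power of 2, 13 E, 14 X, 15 c,
   16 u, 17 h, 18 u X^2, 20 alive, 21 partial sums, 22 and 23 the weights
   U^(k+1) and U^k of small sets, 24 small, 25 and 26 coefficients and vectors of the
   quadratic forms, 27 energies U, 30 and 31 adjugate and determinant of the Gram
   matrix, 32 and 33 their update, 40 one plus the pivot (0 if none), 41 the largest
   entry of the pivot column, 42 step, 43 gradient, 44 sign of the step. *)
Declare Scope prog_scope.
Delimit Scope prog_scope with P.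
Notation "x + y" := (Op Defs.Add x y) : prog_scope.
Notation "x - y" := (Op Defs.Sub x y) : prog_scope.
Notation "x * y" := (Op Defs.Mul x y) : prog_scope.
Notation "x / y" := (Op Defs.Div x y) : prog_scope.
Notation "x <= y" := (Op Defs.Leq x y) : prog_scope.
Notation "c1 ;; c2" := (Seq c1 c2) (at level 90, right associativity) : prog_scope.
Notation "a ::= e" := (Set_ a e) (at level 80) : prog_scope.
Notation "a [ i ] ::= e" := (Assign a i e) (at level 80, i at level 70) : prog_scope.
Arguments Var a%_nat_scope.
Arguments Read n%_nat_scope e%_P.
Arguments Set_ a%_nat_scope e%_P.
Arguments Assign n%_nat_scope e1%_P e2%_P.
Arguments Sum (a i)%_nat_scope (N e)%_P.
Arguments For i%_nat_scope N%_P body%_P.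
Arguments If e%_P (c1 c2)%_P.
Bind Scope prog_scope with expr.
Bind Scope prog_scope with com.
Local Open Scope prog_scope.

Notation K z := (Const z%R) (only parsing).
Notation "'vN'" := (Read 0 (Const 0%R)).
Notation "'vM'" := (Read 0 (Const 1%R)).
Notation "'vI'" := (Var 3).
Notation "'vJ'" := (Var 4).
Notation "'vR'" := (Var 5).
Notation "'vA'" := (Var 6).
Notation "'vt'" := (Var 10).
Notation "'vk'" := (Var 11).
Notation "'vE'" := (Var 13).
Notation "'vX'" := (Var 14).
Notation "'vc'" := (Var 15).
Notation "'vh'" := (Var 17).

Definition inc : expr := Read 1 (vI * vN + vJ).

Definition p_degree : com :=
  For 4 vN (Sum 6 3 vM inc;; If (vA <= vt) Skip (10 ::= vA)).

Definition p_log : com :=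
  12 ::= K 1;;
  For 4 vN (If (Var 12 <= vN) (12 ::= K 2 * Var 12;; 11 ::= vk + K 1) Skip).

(** 1024 is written as a product because literals must stay below [2 ^ 8]. *)
Definition p_params : com :=
  13 ::= (K 64 * (vk + K 2)) * (((vN + vM) + K 1) * (((vN + vM) + K 1) * ((vN + vM) + K 1)));;
  14 ::= (vN + K 1) * vE;;
  15 ::= (K 32 * K 32) * (vk + K 2);;
  16 ::= (vc + K 1) * (vc + K 1) + (K 8 * vc) * vt;;
  18 ::= Var 16 * (vX * vX);;
  17 ::= Var 18 * Var 16;;
  For 4 vk (17 ::= vh * Var 18).

Definition p_alive : com :=
  For 4 vN (20[vJ] ::= ((vE + K 1) - vX <= Read 2 vJ) * ((Read 2 vJ + vE) + K 1 <= vX)).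

Definition p_psum : com :=
  For 3 vM (Sum 6 4 vN (inc * Read 2 vJ);; 21[vI] ::= vA).

Definition p_ener : com :=
  For 3 vM (Sum 6 4 vN (inc * (vX * vX - Read 2 vJ * Read 2 vJ));;
    27[vI] ::= ((vc * vc) * (vX * vX) + Read 21 vI * Read 21 vI) + vc * vA).

Definition p_small : com :=
  For 3 vM (Sum 6 4 vN (inc * Read 20 vJ);; 24[vI] ::= vA <= K 8 * vt).

(** The product starts from the 0/1 flag of smallness, so big sets get weight 0. *)
Definition p_wgt0 : com :=
  For 3 vM (9 ::= Read 24 vI;; For 4 vk (9 ::= Var 9 * Read 27 vI);; 23[vI] ::= Var 9).

Definition p_wgt : com := For 3 vM (22[vI] ::= Read 23 vI * Read 27 vI).

Definition p_load : com :=
  For 4 vN (Sum 6 3 vM (inc * Read 22 vI);; 25[vJ] ::= K 16 * (Read 20 vJ * vA)).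

Definition p_bigw : com :=
  Sum 6 4 vN (Read 25 vJ + K 1);; 8 ::= (vE * vE) * vA.

Definition p_coef_set : com :=
  For 3 vM (25[vN + vI] ::= Read 22 vI + (K 1 - Read 24 vI) * Var 8).

Definition p_coef_vec : com := For 3 vM (25[(vN + vM) + vI] ::= Read 23 vI).

Definition p_form_elt : com :=
  For 3 vN (For 4 vN (26[vI * vN + vJ] ::= (vI <= vJ) * (vJ <= vI))).

Definition p_form_set : com :=
  For 3 vM (For 4 vN (26[(vN + vI) * vN + vJ] ::= Read 20 vJ * inc)).

Definition p_form_vec : com :=
  For 3 vM (For 4 vN (26[((vN + vM) + vI) * vN + vJ] ::=
    (Read 20 vJ * inc) * (Read 21 vI - vc * Read 2 vJ))).

Definition p_unit : com :=
  31 ::= K 1;; For 3 vN (For 4 vN (30[vI * vN + vJ] ::= (vI <= vJ) * (vJ <= vI))).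

(** One rank-one update: the adjugate times the new form, the new determinant, then the entries of
    the adjugate in place, following [gadjS]. *)
Definition p_update : com :=
  For 3 vN (Sum 6 4 vN (Read 30 (vI * vN + vJ) * Read 26 (vR * vN + vJ));; 32[vI] ::= vA);;
  Sum 6 4 vN (Read 26 (vR * vN + vJ) * Read 32 vJ);;
  33 ::= Var 31 + Read 25 vR * vA;;
  For 3 vN (For 4 vN (30[vI * vN + vJ] ::=
    (Var 33 * Read 30 (vI * vN + vJ) - (Read 25 vR * Read 32 vI) * Read 32 vJ) / Var 31));;
  31 ::= Var 33.

Definition p_inverse : com := p_unit;; For 5 ((vN + vM) + vM) p_update.

Definition p_pick : com :=
  40 ::= K 0;;
  For 4 vN (If (Read 20 vJ * (Var 31 <= (K 2 * (Read 25 vJ + K 1)) * Read 30 (vJ * vN + vJ)))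
    (40 ::= vJ + K 1) Skip).

Definition pivot_entry : expr := Read 30 (vJ * vN + (Var 40 - K 1)).

Definition p_max : com :=
  41 ::= K 0;;
  For 4 vN (If (Read 20 vJ * (Var 41 <= pivot_entry * (K 2 * (K 0 <= pivot_entry) - K 1)))
    (41 ::= pivot_entry * (K 2 * (K 0 <= pivot_entry) - K 1)) Skip).

Definition p_delta : com :=
  For 4 vN (42[vJ] ::= Read 20 vJ * ((vE * pivot_entry) / Var 41)).

Definition p_grad : com :=
  For 4 vN (Sum 6 3 vM (Read 22 vI * Read 26 (((vN + vM) + vI) * vN + vJ));;
    43[vJ] ::= (vk + K 2) * vA - vh * Read 2 vJ).

Definition p_sign : com :=
  Sum 6 4 vN (Read 43 vJ * Read 42 vJ);; 44 ::= K 1 - K 2 * (K 1 <= vA).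

Definition p_move : com :=
  For 4 vN (2[vJ] ::= Read 2 vJ + Var 44 * Read 42 vJ).

Definition p_weights : com :=
  p_alive;; p_psum;; p_ener;; p_small;; p_wgt0;; p_wgt;; p_load;; p_bigw.

Definition p_forms : com :=
  p_coef_set;; p_coef_vec;; p_form_elt;; p_form_set;; p_form_vec.

Definition p_step : com :=
  p_weights;; p_forms;; p_inverse;; p_pick;;
  If (Var 40) (p_max;; p_delta;; p_grad;; p_sign;; p_move) Skip.

Definition p_final : com :=
  For 4 vN (2[vJ] ::= K 2 * (K 0 <= Read 2 vJ) - K 1).

Definition program : com :=
  p_degree;; p_log;; p_params;;
  For 7 ((K 2 * ((vN + K 1) * (vN + K 1))) * (vM + vN) + K 1) p_step;;
  p_final.
End ProgramText.
Export ProgramText.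

(** * Parameters and sizes of the numbers *)

(** With a non-strict bound, 0/1 values have [e = 0] and exponents add exactly under products. *)
Definition bits (e : nat) (z : int) := (`|z| <= 2 ^ e)%N.

Lemma bits_mono e e' z : (e <= e')%N -> bits e z -> bits e' z.
Proof. by move=> ee h; apply: leq_trans h _; rewrite leq_exp2l. Qed.

Lemma bits_lt e b z : (e < b)%N -> bits e z -> (`|z| < 2 ^ b)%N.
Proof. by move=> eb h; apply: leq_ltn_trans h _; rewrite ltn_exp2l. Qed.

Lemma bitsM e f x y : bits e x -> bits f y -> bits (e + f) (x * y).
Proof. by move=> hx hy; rewrite /bits abszM expnD leq_mul. Qed.

Lemma bitsD e x y : bits e x -> bits e y -> bits e.+1 (x + y).
Proof.
rewrite /bits expnS => hx hy; move: hx hy; move: (2 ^ e)%N => N; lia.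
Qed.

Lemma bitsN e x : bits e x -> bits e (- x).
Proof. by rewrite /bits abszN. Qed.

Lemma bitsX e x k : bits e x -> bits (e * k) (x ^+ k).
Proof. by rewrite /bits abszX expnM => h; case: k => // k; rewrite leq_exp2r. Qed.

Lemma bits_nat e x : (x <= 2 ^ e)%N -> bits e x%:R.
Proof. by rewrite /bits natz. Qed.

Lemma bits_bool (c : bool) e : bits e c%:R.
Proof. by apply: bits_nat; case: c; rewrite ?expn_gt0. Qed.

Lemma bits_le e x y : `|x| <= `|y| -> bits e y -> bits e x.
Proof. rewrite /bits; lia. Qed.

(** At most [s] terms cost [s] more bits, by [s <= 2 ^ s]; crude, but polynomial. *)
Lemma bits_sum (I : finType) (A : pred I) (f : I -> int) e s :
  (#|I| <= s)%N -> (forall i, A i -> bits e (f i)) -> bits (e + s) (\sum_(i | A i) f i).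
Proof.
move=> cI hf; rewrite /bits expnD.
have h1 : (`|(\sum_(i | A i) f i)%R| <= #|I| * 2 ^ e)%N.
  apply: (@leq_trans (\sum_(i | A i) 2 ^ e)%N).
    elim/big_ind2: _ => // x1 x2 y1 y2 h1 h2; lia.
  by rewrite sum_nat_const leq_mul2r max_card orbT.
apply: leq_trans h1 _; rewrite mulnC leq_mul2l; apply/orP; right.
apply: leq_trans cI _; exact/ltnW/ltn_expl.
Qed.

Module ConcreteParams.
Section ConcreteParams.
Variables n m t k : nat.
Definition pE : int := (64 * k.+2%:R) * (n + m + 1)%:R ^+ 3.
Definition pX : int := (n%:R + 1) * pE.
Definition pc : int := 1024 * k.+2%:R.
Definition pu : int := (pc + 1) ^+ 2 + 8 * pc * t%:R.
Definition ph : int := (pu * pX ^+ 2) ^+ k.+1 * pu.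

Lemma concrete_params : params n m t k pE pX pc pu ph k.+2%:R.
Proof. by split. Qed.

Hypothesis tm : (t <= m)%N.
Hypothesis kn : (k <= n)%N.
Let s := (n + m + 1)%N.
Let s3 := (s ^ 3)%N.

Lemma s_facts : [/\ (1 <= s)%N, (s <= s ^ 2)%N, (s ^ 2 <= s3)%N & (s <= s3)%N].
Proof.
have s1 : (1 <= s)%N by rewrite /s addn1.
have e a b : (a <= b)%N -> (s ^ a <= s ^ b)%N by move=> ab; rewrite leq_pexp2l.
by split; [exact: s1|exact: (e 1 2)%N|exact: (e 2 3)%N|exact: (e 1 3)%N].
Qed.

Let le_s a : (a <= s)%N -> (a <= 2 ^ s)%N.
Proof. by move=> h; apply: leq_trans h _; exact/ltnW/ltn_expl. Qed.

Lemma bits_k : bits (s + 1) k.+2%:R.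
Proof.
apply: bits_nat; rewrite expnD expn1; have : (s < 2 ^ s)%N by exact: ltn_expl.
move: (2 ^ s)%N => N; rewrite /s; lia.
Qed.

Lemma bits_E : bits (11 * s) pE.
Proof.
have [s1 _ _ _] := s_facts.
apply: (@bits_mono (6 + (s + 1) + s * 3)); first by lia.
apply: bitsM; first by apply: bitsM; [exact: (@bits_nat 6 64)|exact: bits_k].
by apply/bitsX/bits_nat/le_s.
Qed.

Lemma bits_X : bits (12 * s) pX.
Proof.
apply: (@bits_mono (s + 11 * s)); first by lia.
apply: bitsM bits_E; rewrite natr1; apply/bits_nat/le_s; rewrite /s; lia.
Qed.

Lemma bits_c : bits (12 * s) pc.
Proof.
have [s1 _ _ _] := s_facts.
apply: (@bits_mono (10 + (s + 1))); first by lia.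
by apply: bitsM bits_k; rewrite (_ : 1024 = 2 ^+ 10) //; apply: (@bitsX 1 2 10).
Qed.

Lemma bits_u : bits (27 * s) pu.
Proof.
have [s1 _ _ _] := s_facts.
apply: (@bits_mono (26 * s).+1); first by lia.
apply: bitsD.
  apply: (@bits_mono ((12 * s).+1 * 2)); first by lia.
  apply: bitsX; apply: bitsD; first exact: bits_c.
  by apply: (@bits_nat _ 1); rewrite expn_gt0.
apply: (@bits_mono (3 + 12 * s + s)); first by lia.
apply: bitsM; first by apply: bitsM; [exact: (@bits_nat 3 8)|exact: bits_c].
apply/bits_nat/le_s; rewrite /s; lia.
Qed.

Lemma bits_uX2 : bits (51 * s) (pu * pX ^+ 2).
Proof.
apply: (@bits_mono (27 * s + 12 * s * 2)); first by lia.
by apply: bitsM; [exact: bits_u|exact/bitsX/bits_X].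
Qed.

Lemma bits_pow e (z : int) l : bits (e * s) z -> (l <= k.+1)%N -> bits (e * s3) (z ^+ l).
Proof.
move=> hz lk; have [s1 s2 s23 _] := s_facts.
apply: (@bits_mono (e * s * l)); last exact: bitsX.
have ls : (l <= s)%N by rewrite /s; lia.
rewrite -mulnA leq_mul2l; apply/orP; right; apply: leq_trans s23.
by rewrite (expnD s 1 1) !expn1 leq_mul2l ls orbT.
Qed.

Lemma bits_h l : (l <= k.+1)%N -> bits (78 * s3) ((pu * pX ^+ 2) ^+ l * pu).
Proof.
move=> lk; have [s1 s2 s23 s13] := s_facts.
apply: (@bits_mono (51 * s3 + 27 * s)); first by lia.
by apply: bitsM; [apply: bits_pow => //; exact: bits_uX2|exact: bits_u].
Qed.

Section State.
Variables (sys : m.-tuple {set 'I_n}) (x : 'I_n -> int).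
Hypothesis box : forall j, `|x j| <= pX.
Local Notation psum := (psum sys x).
Local Notation ener := (ener sys pX pc x).
Local Notation wgt := (wgt sys t k pE pX pc x).
Local Notation wgt0 := (wgt0 sys t k pE pX pc x).
Local Notation ind := (ind sys pE pX x).
Local Notation vec := (vec sys pE pX pc x).
Local Notation load := (load sys t k pE pX pc x).
Local Notation bigw := (bigw sys t k pE pX pc x).
Local Notation coef := (coef sys t k pE pX pc x).
Local Notation lform := (lform sys pE pX pc x).
Let P := concrete_params.

Lemma bits_x j : bits (12 * s) (x j).
Proof.
apply: bits_le bits_X; apply: le_trans (box j) _; exact: ler_norm.
Qed.

Lemma ns : (n <= s)%N. Proof. rewrite /s; lia. Qed.
Lemma ms : (m <= s)%N. Proof. rewrite /s; lia. Qed.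

Lemma bits_psum i : bits (13 * s) (psum i).
Proof.
apply: (@bits_mono (12 * s + s)); first by lia.
by apply: bits_sum => [|j _]; [rewrite card_ord ns|exact: bits_x].
Qed.

Lemma bits_gap j : bits (24 * s) (pX ^+ 2 - x j ^+ 2).
Proof.
apply: (@bits_le _ _ (pX ^+ 2)).
  have := sq_le P box j; have := sqr_ge0 (x j) => h1 h2.
  by rewrite !ger0_norm ?sqr_ge0 ?subr_ge0 // lerBlDr lerDl.
by apply: (@bits_mono (12 * s * 2)); [lia|exact/bitsX/bits_X].
Qed.

Lemma bits_ener i : bits (50 * s) (ener i).
Proof.
have [s1 _ _ _] := s_facts.
apply: (@bits_mono (48 * s).+2); first by lia.
apply: bitsD; last first.
  apply: (@bits_mono (12 * s + (24 * s + s))); first by lia.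
  apply: bitsM; first exact: bits_c.
  by apply: bits_sum => [|j _]; [rewrite card_ord ns|exact: bits_gap].
apply: bitsD.
  apply: (@bits_mono (12 * s * 2 + 12 * s * 2)); first by lia.
  by apply: bitsM; apply: bitsX; [exact: bits_c|exact: bits_X].
apply: (@bits_mono (13 * s * 2)); first by lia.
exact/bitsX/bits_psum.
Qed.

Lemma bits_ener_pow i l : (l <= k.+1)%N -> bits (50 * s3) (ener i ^+ l).
Proof. by apply: bits_pow; exact: bits_ener. Qed.

Lemma bits_wgt i : bits (50 * s3) (wgt i).
Proof.
rewrite /Potential.wgt; case: ifP => _; first exact: bits_ener_pow.
by rewrite /bits absz0.
Qed.

Lemma bits_wgt0 i : bits (50 * s3) (wgt0 i).
Proof.
rewrite /Potential.wgt0; case: ifP => _; first by apply: bits_ener_pow; lia.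
by rewrite /bits absz0.
Qed.

Lemma bits_load j : bits (55 * s3) (load j).
Proof.
have [s1 s2 s23 s13] := s_facts.
apply: (@bits_mono (4 + (50 * s3 + s))); first by lia.
apply: bitsM; first exact: (@bits_nat 4 16).
by apply: bits_sum => [|i _]; [rewrite card_ord ms|exact: bits_wgt].
Qed.

Lemma bits_load1 j : bits (56 * s3) (load j + 1).
Proof.
have [s1 s2 s23 s13] := s_facts.
apply: (@bits_mono (55 * s3).+1); first by lia.
by apply: bitsD; [exact: bits_load|apply: (@bits_nat _ 1); rewrite expn_gt0].
Qed.

Lemma bits_bigw : bits (79 * s3) bigw.
Proof.
have [s1 s2 s23 s13] := s_facts.
apply: (@bits_mono (11 * s * 2 + (56 * s3 + s))); first by lia.
apply: bitsM; first exact/bitsX/bits_E.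
by apply: bits_sum => [|i _]; [rewrite card_ord ns|exact: bits_load1].
Qed.

Lemma bits_diff i j : bits (25 * s) (psum i - pc * x j).
Proof.
have [s1 _ _ _] := s_facts.
apply: (@bits_mono (24 * s).+1); first by lia.
apply: bitsD.
  by apply: (@bits_mono (13 * s)); [lia|exact: bits_psum].
apply: bitsN; apply: (@bits_mono (12 * s + 12 * s)); first by lia.
by apply: bitsM; [exact: bits_c|exact: bits_x].
Qed.

Lemma bits_ind i j : bits 0 (ind i j).
Proof. exact: bits_bool. Qed.

Lemma bits_vec i j : bits (25 * s) (vec i j).
Proof. exact: (bitsM (bits_ind i j) (bits_diff i j)). Qed.

Lemma bits_coef q : bits (79 * s3) (coef q).
Proof.
rewrite /Direction.coef; case: insub => [j|].
  by apply: (@bits_mono (55 * s3)); [lia|exact: bits_load].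
case: insub => [i|].
  case: ifP => _; last exact: bits_bigw.
  by apply: (@bits_mono (50 * s3)); [lia|exact: bits_wgt].
case: insub => [i|]; last by rewrite /bits absz0.
by apply: (@bits_mono (50 * s3)); [lia|exact: bits_wgt0].
Qed.

Lemma bits_form q l : bits (25 * s) (lform q l).
Proof.
rewrite /Direction.lform; case: insub => [j|]; first exact: bits_bool.
case: insub => [i|]; first by apply: (@bits_mono 0); [lia|exact: bits_ind].
case: insub => [i|]; last by rewrite /bits absz0.
exact: bits_vec.
Qed.

Let s4 := (s ^ 4)%N.
Let s34 : (s3 <= s4)%N.
Proof. by have [s1 _ _ _] := s_facts; rewrite /s4 /s3 leq_pexp2l. Qed.

Let coef0 q : 0 <= coef q := coef_ge0 sys P box q.

(** By [gdetS_le] each form multiplies the determinant by at most 1 + c |v|^2, a number of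
    [131 * s3] bits, and there are at most [2 * s] forms. *)
Lemma bits_gdet r : (r <= n + m + m)%N -> bits (262 * s4) (gdet coef lform r).
Proof.
move=> hr; have [s1 s2 s23 s13] := s_facts.
apply: (@bits_mono (131 * s3 * r)).
  rewrite (_ : (262 * s4 = 131 * s3 * (2 * s))%N); last first.
    by rewrite /s4 (expnD s 3 1) expn1 -/s3; lia.
  by rewrite leq_mul2l; apply/orP; right; apply: leq_trans hr _; rewrite /s; lia.
elim: r {hr} => [|r ih]; first by rewrite gdet0 /bits muln0.
have d0 q := gdet_gt0 lform coef0 q.
apply: (@bits_le _ _ (gdet coef lform r * (1 + coef r * \sum_i lform r i ^+ 2))).
  have h1 := gdetS_le lform coef0 r.
  by rewrite gtr0_norm // ger0_norm // (le_trans _ h1) // ltW.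
rewrite mulnS addnC; apply: bitsM => //.
apply: (@bits_mono (79 * s3 + (25 * s * 2 + s)).+1); first by lia.
apply: bitsD; first by apply: (@bits_nat _ 1); rewrite expn_gt0.
apply: bitsM; first exact: bits_coef.
by apply: bits_sum => [|i _]; [rewrite card_ord ns|exact/bitsX/bits_form].
Qed.

Lemma bits_gadj r i j : (r <= n + m + m)%N -> bits (262 * s4) (gadj coef lform r i j).
Proof.
move=> hr; apply: bits_le (bits_gdet hr).
by apply: le_trans (gadj_le lform coef0 _ _ _) _; exact: ler_norm.
Qed.

Lemma bits_gadj_form r q i j : (r <= n + m + m)%N ->
  bits (287 * s4) (gadj coef lform r i j * lform q j).
Proof.
move=> hr; have [s1 s2 s23 s13] := s_facts; have := s34 => s34'.
apply: (@bits_mono (262 * s4 + 25 * s)); first by lia.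
by apply: bitsM; [exact: bits_gadj|exact: bits_form].
Qed.

Lemma bits_gsol r q i : (r <= n + m + m)%N -> bits (288 * s4) (gsol coef lform r (lform q) i).
Proof.
move=> hr; have [s1 s2 s23 s13] := s_facts; have := s34 => s34'.
apply: (@bits_mono (287 * s4 + s)); first by lia.
by apply: bits_sum => [|j _]; [rewrite card_ord ns|exact: bits_gadj_form].
Qed.

Lemma bits_form_gsol r q i : (r <= n + m + m)%N ->
  bits (313 * s4) (lform q i * gsol coef lform r (lform q) i).
Proof.
move=> hr; have [s1 s2 s23 s13] := s_facts; have := s34 => s34'.
apply: (@bits_mono (25 * s + 288 * s4)); first by lia.
by apply: bitsM; [exact: bits_form|exact: bits_gsol].
Qed.

Definition slope j : int := k.+2%:R * (\sum_i wgt i * vec i j) - ph * x j.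

Lemma bits_wgt_vec i j : bits (75 * s3) (wgt i * vec i j).
Proof.
have [s1 s2 s23 s13] := s_facts.
apply: (@bits_mono (50 * s3 + 25 * s)); first by lia.
by apply: bitsM; [exact: bits_wgt|exact: bits_vec].
Qed.

Lemma bits_slope j : bits (91 * s3) (slope j).
Proof.
have [s1 s2 s23 s13] := s_facts.
apply: (@bits_mono (90 * s3).+1); first by lia.
apply: bitsD; last first.
  apply: bitsN; apply: (@bits_mono (78 * s3 + 12 * s)); first by lia.
  by apply: bitsM; [exact: bits_h|exact: bits_x].
apply: (@bits_mono (s + 1 + (75 * s3 + s))); first by lia.
apply: bitsM; first exact: bits_k.
by apply: bits_sum => [|i _]; [rewrite card_ord ms|exact: bits_wgt_vec].
Qed.

End State.
End ConcreteParams.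
End ConcreteParams.
Export ConcreteParams.

(** * Correctness of the program *)

Lemma sum_bool (I : finType) (A : pred I) (f : I -> int) :
  \sum_i (A i)%:R * f i = \sum_(i | A i) f i.
Proof. by rewrite [RHS]big_mkcond; apply: eq_bigr => i _; case: (A i); rewrite ?mul1r ?mul0r. Qed.

Lemma eval_alive (x E X : int) :
  Posz (E + 1 - X <= x)%R * Posz (x + E + 1 <= X)%R = (`|x| + E < X)%R%:R.
Proof.
rewrite natz -PoszM mulnb; congr (Posz (nat_of_bool _)).
by apply/andP/idP => [[]|]; [|split]; lia.
Qed.

Lemma card_sum (n : nat) (A : {set 'I_n}) (a : pred 'I_n) :
  \sum_(j in A) (a j)%:R = #|[set j in A | a j]|%:R :> int.
Proof.
rewrite -sum1dep_card natr_sum [RHS]big_mkcond [LHS]big_mkcond; apply: eq_bigr => j _ /=.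
by case: (j \in A); case: (a j).
Qed.

(** * Correctness: memory layout and the weights *)

Section Spec.
Variables (n m : nat) (sys : m.-tuple {set 'I_n}) (t k : nat).
Hypothesis tm : (t <= m)%N.
Hypothesis kn : (k <= n)%N.
Let s := (n + m + 1)%N.
(** The largest stored numbers are sums of at most [s] terms of [313 * s ^ 4] bits, met in the
    update of the determinant. *)
Let b := (400 * s ^ 4)%N.
Let L := (2 * s ^ 3)%N.
Local Notation S := (tnth sys).
Local Notation E := (pE n m k).
Local Notation X := (pX n m k).
Local Notation c := (pc k).
Local Notation h := (ph n m t k).
Local Notation spec := (spec b L).

Lemma s4_facts : [/\ (1 <= s)%N, (s <= s ^ 3)%N, (s <= s ^ 4)%N & (s ^ 3 <= s ^ 4)%N].
Proof.
have s1 : (1 <= s)%N by rewrite /s addn1.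
have e a d : (a <= d)%N -> (s ^ a <= s ^ d)%N by move=> ab; rewrite leq_pexp2l.
by split; [exact: s1|exact: (e 1 3)%N|exact: (e 1 4)%N|exact: (e 3 4)%N].
Qed.

Lemma b_ge8 : (8 <= b)%N.
Proof. have [h1 h2 h3 h4] := s4_facts; rewrite /b; lia. Qed.

Lemma L_lt : (L < 2 ^ b)%N.
Proof.
have [h1 h2 h3 h4] := s4_facts; apply: leq_ltn_trans (_ : 2 ^ (s * 3 + 1) < _)%N.
  rewrite /L addnC expnD expn1 leq_mul // expnM leq_exp2r //; exact/ltnW/ltn_expl.
rewrite ltn_exp2l // /b; lia.
Qed.

Lemma sL : (s <= L)%N.
Proof. have [h1 h2 h3 h4] := s4_facts; rewrite /L; lia. Qed.

Lemma nL : (n <= L)%N. Proof. apply: leq_trans sL; rewrite /s; lia. Qed.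
Lemma mL : (m <= L)%N. Proof. apply: leq_trans sL; rewrite /s; lia. Qed.
Lemma n_s : (n <= s)%N. Proof. rewrite /s; lia. Qed.
Lemma m_s : (m <= s)%N. Proof. rewrite /s; lia. Qed.

Lemma sum_bits e : (e + s < b)%N -> (s * 2 ^ e < 2 ^ b)%N.
Proof.
move=> h0; apply: (@leq_ltn_trans (2 ^ (e + s))%N); last by rewrite ltn_exp2l.
by rewrite expnD mulnC leq_mul2l; apply/orP; right; exact/ltnW/ltn_expl.
Qed.

Local Definition b8 := b_ge8.
Local Definition Lb := L_lt.

Record ctx0 (M : memory) : Prop := Ctx0 {
  c_n : M 0 0 = n;
  c_m : M 0 1 = m;
  c_inc : forall (i : 'I_m) (j : 'I_n), M 1%N (Posz i * Posz n + Posz j) = (j \in S i)%:R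
}.

Record ctx (x : 'I_n -> int) (M : memory) : Prop := Ctx {
  c_0 :> ctx0 M;
  c_t : M 10 0 = t;
  c_k : M 11 0 = k;
  c_E : M 13 0 = E;
  c_X : M 14 0 = X;
  c_c : M 15 0 = c;
  c_h : M 17 0 = h;
  c_x : forall j : 'I_n, M 2%N j = x j
}.

(** Frame rule: the list of written arrays is concrete, so the side condition is decided by
    computation. *)
Lemma ctx0_off l M M' : eq_off l M M' -> ~~ has (mem l) [:: 0; 1]%N -> ctx0 M -> ctx0 M'.
Proof.
move=> o; rewrite /= orbF negb_or => /andP[/o o0 /o o1] [h0 h1 h2].
by split=> *; rewrite ?o0 ?o1.
Qed.

Lemma ctx_off l x M M' : eq_off l M M' ->
  ~~ has (mem l) [:: 0; 1; 2; 10; 11; 13; 14; 15; 17]%N -> ctx x M -> ctx x M'.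
Proof.
move=> o; rewrite /= orbF !negb_or.
case/and5P => i0 i1 /o o2 /o o10 /and5P[/o o11 /o o13 /o o14 /o o15 /o o17].
move=> [h0 h1 h2 h3 h4 h5 h6 h7]; split=> *; rewrite ?o2 ?o10 ?o11 ?o13 ?o14 ?o15 ?o17 //.
by apply: ctx0_off o _ h0; rewrite /= orbF negb_or i0.
Qed.

Section Weights.
Variable x : 'I_n -> int.
Hypothesis box : forall j, `|x j| <= X.
Local Notation al j := ((alive E X x j)%:R : int).
Local Notation sm i := ((small sys t E X x i)%:R : int).
Local Notation psum := (psum sys x).
Local Notation ener := (ener sys X c x).
Local Notation wgt := (wgt sys t k E X c x).
Local Notation wgt0 := (wgt0 sys t k E X c x).
Local Notation load := (load sys t k E X c x).
Local Notation bigw := (bigw sys t k E X c x).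

Ltac fit := rewrite /b; have [] := s4_facts; lia.

(** This and the later specifications quantify over the postcondition and list the written arrays,
    so that consecutive pieces chain by plain application. *)
Lemma p_aliveP M Q : ctx x M ->
  (forall M', eq_off [:: 20; 4]%N M M' -> (forall j : 'I_n, M' 20%N j = al j) -> Q M') ->
  spec p_alive Q M.
Proof.
move=> C hQ; apply: (@spec_fill _ _ b8 Lb 4 20 0 [::] _ _ n (fun j => al j)) => //.
- exact: nL.
- by move=> M' o; rewrite /= (c_n (ctx_off o isT C)).
- move=> j M' o e4 _; have C' := ctx_off o isT C.
  have ev : eval M' (((vE + K 1) - vX <= Read 2 vJ) * ((Read 2 vJ + vE) + K 1 <= vX))%P = al j.
    by rewrite /= e4 (c_E C') (c_X C') (c_x C') eval_alive.
  apply: (spec_store b8) => //.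
  by apply: (@bits_lt 0); [fit|exact: bits_bool].
- by move=> M' o [f1 _]; apply: hQ.
Qed.

Lemma p_psumP M Q : ctx x M ->
  (forall M', eq_off [:: 21; 3; 6; 4]%N M M' -> (forall i : 'I_m, M' 21%N i = psum i) -> Q M') ->
  spec p_psum Q M.
Proof.
move=> C hQ; apply: (@spec_fill _ _ b8 Lb 3 21 0 [:: 6; 4]%N _ _ m psum) => //.
- exact: mL.
- by move=> M' o; rewrite /= (c_m (ctx_off o isT C)).
- move=> i M' o e3 _; have C' := ctx_off o isT C.
  apply: spec_seq; apply: (@spec_sum _ _ s b8 Lb 6 4 _ _ n
     (fun j => (j \in S i)%:R * x j) (2 ^ (12 * s))%N) => //.
  + exact: n_s.
  + exact: sL.
  + by apply: sum_bits; fit.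
  + by move=> M2 o2; rewrite /= (c_n (ctx_off o2 isT C')).
  + move=> j M2 o2 e4; have C2 := ctx_off o2 isT C'.
    by rewrite /= e4 (o2 3%N isT) e3 (c_n C2) (c_inc C2) (c_x C2).
  + by move=> j; apply: (bitsM (bits_bool _ 0)); exact: (bits_x tm kn box).
  move=> M2 o2; rewrite sum_bool -/(psum i) => e6.
  apply: (spec_store b8) => //; first by rewrite /= (o2 3%N isT).
  by apply: (@bits_lt (13 * s)); [fit|exact: (bits_psum tm kn sys box)].
by move=> M' o [f1 _]; apply: hQ.
Qed.


Lemma p_enerP M Q : ctx x M -> (forall i : 'I_m, M 21%N i = psum i) ->
  (forall M', eq_off [:: 27; 3; 6; 4]%N M M' -> (forall i : 'I_m, M' 27%N i = ener i) -> Q M') ->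
  spec p_ener Q M.
Proof.
move=> C h21 hQ; apply: (@spec_fill _ _ b8 Lb 3 27 0 [:: 6; 4]%N _ _ m ener) => //.
- exact: mL.
- by move=> M' o; rewrite /= (c_m (ctx_off o isT C)).
- move=> i M' o e3 _; have C' := ctx_off o isT C.
  apply: spec_seq; apply: (@spec_sum _ _ s b8 Lb 6 4 _ _ n
     (fun j => (j \in S i)%:R * (X ^+ 2 - x j ^+ 2)) (2 ^ (24 * s))%N) => //.
  + exact: n_s.
  + exact: sL.
  + by apply: sum_bits; fit.
  + by move=> M2 o2; rewrite /= (c_n (ctx_off o2 isT C')).
  + move=> j M2 o2 e4; have C2 := ctx_off o2 isT C'.
    by rewrite /= e4 (o2 3%N isT) e3 (c_n C2) (c_inc C2) (c_x C2) (c_X C2) !expr2.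
  + by move=> j; apply: (bitsM (bits_bool _ 0)); exact: (bits_gap tm kn box).
  move=> M2 o2; rewrite sum_bool => e6; have C2 := ctx_off o2 isT C'.
  apply: (spec_store b8) => //.
  + by rewrite /= (o2 3%N isT).
  + rewrite /= (c_c C2) (c_X C2) (o2 3%N isT) e3 (o2 21%N isT) (o 21%N isT) h21 e6.
    by rewrite /Potential.ener -!expr2.
  + by apply: (@bits_lt (50 * s)); [fit|exact: (bits_ener tm kn sys box)].
by move=> M' o [f1 _]; apply: hQ.
Qed.

Lemma p_smallP M Q : ctx x M -> (forall j : 'I_n, M 20%N j = al j) ->
  (forall M', eq_off [:: 24; 3; 6; 4]%N M M' -> (forall i : 'I_m, M' 24%N i = sm i) -> Q M') ->
  spec p_small Q M.
Proof.
move=> C h20 hQ; apply: (@spec_fill _ _ b8 Lb 3 24 0 [:: 6; 4]%N _ _ m (fun i => sm i)) => //.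
- exact: mL.
- by move=> M' o; rewrite /= (c_m (ctx_off o isT C)).
- move=> i M' o e3 _; have C' := ctx_off o isT C.
  apply: spec_seq; apply: (@spec_sum _ _ s b8 Lb 6 4 _ _ n
     (fun j => (j \in S i)%:R * al j) (2 ^ 0)%N) => //.
  + exact: n_s.
  + exact: sL.
  + by apply: sum_bits; fit.
  + by move=> M2 o2; rewrite /= (c_n (ctx_off o2 isT C')).
  + move=> j M2 o2 e4; have C2 := ctx_off o2 isT C'.
    by rewrite /= e4 (o2 3%N isT) e3 (c_n C2) (c_inc C2) (o2 20%N isT) (o 20%N isT) h20.
  + by move=> j; apply: (bitsM (bits_bool _ 0)); exact: bits_bool.
  move=> M2 o2; rewrite sum_bool card_sum => e6; have C2 := ctx_off o2 isT C'.
  apply: (spec_store b8) => //.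
  + by rewrite /= (o2 3%N isT).
  + rewrite /= e6 (c_t C2) /Potential.small [RHS]natz; congr (Posz (nat_of_bool _)).
    by rewrite !natz -PoszM lez_nat.
  + by apply: (@bits_lt 0); [fit|exact: bits_bool].
by move=> M' o [f1 _]; apply: hQ.
Qed.

Lemma p_wgt0P M Q : ctx x M -> (forall i : 'I_m, M 24%N i = sm i) ->
  (forall i : 'I_m, M 27%N i = ener i) ->
  (forall M', eq_off [:: 23; 3; 9; 4]%N M M' -> (forall i : 'I_m, M' 23%N i = wgt0 i) -> Q M') ->
  spec p_wgt0 Q M.
Proof.
move=> C h24 h27 hQ; apply: (@spec_fill _ _ b8 Lb 3 23 0 [:: 9; 4]%N _ _ m wgt0) => //.
- exact: mL.
- by move=> M' o; rewrite /= (c_m (ctx_off o isT C)).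
- move=> i M' o e3 _; have C' := ctx_off o isT C.
  have bnd l : (l <= k)%N -> (`|(sm i * ener i ^+ l)%R| < 2 ^ b)%N.
    move=> lk; apply: (@bits_lt (0 + 50 * s ^ 3)); first by fit.
    apply: bitsM; first exact: bits_bool.
    by apply: (bits_ener_pow tm kn sys box); exact: leqW.
  apply: spec_seq; apply: (spec_assign b8) => //=.
    by rewrite e3 (o 24%N isT) h24; apply: (@bits_lt 0); [fit|exact: bits_bool].
  apply: spec_seq.
  apply: (@spec_for _ _ b8 Lb 4 _ _ k (fun l M2 => [/\ eq_off [:: 9; 4]%N M' M2,
    M2 4%N 0 = l & M2 9%N 0 = sm i * ener i ^+ l])) => //.
  + by apply: leq_trans kn _; exact: nL.
  + by move=> l M2 [o2 e4 _]; split=> //; rewrite /= (c_k (ctx_off o2 isT C')).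
  + split=> //.
    * by do 2!(apply: eq_off_write; first by []).
    * by rewrite /= /write /= e3 (o 24%N isT) h24 expr0 mulr1.
  + move=> l M2 lk [o2 e4 e9].
    have e : M2 9%N 0 * M2 27%N (M2 3%N 0) = sm i * ener i ^+ l.+1.
      by rewrite e9 (o2 3%N isT) e3 (o2 27%N isT) (o 27%N isT) h27 exprSr mulrA.
    apply: (spec_assign b8) => //=; first by rewrite e bnd.
    split; first by rewrite /write /=.
    split=> //=.
    by do 2!(apply: eq_off_write; first by []).
  move=> M2 [o2 e4 e9]; apply: (spec_store b8) => //.
  + by rewrite /= (o2 3%N isT).
  + by rewrite /= e9 /Potential.wgt0; case: (Potential.small _ _ _ _ _ _); rewrite ?mul1r ?mul0r.
  + by apply: (@bits_lt (50 * s ^ 3)); [fit|exact: (bits_wgt0 tm kn sys box)].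
by move=> M' o [f1 _]; apply: hQ.
Qed.

Lemma p_wgtP M Q : ctx x M -> (forall i : 'I_m, M 27%N i = ener i) ->
  (forall i : 'I_m, M 23%N i = wgt0 i) ->
  (forall M', eq_off [:: 22; 3]%N M M' -> (forall i : 'I_m, M' 22%N i = wgt i) -> Q M') ->
  spec p_wgt Q M.
Proof.
move=> C h27 h23 hQ; apply: (@spec_fill _ _ b8 Lb 3 22 0 [::] _ _ m wgt) => //.
- exact: mL.
- by move=> M' o; rewrite /= (c_m (ctx_off o isT C)).
- move=> i M' o e3 _; apply: (spec_store b8) => //.
  + by rewrite /= e3 (o 23%N isT) (o 27%N isT) h27 h23 wgtE.
  + by apply: (@bits_lt (50 * s ^ 3)); [fit|exact: (bits_wgt tm kn sys box)].
by move=> M' o [f1 _]; apply: hQ.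
Qed.

Lemma p_loadP M Q : ctx x M -> (forall j : 'I_n, M 20%N j = al j) ->
  (forall i : 'I_m, M 22%N i = wgt i) ->
  (forall M', eq_off [:: 25; 4; 6; 3]%N M M' -> (forall j : 'I_n, M' 25%N j = load j) -> Q M') ->
  spec p_load Q M.
Proof.
move=> C h20 h22 hQ; apply: (@spec_fill _ _ b8 Lb 4 25 0 [:: 6; 3]%N _ _ n load) => //.
- exact: nL.
- by move=> M' o; rewrite /= (c_n (ctx_off o isT C)).
- move=> j M' o e4 _; have C' := ctx_off o isT C.
  apply: spec_seq; apply: (@spec_sum _ _ s b8 Lb 6 3 _ _ m
     (fun i => (j \in S i)%:R * wgt i) (2 ^ (50 * s ^ 3))%N) => //.
  + exact: m_s.
  + exact: sL.
  + by apply: sum_bits; fit.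
  + by move=> M2 o2; rewrite /= (c_m (ctx_off o2 isT C')).
  + move=> i M2 o2 e3; have C2 := ctx_off o2 isT C'.
    by rewrite /= e3 (o2 4%N isT) e4 (c_n C2) (c_inc C2) (o2 22%N isT) (o 22%N isT) h22.
  + by move=> i; apply: (bitsM (bits_bool _ 0)); exact: (bits_wgt tm kn sys box).
  move=> M2 o2; rewrite sum_bool => e6.
  apply: (spec_store b8) => //.
  + by rewrite /= (o2 4%N isT).
  + rewrite /= e6 (o2 4%N isT) e4 (o2 20%N isT) (o 20%N isT) h20 /Potential.load; congr (_ * _).
    have [a|a] := boolP (alive E X x j); first by rewrite mul1r.
    by rewrite mul0r big_pred0.
  + by apply: (@bits_lt (55 * s ^ 3)); [fit|exact: (bits_load tm kn sys box)].
by move=> M' o [f1 _]; apply: hQ.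
Qed.

Lemma p_bigwP M Q : ctx x M -> (forall j : 'I_n, M 25%N j = load j) ->
  (forall M', eq_off [:: 8; 6; 4]%N M M' -> M' 8%N 0 = bigw -> Q M') ->
  spec p_bigw Q M.
Proof.
move=> C h25 hQ; apply: spec_seq; apply: (@spec_sum _ _ s b8 Lb 6 4 _ _ n
     (fun j => load j + 1) (2 ^ (56 * s ^ 3))%N) => //.
- exact: n_s.
- exact: sL.
- by apply: sum_bits; fit.
- by move=> M2 o2; rewrite /= (c_n (ctx_off o2 isT C)).
- by move=> j M2 o2 e4; rewrite /= e4 (o2 25%N isT) h25.
- by move=> j; exact: (bits_load1 tm kn sys box).
move=> M2 o2 e6; have C2 := ctx_off o2 isT C.
have e : eval M2 ((vE * vE) * vA)%P = bigw by rewrite /= e6 (c_E C2) -expr2.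
apply: (spec_assign b8) => //.
  by rewrite e; apply: (@bits_lt (79 * s ^ 3)); [fit|exact: (bits_bigw tm kn sys box)].
rewrite e; apply: hQ => //=.
by apply: eq_off_write => //; apply: eq_off_sub o2 => a; rewrite !inE => /orP[]->; rewrite ?orbT.
Qed.

Record weights (M : memory) : Prop := Weights {
  w_al : forall j : 'I_n, M 20%N j = al j;
  w_ps : forall i : 'I_m, M 21%N i = psum i;
  w_sm : forall i : 'I_m, M 24%N i = sm i;
  w_w : forall i : 'I_m, M 22%N i = wgt i;
  w_w0 : forall i : 'I_m, M 23%N i = wgt0 i;
  w_ld : forall j : 'I_n, M 25%N j = load j;
  w_bw : M 8%N 0 = bigw
}.

Lemma p_weightsP M Q : ctx x M ->
  (forall M', eq_off [:: 20; 21; 22; 23; 24; 25; 27; 3; 4; 6; 8; 9]%N M M' ->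
    weights M' -> Q M') ->
  spec p_weights Q M.
Proof.
move=> C hQ.
apply: spec_seq; apply: p_aliveP => // M1 o1 h20; have C1 := ctx_off o1 isT C.
apply: spec_seq; apply: p_psumP => // M2 o2 h21; have C2 := ctx_off o2 isT C1.
apply: spec_seq; apply: p_enerP => // M3 o3 h27; have C3 := ctx_off o3 isT C2.
have {}h20 (j : 'I_n) : M3 20%N j = al j by rewrite (o3 20%N isT) (o2 20%N isT).
apply: spec_seq; apply: p_smallP => // M4 o4 h24; have C4 := ctx_off o4 isT C3.
have {}h27 (i : 'I_m) : M4 27%N i = ener i by rewrite (o4 27%N isT).
apply: spec_seq; apply: p_wgt0P => // M5 o5 h23; have C5 := ctx_off o5 isT C4.
have {}h27 (i : 'I_m) : M5 27%N i = ener i by rewrite (o5 27%N isT).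
apply: spec_seq; apply: p_wgtP => // M6 o6 h22; have C6 := ctx_off o6 isT C5.
have {}h20 (j : 'I_n) : M6 20%N j = al j by rewrite (o6 20%N isT) (o5 20%N isT) (o4 20%N isT).
apply: spec_seq; apply: p_loadP => // M7 o7 h25; have C7 := ctx_off o7 isT C6.
apply: p_bigwP => // M8 o8 h8; apply: hQ.
  apply: eq_off_chain o8 _ _ => //; apply: eq_off_chain o7 _ _ => //.
  apply: eq_off_chain o6 _ _ => //; apply: eq_off_chain o5 _ _ => //.
  apply: eq_off_chain o4 _ _ => //; apply: eq_off_chain o3 _ _ => //.
  by apply: eq_off_chain o2 _ _ => //; apply: eq_off_incl o1.
split=> // [j|i|i|i|i|j].
- by rewrite (o8 20%N isT) (o7 20%N isT).
- by rewrite (o8 21%N isT) (o7 21%N isT) (o6 21%N isT) (o5 21%N isT) (o4 21%N isT) (o3 21%N isT).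
- by rewrite (o8 24%N isT) (o7 24%N isT) (o6 24%N isT) (o5 24%N isT).
- by rewrite (o8 22%N isT) (o7 22%N isT).
- by rewrite (o8 23%N isT) (o7 23%N isT) (o6 23%N isT).
- by rewrite (o8 25%N isT).
Qed.

End Weights.
End Spec.

Lemma eval_eq (n : nat) (i j : 'I_n) :
  Posz (Posz i <= Posz j)%R * Posz (Posz j <= Posz i)%R = (j == i)%:R.
Proof.
rewrite natz -PoszM mulnb; congr (Posz (nat_of_bool _)).
by rewrite !lez_nat -eqn_leq eq_sym.
Qed.

Lemma row_neq n q q' l l' : (l < n)%N -> (l' < n)%N -> q <> q' ->
  (q * n + l)%N <> (q' * n + l')%N.
Proof.
move=> ln l'n; have n0 := leq_ltn_trans (leq0n l) ln; apply: contra_not.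
by move/(congr1 (fun z => z %/ n)%N); rewrite !divnMDl // !divn_small // !addn0.
Qed.

(** * Correctness: the quadratic forms and the adjugate *)

Section Inverse.
Variables (n m : nat) (sys : m.-tuple {set 'I_n}) (t k : nat).
Hypothesis tm : (t <= m)%N.
Hypothesis kn : (k <= n)%N.
Let s := (n + m + 1)%N.
Let b := (400 * s ^ 4)%N.
Let L := (2 * s ^ 3)%N.
Local Notation E := (pE n m k).
Local Notation X := (pX n m k).
Local Notation c := (pc k).
Local Notation spec := (spec b L).
Local Notation ctx := (ctx sys t k).
Let b8 := b_ge8 tm kn.
Let Lb := L_lt tm kn.
Let sL := sL tm kn.
Let nL := nL tm kn.
Let mL := mL tm kn.
Let n_s := n_s tm kn.
Let m_s := m_s tm kn.
Variable x : 'I_n -> int.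
Hypothesis box : forall j, `|x j| <= X.
Local Notation al j := ((alive E X x j)%:R : int).
Local Notation psum := (psum sys x).
Local Notation wgt := (wgt sys t k E X c x).
Local Notation wgt0 := (wgt0 sys t k E X c x).
Local Notation vec := (vec sys E X c x).
Local Notation ind := (ind sys E X x).
Local Notation load := (load sys t k E X c x).
Local Notation coef := (coef sys t k E X c x).
Local Notation lform := (lform sys E X c x).
Local Notation gadj := (gadj coef lform).
Local Notation gdet := (gdet coef lform).
Local Notation gsol := (gsol coef lform).
Local Notation weights := (weights sys t k x).
Let R := (n + m + m)%N.
Let P := concrete_params n m t k.
Let coef0 q : 0 <= coef q := coef_ge0 sys P box q.

Ltac fit := rewrite /b; have [] := s4_facts n m; rewrite -/s; lia.

(** The first [n] cells of array 25 already hold the loads, which are the coefficients of the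
    coordinate forms; they survive this fill. *)
Lemma p_coef_setP M Q : ctx x M -> weights M ->
  (forall M', eq_off [:: 25; 3]%N M M' ->
    (forall q : 'I_n, M' 25%N q = coef q) ->
    (forall i : 'I_m, M' 25%N (n + i)%N = coef (n + i)) -> Q M') ->
  spec p_coef_set Q M.
Proof.
move=> C W hQ.
apply: (@spec_fill _ _ b8 Lb 3 25 n [::] _ _ m (fun i => coef (n + i))) => //.
- by move=> M' o; rewrite /= (c_m (ctx_off o isT C)).
- move=> i M' o e3 _; have C' := ctx_off o isT C.
  apply: (spec_store b8) => //.
  + by rewrite /= (c_n C') e3.
  + rewrite /= e3 (o 22%N isT) (o 24%N isT) (o 8%N isT) (w_w W) (w_sm W) (w_bw W).
    rewrite coef_set /Potential.wgt; case: ifP => _; first by rewrite subrr mul0r addr0.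
    by rewrite subr0 mul1r add0r.
  + by apply: (@bits_lt (79 * s ^ 3)); [fit|exact: (bits_coef tm kn sys box)].
move=> M' o [f1 f2]; apply: hQ => // q.
by rewrite f2 ?(w_ld W) ?coef_elt // => l _; have := ltn_ord q; lia.
Qed.

Lemma p_coef_vecP M Q : ctx x M -> (forall i : 'I_m, M 23%N i = wgt0 i) ->
  (forall q : 'I_n, M 25%N q = coef q) ->
  (forall i : 'I_m, M 25%N (n + i)%N = coef (n + i)) ->
  (forall M', eq_off [:: 25; 3]%N M M' ->
    (forall q, (q < R)%N -> M' 25%N q = coef q) -> Q M') ->
  spec p_coef_vec Q M.
Proof.
move=> C h23 h1 h2 hQ.
apply: (@spec_fill _ _ b8 Lb 3 25 (n + m) [::] _ _ m (fun i => coef (n + m + i))) => //.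
- by move=> M' o; rewrite /= (c_m (ctx_off o isT C)).
- move=> i M' o e3 _; have C' := ctx_off o isT C.
  apply: (spec_store b8) => //.
  + by rewrite /= (c_n C') (c_m C') e3.
  + by rewrite /= e3 (o 23%N isT) h23 coef_vec.
  + by apply: (@bits_lt (79 * s ^ 3)); [fit|exact: (bits_coef tm kn sys box)].
move=> M' o [f1 f2]; apply: hQ => // q qR.
have [qn|nq] := ltnP q n.
  rewrite f2 => [|l _]; last by lia.
  exact: (h1 (Ordinal qn)).
have [qm|mq] := ltnP (q - n) m.
  have e : q = (n + Ordinal qm)%N by rewrite /= subnKC.
  by rewrite f2 => [|l _]; [rewrite e h2|lia].
have qv : (q - (n + m) < m)%N by move: qR; rewrite /R; lia.
have e : q = (n + m + Ordinal qv)%N by rewrite /= subnKC //; lia.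
by rewrite e f1.
Qed.

Lemma p_form_eltP M Q : ctx x M ->
  (forall M', eq_off [:: 26; 3; 4]%N M M' ->
    (forall q l : 'I_n, M' 26%N (q * n + l)%N = lform q l) -> Q M') ->
  spec p_form_elt Q M.
Proof.
move=> C hQ.
apply: (@spec_fill2 _ _ b8 Lb 3 4 26 0 _ _ _ _ n n (fun q l => lform q l)) => //.
- by move=> M' o; rewrite /= (c_n (ctx_off o isT C)).
- move=> q l M' o e3 e4 _; have C' := ctx_off o isT C.
  by rewrite /= e3 e4 (c_n C') eval_eq form_elt.
- by move=> q l; apply: (@bits_lt (25 * s)); [fit|exact: (bits_form tm kn sys box)].
by move=> M' o [f1 _]; apply: hQ.
Qed.

Lemma p_form_setP M Q : ctx x M -> (forall j : 'I_n, M 20%N j = al j) ->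
  (forall M', eq_off [:: 26; 3; 4]%N M M' ->
    filled2 26 n (fun (i : 'I_m) (l : 'I_n) => lform (n + i) l) M M' -> Q M') ->
  spec p_form_set Q M.
Proof.
move=> C h20 hQ.
apply: (@spec_fill2 _ _ b8 Lb 3 4 26 n _ _ _ _ m n (fun i l => lform (n + i) l)) => //.
- by move=> M' o; have C' := ctx_off o isT C; rewrite /= (c_n C') (c_m C').
- move=> i l M' o e3 e4 _; have C' := ctx_off o isT C.
  rewrite /= e3 e4 (c_n C') (c_inc C') (o 20%N isT) h20 form_set; split=> //.
  by rewrite /Potential.ind; case: (Potential.alive _ _ _ _); rewrite ?mul1r ?mul0r.
by move=> q l; apply: (@bits_lt (25 * s)); [fit|exact: (bits_form tm kn sys box)].
Qed.

Lemma p_form_vecP M Q : ctx x M -> (forall j : 'I_n, M 20%N j = al j) ->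
  (forall i : 'I_m, M 21%N i = psum i) ->
  (forall M', eq_off [:: 26; 3; 4]%N M M' ->
    filled2 26 (n + m) (fun (i : 'I_m) (l : 'I_n) => lform (n + m + i) l) M M' -> Q M') ->
  spec p_form_vec Q M.
Proof.
move=> C h20 h21 hQ.
apply: (@spec_fill2 _ _ b8 Lb 3 4 26 (n + m) _ _ _ _ m n (fun i l => lform (n + m + i) l)) => //.
- by move=> M' o; have C' := ctx_off o isT C; rewrite /= (c_n C') (c_m C').
- move=> i l M' o e3 e4 _; have C' := ctx_off o isT C.
  rewrite /= e3 e4 (c_n C') (c_m C') (c_inc C') (o 20%N isT) h20 (o 21%N isT) h21.
  rewrite (c_c C') (c_x C') form_vec; split=> //; rewrite /Potential.vec /Potential.ind; congr (_ * _).
  by case: (Potential.alive _ _ _ _); rewrite ?mul1r ?mul0r.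
by move=> q l; apply: (@bits_lt (25 * s)); [fit|exact: (bits_form tm kn sys box)].
Qed.

Record forms_ok (M : memory) : Prop := FormsOk {
  f_coef : forall q, (q < R)%N -> M 25%N q = coef q;
  f_form : forall q (l : 'I_n), (q < R)%N -> M 26%N (q * n + l)%N = lform q l
}.

Lemma p_formsP M Q : ctx x M -> weights M ->
  (forall M', eq_off [:: 25; 26; 3; 4]%N M M' -> forms_ok M' -> Q M') ->
  spec p_forms Q M.
Proof.
move=> C W hQ.
apply: spec_seq; apply: p_coef_setP => // M1 o1 h1 h2; have C1 := ctx_off o1 isT C.
apply: spec_seq; apply: p_coef_vecP => // [i|M2 o2 hc].
  by rewrite (o1 23%N isT) (w_w0 W).
have C2 := ctx_off o2 isT C1.
apply: spec_seq; apply: p_form_eltP => // M3 o3 h3; have C3 := ctx_off o3 isT C2.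
have h20 (j : 'I_n) : M3 20%N j = al j.
  by rewrite (o3 20%N isT) (o2 20%N isT) (o1 20%N isT) (w_al W).
have h21 (i : 'I_m) : M3 21%N i = psum i.
  by rewrite (o3 21%N isT) (o2 21%N isT) (o1 21%N isT) (w_ps W).
apply: spec_seq; apply: p_form_setP => // M4 o4 [f4 g4]; have C4 := ctx_off o4 isT C3.
apply: p_form_vecP => // [j|i|M5 o5 [f5 g5]].
- by rewrite (o4 20%N isT) h20.
- by rewrite (o4 21%N isT) h21.
apply: hQ.
  apply: eq_off_chain o5 _ _ => //; apply: eq_off_chain o4 _ _ => //.
  by apply: eq_off_chain o3 _ _ => //; apply: eq_off_chain o2 _ _ => //; apply: eq_off_incl o1.
split=> [q qR|q l qR].
  by rewrite (o5 25%N isT) (o4 25%N isT) (o3 25%N isT) hc.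
have ln := ltn_ord l.
have [qn|nq] := ltnP q n.
  rewrite g5 => [|i l' im l'n]; last by apply: row_neq => //; lia.
  rewrite g4 => [|i l' im l'n]; last by apply: row_neq => //; lia.
  exact: (h3 (Ordinal qn)).
have [qm|mq] := ltnP (q - n) m.
  have e : q = (n + Ordinal qm)%N by rewrite /= subnKC.
  rewrite g5 => [|i l' im l'n]; last by apply: row_neq => //; lia.
  by rewrite e f4.
have qv : (q - (n + m) < m)%N by move: qR; rewrite /R; lia.
have e : q = (n + m + Ordinal qv)%N by rewrite /= subnKC //; lia.
by rewrite e f5.
Qed.

Lemma p_unitP M Q : ctx x M ->
  (forall M', eq_off [:: 30; 31; 3; 4]%N M M' ->
    M' 31%N 0 = gdet 0 -> (forall i j : 'I_n, M' 30%N (i * n + j)%N = gadj 0 i j) -> Q M') ->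
  spec p_unit Q M.
Proof.
move=> C hQ; apply: spec_seq; apply: (spec_assign b8) => //.
  by apply: (@bits_lt 0); [fit|exact: (@bits_nat 0 1)].
set M1 := write _ _ _ _.
have o1 : eq_off [:: 31]%N M M1 by apply: eq_off_write.
have C1 := ctx_off o1 isT C.
apply: (@spec_fill2 _ _ b8 Lb 3 4 30 0 _ _ _ _ n n (fun i j => gadj 0 i j)) => //.
- by move=> M' o; rewrite /= (c_n (ctx_off o isT C1)).
- move=> i j M' o e3 e4 _; have C' := ctx_off o isT C1.
  by rewrite /= e3 e4 (c_n C') eval_eq gadj0 eq_sym.
- move=> i j; apply: (@bits_lt 0); first by fit.
  by rewrite gadj0; exact: bits_bool.
move=> M' o [f1 _]; apply: hQ => //.
- by apply: eq_off_chain o _ _ => //; apply: eq_off_incl o1.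
- by rewrite (o 31%N isT) /M1 writeE /= gdet0.
Qed.

Lemma p_updateP r M Q : (r < R)%N -> ctx x M -> forms_ok M -> M 5%N 0 = r ->
  M 31%N 0 = gdet r -> (forall i j : 'I_n, M 30%N (i * n + j)%N = gadj r i j) ->
  (forall M', eq_off [:: 30; 31; 32; 33; 3; 4; 6]%N M M' ->
    M' 31%N 0 = gdet r.+1 -> (forall i j : 'I_n, M' 30%N (i * n + j)%N = gadj r.+1 i j) ->
    Q M') ->
  spec p_update Q M.
Proof.
move=> rR C F h5 h31 h30 hQ; have rR' := ltnW rR.
apply: spec_seq.
apply: (@spec_fill _ _ b8 Lb 3 32 0 [:: 6; 4]%N _ _ n (gsol r (lform r))) => //.
- by move=> M' o; rewrite /= (c_n (ctx_off o isT C)).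
- move=> i M' o e3 _; have C' := ctx_off o isT C.
  apply: spec_seq; apply: (@spec_sum _ _ s b8 Lb 6 4 _ _ n
     (fun j => gadj r i j * lform r j) (2 ^ (287 * s ^ 4))%N) => //.
  + by apply: sum_bits; fit.
  + by move=> M2 o2; rewrite /= (c_n (ctx_off o2 isT C')).
  + move=> j M2 o2 e4; have C2 := ctx_off o2 isT C'.
    rewrite /= e4 (o2 3%N isT) e3 (c_n C2) (o2 5%N isT) (o 5%N isT) h5.
    by rewrite (o2 30%N isT) (o 30%N isT) h30 (o2 26%N isT) (o 26%N isT) (f_form F).
  + by move=> j; exact: (bits_gadj_form tm kn sys box).
  move=> M2 o2 e6; apply: (spec_store b8) => //.
  + by rewrite /= (o2 3%N isT).
  + by apply: (@bits_lt (288 * s ^ 4)); [fit|exact: (bits_gsol tm kn sys box)].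
move=> M1 o1 [h32 _]; have C1 := ctx_off o1 isT C.
apply: spec_seq; apply: (@spec_sum _ _ s b8 Lb 6 4 _ _ n
     (fun j => lform r j * gsol r (lform r) j) (2 ^ (313 * s ^ 4))%N) => //.
- by apply: sum_bits; fit.
- by move=> M2 o2; rewrite /= (c_n (ctx_off o2 isT C1)).
- move=> j M2 o2 e4; have C2 := ctx_off o2 isT C1.
  rewrite /= e4 (c_n C2) (o2 5%N isT) (o1 5%N isT) h5.
  by rewrite (o2 26%N isT) (o1 26%N isT) (f_form F) // (o2 32%N isT) h32.
- by move=> j; exact: (bits_form_gsol tm kn sys box).
move=> M2 o2 e6; have C2 := ctx_off o2 isT C1.
have e33 : eval M2 (Var 31 + Read 25 vR * vA)%P = gdet r.+1.
  rewrite /= e6 (o2 31%N isT) (o1 31%N isT) h31 (o2 5%N isT) (o1 5%N isT) h5.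
  by rewrite (o2 25%N isT) (o1 25%N isT) (f_coef F) // [RHS]gdetS.
have bd q : (q <= R)%N -> (`|gdet q| < 2 ^ b)%N.
  by move=> qR; apply: (@bits_lt (262 * s ^ 4)); [fit|exact: (bits_gdet tm kn sys box)].
apply: spec_seq; apply: (spec_assign b8) => //; rewrite e33; first exact: bd.
set M3 := write _ _ _ _.
have o3 : eq_off [:: 33]%N M2 M3 by apply: eq_off_write.
have C3 := ctx_off o3 isT C2.
apply: spec_seq.
apply: (@spec_fill2 _ _ b8 Lb 3 4 30 0 _ _ _ _ n n (fun i j => gadj r.+1 i j)) => //.
- by move=> M' o; rewrite /= (c_n (ctx_off o isT C3)).
(* [e30] says that the entry has not been overwritten yet; the formula reads no other entry of array
   30. *)
- move=> i j M' o e3 e4 e30; have C' := ctx_off o isT C3; split.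
    by rewrite /= e3 e4 (c_n C').
  rewrite /= e3 e4 (c_n C') e30 (o 33%N isT) (o 25%N isT) (o 5%N isT) (o 31%N isT) (o 32%N isT).
  rewrite {1}/M3 writeE eqxx (o3 25%N isT) (o3 5%N isT) (o3 31%N isT) (o3 32%N isT).
  rewrite (o3 30%N isT) (o2 25%N isT) (o2 5%N isT) (o2 31%N isT) (o2 32%N isT) (o2 30%N isT).
  rewrite !h32 (o1 25%N isT) (o1 5%N isT) (o1 31%N isT) (o1 30%N isT) h30 h5 h31 (f_coef F) //.
  by rewrite [RHS]gadjS.
- move=> i j; apply: (@bits_lt (262 * s ^ 4)); first by fit.
  exact: (bits_gadj tm kn sys box).
move=> M4 o4 [f4 _].
have e31 : eval M4 (Var 33) = gdet r.+1 by rewrite /= (o4 33%N isT) /M3 writeE.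
apply: (spec_assign b8) => //; rewrite e31; first exact: bd.
apply: hQ.
- apply: eq_off_write => //.
  apply: eq_off_chain o4 _ _ => //; apply: eq_off_chain o3 _ _ => //.
  by apply: eq_off_chain o2 _ _ => //; apply: eq_off_incl o1.
- by rewrite writeE.
by move=> i j; rewrite write_off //; exact: f4.
Qed.

Record inverse_ok (M : memory) : Prop := InverseOk {
  i_det : M 31%N 0 = gdet R;
  i_adj : forall i j : 'I_n, M 30%N (i * n + j)%N = gadj R i j
}.

Lemma p_inverseP M Q : ctx x M -> forms_ok M ->
  (forall M', eq_off [:: 30; 31; 32; 33; 3; 4; 5; 6]%N M M' -> inverse_ok M' -> Q M') ->
  spec p_inverse Q M.
Proof.
move=> C F hQ; apply: spec_seq; apply: p_unitP => // M1 o1 h31 h30.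
apply: (@spec_for _ _ b8 Lb 5 _ _ R (fun r M' => [/\
  eq_off [:: 30; 31; 32; 33; 3; 4; 5; 6]%N M M', M' 5%N 0 = r, M' 31%N 0 = gdet r &
  forall i j : 'I_n, M' 30%N (i * n + j)%N = gadj r i j])) => //.
- rewrite /R /L; have [h1 h2 h3 h4] := s4_facts n m; move: h2; rewrite -/s.
  by move: (s ^ 3)%N => s3; rewrite /s; lia.
- by move=> r M' [o h5 _ _]; have C' := ctx_off o isT C; rewrite /= (c_n C') (c_m C').
- split=> //.
  + by apply: eq_off_write => //; apply: eq_off_incl o1.
- move=> r M' rR [o h5 h31' h30']; have C' := ctx_off o isT C.
  apply: (@p_updateP r) => //.
    by split=> *; rewrite ?(o 25%N isT) ?(o 26%N isT) ?(f_coef F) ?(f_form F).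
  move=> M2 o2 g31 g30; split; first by rewrite (o2 5%N isT).
  split=> //.
  by apply: eq_off_write => //; apply: eq_off_chain o2 _ _.
by move=> M' [o _ g31 g30]; apply: hQ.
Qed.

End Inverse.

Lemma eval_guard (a q : bool) : a%:R * Posz q = (a && q)%:R.
Proof. by case: a; case: q. Qed.

Lemma abs_norm (y : int) : absz (Num.norm y) = absz y.
Proof. lia. Qed.

Lemma add2_nat (k : nat) : Posz k + 2 = k.+2%:R.
Proof. lia. Qed.

Lemma eval_abs (y : int) : y * (2 * Posz (0 <= y)%R - 1) = `|y|.
Proof. by case: leP => hy /=; [rewrite ger0_norm //|rewrite ltr0_norm //]; ring. Qed.

(** * Correctness: one step of the walk *)

Section OneStep.
Variables (n m : nat) (sys : m.-tuple {set 'I_n}) (t k : nat).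
Hypothesis tm : (t <= m)%N.
Hypothesis kn : (k <= n)%N.
Let s := (n + m + 1)%N.
Let b := (400 * s ^ 4)%N.
Let L := (2 * s ^ 3)%N.
Local Notation E := (pE n m k).
Local Notation X := (pX n m k).
Local Notation c := (pc k).
Local Notation h := (ph n m t k).
Local Notation spec := (spec b L).
Local Notation ctx := (ctx sys t k).
Let b8 := b_ge8 tm kn.
Let Lb := L_lt tm kn.
Let sL := sL tm kn.
Let nL := nL tm kn.
Let mL := mL tm kn.
Let n_s := n_s tm kn.
Let m_s := m_s tm kn.
Variable x : 'I_n -> int.
Hypothesis box : forall j, `|x j| <= X.
Local Notation al j := ((alive E X x j)%:R : int).
Local Notation psum := (psum sys x).
Local Notation wgt := (wgt sys t k E X c x).
Local Notation wgt0 := (wgt0 sys t k E X c x).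
Local Notation vec := (vec sys E X c x).
Local Notation ind := (ind sys E X x).
Local Notation load := (load sys t k E X c x).
Local Notation coef := (coef sys t k E X c x).
Local Notation lform := (lform sys E X c x).
Local Notation gadj := (gadj coef lform).
Local Notation gdet := (gdet coef lform).
Local Notation gsol := (gsol coef lform).
Local Notation weights := (weights sys t k x).
Let R := (n + m + m)%N.
Let P := concrete_params n m t k.
Let coef0 q : 0 <= coef q := coef_ge0 sys P box q.

Ltac fit := rewrite /b; have [] := s4_facts n m; rewrite -/s; lia.

Hypothesis tS : sparse t sys.
Local Notation forms_ok := (forms_ok sys t k x).
Local Notation inverse_ok := (inverse_ok sys t k x).

Definition pivotal (j : 'I_n) := alive E X x j && (gdet R <= 2 * (load j + 1) * gadj R j j).

Lemma p_pickP M Q : ctx x M -> (forall j : 'I_n, M 20%N j = al j) ->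
  forms_ok M -> inverse_ok M ->
  (forall M', eq_off [:: 40; 4]%N M M' ->
    (M' 40%N 0 = 0 /\ forall j, ~~ pivotal j) \/
    (exists2 j : 'I_n, pivotal j & M' 40%N 0 = j.+1) -> Q M') ->
  spec p_pick Q M.
Proof.
move=> C h20 F V hQ; apply: spec_seq; apply: (spec_assign b8) => //.
  by rewrite absz0 expn_gt0.
apply: (@spec_for _ _ b8 Lb 4 _ _ n (fun l M' => [/\ eq_off [:: 40; 4]%N M M', M' 4%N 0 = l &
  (M' 40%N 0 = 0 /\ forall j : 'I_n, (j < l)%N -> ~~ pivotal j) \/
  (exists2 j : 'I_n, pivotal j & M' 40%N 0 = j.+1)])) => //.
- by move=> l M' [o e4 _]; have C' := ctx_off o isT C; rewrite /= (c_n C').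
- split=> //; first by do 2!(apply: eq_off_write; first by []).
  by left.
- move=> l M' ln [o e4 IH]; have C' := ctx_off o isT C.
  pose j := Ordinal ln.
  have ev : eval M' (Read 20 vJ * (Var 31 <= (K 2 * (Read 25 vJ + K 1)) * Read 30 (vJ * vN + vJ)))%P
      = (pivotal j)%:R.
    rewrite /= e4 (c_n C') (o 20%N isT) (h20 j) (o 31%N isT) (i_det V) (o 25%N isT).
    have lR : (l < R)%N by rewrite /R; lia.
    rewrite (f_coef F) // (o 30%N isT) (i_adj V j j) (coef_elt _ _ _ _ _ _ _ j).
    by rewrite eval_guard.
  apply: (spec_if b8) => //; rewrite ev.
    case: (boolP (pivotal j)) => // pj _; apply: (spec_assign b8) => //.
      rewrite /= e4 -PoszD addn1; apply: (@bits_lt s); first by fit.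
      rewrite /bits /=; apply: leq_trans (ltnW (ltn_expl s _)) => //.
      exact: (leq_trans (ltn_ord j) n_s).
    split; first by rewrite write_off.
    split=> //; last by right; exists j; rewrite ?writeE // /write /= e4 -PoszD addn1.
    by do 2!(apply: eq_off_write; first by []).
  case: (boolP (pivotal j)) => // pj _; apply: spec_skip.
  split=> //; split=> //; first by apply: eq_off_write.
  case: IH => [[h0 hl]|[i pi h0]]; last by right; exists i => //; rewrite write_off.
  left; split; first by rewrite write_off.
  move=> i; rewrite ltnS leq_eqVlt => /orP[/eqP e|]; last exact: hl.
  by rewrite (_ : i = j) //; exact: val_inj.
move=> M' [o _ [[h0 hl]|hr]]; apply: hQ => //; [left|right] => //.
by split=> // j; exact: hl.
Qed.

Local Notation slope := (slope t k sys x).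

Lemma p_gradP M Q : ctx x M -> (forall i : 'I_m, M 22%N i = wgt i) -> forms_ok M ->
  (forall M', eq_off [:: 43; 4; 6; 3]%N M M' -> (forall j : 'I_n, M' 43%N j = slope j) -> Q M') ->
  spec p_grad Q M.
Proof.
move=> C h22 F hQ.
apply: (@spec_fill _ _ b8 Lb 4 43 0 [:: 6; 3]%N _ _ n slope) => //.
- by move=> M' o; rewrite /= (c_n (ctx_off o isT C)).
- move=> j M' o e4 _; have C' := ctx_off o isT C.
  apply: spec_seq; apply: (@spec_sum _ _ s b8 Lb 6 3 _ _ m
     (fun i => wgt i * vec i j) (2 ^ (75 * s ^ 3))%N) => //.
  + by apply: sum_bits; fit.
  + by move=> M2 o2; rewrite /= (c_m (ctx_off o2 isT C')).
  + move=> i M2 o2 e3; have C2 := ctx_off o2 isT C'.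
    rewrite /= e3 (o2 22%N isT) (o 22%N isT) h22 (c_n C2) (c_m C2) (o2 4%N isT) e4.
    rewrite (o2 26%N isT) (o 26%N isT); congr (_ * _).
    rewrite -form_vec -(f_form F) //; rewrite /R; have := ltn_ord i; lia.
  + by move=> i; exact: (bits_wgt_vec tm kn sys box).
  move=> M2 o2 e6; have C2 := ctx_off o2 isT C'.
  apply: (spec_store b8) => //.
  + by rewrite /= (o2 4%N isT).
  + rewrite /= e6 (c_k C2) (c_h C2) (o2 4%N isT) e4 (c_x C2) /ConcreteParams.slope.
    by rewrite add2_nat.
  + by apply: (@bits_lt (91 * s ^ 3)); [fit|exact: (bits_slope tm kn sys box)].
by move=> M' o [f1 _]; apply: hQ.
Qed.

Section Move.
Variable j0 : 'I_n.
Hypothesis piv : pivotal j0.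
Let z j := gadj R j j0.

Lemma eval_col M (j : 'I_n) : ctx x M -> inverse_ok M -> M 40%N 0 = j0.+1 -> M 4%N 0 = j ->
  eval M pivot_entry = z j.
Proof.
move=> C V h40 h4; rewrite /= h4 h40 (c_n C).
have -> : Posz j0.+1 - 1 = j0 by rewrite -addn1 PoszD addrK.
exact: (i_adj V).
Qed.

Lemma p_maxP M Q : ctx x M -> (forall j : 'I_n, M 20%N j = al j) ->
  inverse_ok M -> M 40%N 0 = j0.+1 ->
  (forall M' mu, eq_off [:: 41; 4]%N M M' -> M' 41%N 0 = mu ->
     (forall j, alive E X x j -> `|z j| <= mu) ->
     (exists2 j, alive E X x j & `|z j| = mu) -> Q M') ->
  spec p_max Q M.
Proof.
move=> C h20 V h40 hQ; apply: spec_seq; apply: (spec_assign b8) => //.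
  by rewrite absz0 expn_gt0.
have bz j : (`|z j| < 2 ^ b)%N.
  by apply: (@bits_lt (262 * s ^ 4)); [fit|exact: (bits_gadj tm kn sys box)].
apply: (@spec_for _ _ b8 Lb 4 _ _ n (fun l M' => [/\ eq_off [:: 41; 4]%N M M', M' 4%N 0 = l &
  [/\ 0 <= M' 41%N 0,
    forall j : 'I_n, (j < l)%N -> alive E X x j -> `|z j| <= M' 41%N 0 &
    M' 41%N 0 = 0 \/ exists2 j, alive E X x j & `|z j| = M' 41%N 0]])) => //.
- by move=> l M' [o e4 _]; have C' := ctx_off o isT C; rewrite /= (c_n C').
- split=> //; first by do 2!(apply: eq_off_write; first by []).
  by split=> //; left.
- move=> l M' ln [o e4 [mu0 hl hex]]; have C' := ctx_off o isT C.
  pose j := Ordinal ln.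
  have V' : inverse_ok M'.
    by split=> *; rewrite ?(o 31%N isT) ?(o 30%N isT) ?(i_det V) ?(i_adj V).
  have ea : eval M' (pivot_entry * (K 2 * (K 0 <= pivot_entry) - K 1))%P = `|z j|.
    have ec : eval M' pivot_entry = z j by apply: eval_col => //; rewrite (o 40%N isT).
    by rewrite -eval_abs -ec.
  have eg : eval M' (Read 20 vJ * (Var 41 <= pivot_entry * (K 2 * (K 0 <= pivot_entry) - K 1)))%P =
      (alive E X x j && (M' 41%N 0 <= `|z j|))%:R.
    have -> : eval M' (Read 20 vJ * (Var 41 <= pivot_entry * (K 2 * (K 0 <= pivot_entry) - K 1)))%P =
       M' 20%N (M' 4%N 0) * Posz (M' 41%N 0 <=
         eval M' (pivot_entry * (K 2 * (K 0 <= pivot_entry) - K 1))%P)%R by [].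
    by rewrite ea e4 (o 20%N isT) (h20 j) eval_guard.
  apply: (spec_if b8) => //; rewrite eg.
    case: andP => // -[alj hle] _; apply: (spec_assign b8) => //; rewrite ea.
      by rewrite abs_norm.
    split; first by rewrite write_off.
    have e : write (write M' 41 (eval M' (Const 0)) `|z j|) 4 0 l.+1 41%N 0 = `|z j|.
      by rewrite write_off // writeE.
    rewrite e; split=> //; first by do 2!(apply: eq_off_write; first by []).
    split; [by []| |by right; exists j].
    move=> i; rewrite ltnS leq_eqVlt => /orP[/eqP ei _|il ai].
      by rewrite (_ : i = j) //; exact: val_inj.
    exact: le_trans (hl i il ai) hle.
  case: andP => // hno _; apply: spec_skip; split=> //.
  have e : write M' 4 0 l.+1 41%N 0 = M' 41%N 0 by rewrite write_off.
  rewrite e; split=> //; first by apply: eq_off_write.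
  split=> // i; rewrite ltnS leq_eqVlt => /orP[/eqP ei ai|il ai]; last exact: hl.
  have ij : i = j by exact: val_inj.
  rewrite ij in ai *; rewrite leNgt; apply/negP => hlt; apply: hno.
  by split=> //; exact: ltW.
move=> M' [o _ [mu0 hl hex]]; apply: (hQ M' _ o erefl) => [j aj|]; first exact: hl.
have [aj hj] := andP piv.
(* A zero maximum would make the pivot entry vanish, and the pivot inequality would contradict the
   positivity of the determinant. *)
case: hex => // e0; exfalso.
have := hl j0 (ltn_ord j0) aj; rewrite e0 normr_le0 => /eqP z0.
move: hj; rewrite -/(z j0) z0 mulr0 leNgt; apply/negP; rewrite negbK.
exact: gdet_gt0.
Qed.

Variables (mu : int).
Hypothesis mu_ge : forall j, alive E X x j -> `|z j| <= mu.
Hypothesis mu_ex : exists2 j, alive E X x j & `|z j| = mu.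
Definition delta j : int := if alive E X x j then (E * z j %/ mu)%Z else 0.

Let alj0 : alive E X x j0. Proof. by case/andP: piv. Qed.
Let piv' : gdet R <= 2 * (load j0 + 1) * z j0. Proof. by case/andP: piv. Qed.

Lemma bits_delta j : bits (11 * s) (delta j).
Proof.
apply: bits_le (bits_E tm kn); apply: le_trans (ler_norm _).
exact: (dl_le P box piv' alj0 mu_ge (dl := delta)).
Qed.

Lemma p_deltaP M Q : ctx x M -> (forall j : 'I_n, M 20%N j = al j) ->
  inverse_ok M -> M 40%N 0 = j0.+1 -> M 41%N 0 = mu ->
  (forall M', eq_off [:: 42; 4]%N M M' -> (forall j : 'I_n, M' 42%N j = delta j) -> Q M') ->
  spec p_delta Q M.
Proof.
move=> C h20 V h40 h41 hQ.
apply: (@spec_fill _ _ b8 Lb 4 42 0 [::] _ _ n delta) => //.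
- by move=> M' o; rewrite /= (c_n (ctx_off o isT C)).
- move=> j M' o e4 _; have C' := ctx_off o isT C.
  have V' : inverse_ok M'.
    by split=> *; rewrite ?(o 31%N isT) ?(o 30%N isT) ?(i_det V) ?(i_adj V).
  apply: (spec_store b8) => //.
  + have -> : eval M' (Read 20 vJ * ((vE * pivot_entry) / Var 41))%P =
       M' 20%N (M' 4%N 0) * (M' 13%N 0 * eval M' pivot_entry %/ M' 41%N 0)%Z by [].
    rewrite (@eval_col _ j) // ?(o 40%N isT) // e4 (o 20%N isT) h20 (c_E C') (o 41%N isT) h41.
    by rewrite /delta; case: (alive _ _ _ _); rewrite ?mul1r ?mul0r.
  + by apply: (@bits_lt (11 * s)); [fit|exact: bits_delta].
by move=> M' o [f1 _]; apply: hQ.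
Qed.

Let F := \sum_j slope j * delta j.

Lemma p_signP M Q : ctx x M -> (forall j : 'I_n, M 43%N j = slope j) ->
  (forall j : 'I_n, M 42%N j = delta j) ->
  (forall M' sg, eq_off [:: 44; 6; 4]%N M M' -> M' 44%N 0 = sg ->
     sg = 1 \/ sg = -1 -> sg * F <= 0 -> Q M') ->
  spec p_sign Q M.
Proof.
move=> C h43 h42 hQ; apply: spec_seq; apply: (@spec_sum _ _ s b8 Lb 6 4 _ _ n
     (fun j => slope j * delta j) (2 ^ (102 * s ^ 3))%N) => //.
- by apply: sum_bits; fit.
- by move=> M2 o2; rewrite /= (c_n (ctx_off o2 isT C)).
- by move=> j M2 o2 e4; rewrite /= e4 (o2 43%N isT) (o2 42%N isT) h43 h42.
- move=> j; apply: (@bits_mono (91 * s ^ 3 + 11 * s)); first by fit.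
  by apply: bitsM; [exact: (bits_slope tm kn sys box)|exact: bits_delta].
move=> M2 o2 e6; apply: (spec_assign b8) => //.
  apply: (@bits_lt 1); first by fit.
  by rewrite /= e6; case: (1 <= _).
apply: (hQ _ _ _ erefl).
- apply: eq_off_write => //; exact: eq_off_incl o2.
- by rewrite writeE /= e6; case: (1 <= _); [right|left].
rewrite writeE /= e6 -/F; case: leP => h1; rewrite /=.
  by have := h1; lia.
by have := h1; lia.
Qed.

Lemma p_moveP M sg Q : ctx x M -> (forall j : 'I_n, M 42%N j = delta j) ->
  M 44%N 0 = sg -> sg = 1 \/ sg = -1 -> sg * F <= 0 ->
  (forall M' x', eq_off [:: 2; 4]%N M M' -> (forall j : 'I_n, M' 2%N j = x' j) ->
     walk_step sys t k E X c h k.+2%:R x x' -> Q M') ->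
  spec p_move Q M.
Proof.
move=> C h42 h44 sg1 sgF hQ.
have gd := @pivot_good_dir _ _ _ _ _ _ _ _ _ _ _ P _ box j0 mu sg delta piv' alj0 mu_ge mu_ex
   (fun l => erefl) sg1 sgF.
apply: (@spec_fill _ _ b8 Lb 4 2 0 [::] _ _ n (fun j => x j + sg * delta j)) => //.
- by move=> M' o; rewrite /= (o 0%N isT) (c_n C).
- move=> j M' o e4 e2; apply: (spec_store b8) => //.
  + rewrite /= e4 (o 44%N isT) h44 (o 42%N isT) h42.
    by have := c_x C j; rewrite -e2 => ->.
  + apply: (@bits_lt (12 * s)); first by fit.
    apply: bits_le (bits_X tm kn); apply: le_trans (ler_norm _).
    exact: (box_step box gd).
move=> M' o [f1 _]; apply: (hQ M' (fun j => x j + sg * delta j)) => //.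
by left; exists (fun j => sg * delta j).
Qed.

End Move.

Lemma p_stepP M Q : ctx x M ->
  (forall M' x', eq_off [:: 2; 3; 4; 5; 6; 8; 9; 20; 21; 22; 23; 24; 25; 26; 27;
      30; 31; 32; 33; 40; 41; 42; 43; 44]%N M M' ->
     ctx x' M' -> walk_step sys t k E X c h k.+2%:R x x' -> Q M') ->
  spec p_step Q M.
Proof.
move=> C hQ.
have ctx_new M' M'' x' : ctx x M' -> eq_off [:: 2; 4]%N M' M'' ->
    (forall j : 'I_n, M'' 2%N j = x' j) -> ctx x' M''.
  move=> C' o hx; split=> //.
  - exact: (ctx0_off o isT C').
  - by rewrite (o 10%N isT) (c_t C').
  - by rewrite (o 11%N isT) (c_k C').
  - by rewrite (o 13%N isT) (c_E C').
  - by rewrite (o 14%N isT) (c_X C').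
  - by rewrite (o 15%N isT) (c_c C').
  - by rewrite (o 17%N isT) (c_h C').
apply: spec_seq; apply: (p_weightsP tm kn box C) => M1 o1 W; have C1 := ctx_off o1 isT C.
apply: spec_seq; apply: (p_formsP tm kn box C1 W) => M2 o2 Fm; have C2 := ctx_off o2 isT C1.
apply: spec_seq; apply: (p_inverseP tm kn box C2 Fm) => M3 o3 V; have C3 := ctx_off o3 isT C2.
have Fm3 : forms_ok M3.
  by split=> *; rewrite ?(o3 25%N isT) ?(o3 26%N isT) ?(f_coef Fm) ?(f_form Fm).
have a20 (j : 'I_n) : M3 20%N j = al j by rewrite (o3 20%N isT) (o2 20%N isT) (w_al W).
apply: spec_seq; apply: p_pickP => // M4 o4 hp; have C4 := ctx_off o4 isT C3.
have o04 : eq_off [:: 2; 3; 4; 5; 6; 8; 9; 20; 21; 22; 23; 24; 25; 26; 27;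
      30; 31; 32; 33; 40; 41; 42; 43; 44]%N M M4.
  apply: eq_off_chain o4 _ _ => //; apply: eq_off_chain o3 _ _ => //.
  by apply: eq_off_chain o2 _ _ => //; apply: eq_off_incl o1.
apply: (spec_if b8) => //= h40; last first.
  (* Finding no pivot means that nothing is alive, by [pivot_exists]: an idle step. *)
  apply: spec_skip; apply: (hQ _ x) => //; right; split=> // j; apply/negP => aj.
  have [j1 aj1 pj1] := pivot_exists P box tS (ex_intro _ j aj).
  case: hp => [[_ hno]|[j2 _ e]]; last by rewrite e in h40.
  by have := hno j1; rewrite /pivotal aj1 pj1.
case: hp => [[h0 _]|[j0 piv e40]]; first by rewrite h0 in h40.
have V4 : inverse_ok M4.
  by split=> *; rewrite ?(o4 31%N isT) ?(o4 30%N isT) ?(i_det V) ?(i_adj V).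
have b20 (j : 'I_n) : M4 20%N j = al j by rewrite (o4 20%N isT).
apply: spec_seq; apply: (p_maxP piv) => // M5 mu o5 e41 mu_ge mu_ex.
have C5 := ctx_off o5 isT C4.
have V5 : inverse_ok M5.
  by split=> *; rewrite ?(o5 31%N isT) ?(o5 30%N isT) ?(i_det V4) ?(i_adj V4).
apply: spec_seq; apply: (p_deltaP piv mu_ge) => // [j||M6 o6 h42].
- by rewrite (o5 20%N isT).
- by rewrite (o5 40%N isT).
have C6 := ctx_off o6 isT C5.
have Fm6 : forms_ok M6.
  by split=> *; rewrite ?(o6 25%N isT) ?(o6 26%N isT) ?(o5 25%N isT) ?(o5 26%N isT)
    ?(o4 25%N isT) ?(o4 26%N isT) ?(f_coef Fm3) ?(f_form Fm3).
apply: spec_seq; apply: p_gradP => // [i|M7 o7 h43].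
  by rewrite (o6 22%N isT) (o5 22%N isT) (o4 22%N isT) (o3 22%N isT) (o2 22%N isT) (w_w W).
have C7 := ctx_off o7 isT C6.
have {}h42 (j : 'I_n) : M7 42%N j = delta j0 mu j by rewrite (o7 42%N isT).
apply: spec_seq; apply: (p_signP piv mu_ge) => // M8 sg o8 h44 sg1 sgF.
have C8 := ctx_off o8 isT C7.
have {}h42 (j : 'I_n) : M8 42%N j = delta j0 mu j by rewrite (o8 42%N isT).
apply: (p_moveP piv mu_ge mu_ex C8 h42 h44 sg1 sgF) => M9 x' o9 hx hw.
apply: (hQ _ x') => //; last exact: ctx_new o9 hx.
apply: eq_off_chain o9 _ _ => //; apply: eq_off_chain o8 _ _ => //.
apply: eq_off_chain o7 _ _ => //; apply: eq_off_chain o6 _ _ => //.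
by apply: eq_off_chain o5 _ _.
Qed.

End OneStep.

(** The input does not contain [t]; the program computes the least one, and larger values follow by
    monotonicity. *)
Definition max_degree n m (sys : m.-tuple {set 'I_n}) (t : nat) :=
  [/\ sparse t sys, (t <= m)%N & forall t', sparse t' sys -> (t <= t')%N].

Definition is_log (n k : nat) :=
  [/\ (n < 2 ^ k)%N, (k <= n)%N & (0 < k)%N -> (2 ^ k.-1 <= n)%N].

Lemma step_count n m : (2 * (n + 1) ^ 2 * (m + n) + 1 <= 2 * (n + m + 1) ^ 3)%N.
Proof.
set q := (n + m + 1)%N; have q1 : (1 <= q ^ 2)%N by rewrite expn_gt0 /q addn1.
have h1 : ((n + 1) ^ 2 <= q ^ 2)%N by rewrite leq_exp2r // /q; lia.
have h2 : ((n + 1) ^ 2 * (m + n) <= q ^ 2 * (m + n))%N by rewrite leq_mul2r h1 orbT.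
have -> : (q ^ 3 = q ^ 2 * (m + n) + q ^ 2)%N.
  by rewrite (expnD q 2 1) -[X in (_ + X)%N]muln1 -mulnDr; congr (_ * _)%N; rewrite /q; lia.
rewrite -mulnA; move: h2 q1.
move: ((n + 1) ^ 2 * (m + n))%N (q ^ 2 * (m + n))%N (q ^ 2)%N => a1 a2 a3; lia.
Qed.

Lemma eval_steps n m :
  2 * ((Posz n + 1) * (Posz n + 1)) * (Posz m + Posz n) + 1 =
  (2 * (n + 1) ^ 2 * (m + n) + 1)%N.
Proof. by rewrite -[1]/(Posz 1) -[2]/(Posz 2) -!(PoszD, PoszM) mulnn. Qed.

(** * Correctness: parameters, main loop and final rounding *)

Section Program.
Variables (n m : nat) (sys : m.-tuple {set 'I_n}).
Let s := (n + m + 1)%N.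
Let b := (400 * s ^ 4)%N.
Let L := (2 * s ^ 3)%N.
Local Notation S := (tnth sys).
Local Notation spec := (spec b L).
Local Notation ctx0 := (ctx0 sys).
Let b8 := b_ge8 (leq0n m) (leq0n n).
Let Lb := L_lt (leq0n m) (leq0n n).
Let sL := sL (leq0n m) (leq0n n).
Let nL := nL (leq0n m) (leq0n n).
Let mL := mL (leq0n m) (leq0n n).
Let n_s := n_s (leq0n m) (leq0n n).
Let m_s := m_s (leq0n m) (leq0n n).

Ltac fit := rewrite /b; have [] := s4_facts n m; rewrite -/s; lia.

Let small_nat l : (l <= s)%N -> (`|Posz l| < 2 ^ b)%N.
Proof.
move=> ls; apply: (@bits_lt s); first by fit.
by rewrite /bits /=; apply: leq_trans ls _; exact/ltnW/ltn_expl.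
Qed.

Lemma p_degreeP M Q : ctx0 M -> M 10%N 0 = 0 ->
  (forall M' (t : nat), eq_off [:: 4; 6; 3; 10]%N M M' -> M' 10%N 0 = t -> max_degree sys t -> Q M') ->
  spec p_degree Q M.
Proof.
move=> C h10 hQ.
pose deg j := count (fun A : {set 'I_n} => j \in A) sys.
have degE j : \sum_i ((j \in S i)%:R : int) = deg j.
  rewrite /deg -sum1_count big_tuple -natz natr_sum [RHS]big_mkcond.
  by apply: eq_bigr => i _; case: (j \in S i).
have degm j : (deg j <= m)%N by rewrite -[X in (_ <= X)%N](size_tuple sys) count_size.
apply: (@spec_for _ _ b8 Lb 4 _ _ n (fun l M' => [/\ eq_off [:: 4; 6; 3; 10]%N M M', M' 4%N 0 = l &
  exists v : nat, [/\ M' 10%N 0 = v, forall j : 'I_n, (j < l)%N -> (deg j <= v)%N &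
    v = 0%N \/ exists j, deg j = v]])) => //.
- by move=> l M' [o e4 _]; have C' := ctx0_off o isT C; rewrite /= (c_n C').
- split=> //; first by apply: eq_off_write.
  by exists 0%N; split=> //; left.
- move=> l M' ln [o e4 [v [h10' hv hex]]]; have C' := ctx0_off o isT C.
  pose j := Ordinal ln.
  apply: spec_seq; apply: (@spec_sum _ _ s b8 Lb 6 3 _ _ m
     (fun i => (j \in S i)%:R) (2 ^ 0)%N) => //.
  + by rewrite muln1; apply: leq_ltn_trans Lb; exact: sL.
  + by move=> M2 o2; rewrite /= (c_m (ctx0_off o2 isT C')).
  + move=> i M2 o2 e3; have C2 := ctx0_off o2 isT C'.
    by rewrite /= e3 (o2 4%N isT) e4 (c_n C2) (c_inc C2 i j).
  + by move=> i; case: (j \in S i).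
  move=> M2 o2; rewrite degE => e6.
  have o02 : eq_off [:: 4; 6; 3; 10]%N M M2 by apply: eq_off_chain o2 _ _.
  have e10 : M2 10%N 0 = v by rewrite (o2 10%N isT).
  have ev : eval M2 (vA <= vt)%P = Posz (deg j <= v)%N by rewrite /= e6 e10 lez_nat.
  apply: (spec_if b8) => //; rewrite ev.
    case: (leqP (deg j) v) => // hd _; apply: spec_skip.
    split; first by rewrite (o2 4%N isT).
    split=> //; first by apply: eq_off_write.
    exists v; split; [by rewrite write_off| |by []].
    move=> i; rewrite ltnS leq_eqVlt => /orP[/eqP e|]; last exact: hv.
    by rewrite (_ : i = j) //; exact: val_inj.
  case: (leqP (deg j) v) => // hd _; apply: (spec_assign b8) => //=.
    by rewrite e6; apply: small_nat; apply: leq_trans (degm j) _; exact: m_s.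
  split; first by rewrite write_off // (o2 4%N isT).
  split=> //; first by do 2!(apply: eq_off_write; first by []).
  exists (deg j); split; [by rewrite write_off // writeE| |by right; exists j].
  move=> i; rewrite ltnS leq_eqVlt => /orP[/eqP e|il].
    by rewrite (_ : i = j) //; exact: val_inj.
  by apply: leq_trans (hv i il) _; exact: ltnW.
move=> M' [o _ [v [h10' hv hex]]]; apply: (hQ _ v) => //; split.
- by move=> j; exact: hv.
- by case: hex => [->|[j <-]].
by move=> t' ht'; case: hex => [->|[j <-]] //; exact: ht'.
Qed.

Lemma p_logP M Q : ctx0 M -> M 11%N 0 = 0 ->
  (forall M' (k : nat), eq_off [:: 4; 11; 12]%N M M' -> M' 11%N 0 = k -> is_log n k -> Q M') ->
  spec p_log Q M.
Proof.
move=> C h11 hQ; apply: spec_seq; apply: (spec_assign b8) => //.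
  by apply: (@small_nat 1); rewrite /s addn1.
(* Either [2 ^ k] has exceeded [n], or [k] has grown in every iteration; in the latter case [k = n]
   at the end, and [n < 2 ^ n]. *)
apply: (@spec_for _ _ b8 Lb 4 _ _ n (fun l M' => [/\ eq_off [:: 4; 11; 12]%N M M', M' 4%N 0 = l &
  exists k : nat, [/\ M' 11%N 0 = k, M' 12%N 0 = (2 ^ k)%N, (k <= l)%N,
    (0 < k)%N -> (2 ^ k.-1 <= n)%N & (n < 2 ^ k)%N \/ k = l]])) => //.
- by move=> l M' [o e4 _]; have C' := ctx0_off o isT C; rewrite /= (c_n C').
- split=> //; first by do 2!(apply: eq_off_write; first by []).
  by exists 0%N; split=> //; right.
- move=> l M' ln [o e4 [k [h11' h12 kl hk hor]]]; have C' := ctx0_off o isT C.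
  have ev : eval M' (Var 12 <= vN)%P = Posz (2 ^ k <= n)%N by rewrite /= h12 (c_n C') lez_nat.
  apply: (spec_if b8) => //; rewrite ev.
    case: (leqP (2 ^ k)%N n) => // hd _.
    have kl' : k = l by case: hor => // ; rewrite ltnNge hd.
    apply: spec_seq; apply: (spec_assign b8) => //=.
      rewrite h12; apply: (@bits_lt (1 + s)); first by fit.
      apply: bitsM => //; rewrite /bits /=; apply: leq_trans hd _.
      by apply: leq_trans n_s _; exact/ltnW/ltn_expl.
    apply: (spec_assign b8) => //=.
      rewrite /write /= h11' -PoszD addn1; apply: small_nat.
      by rewrite kl'; apply: leq_trans ln _; exact: n_s.
    split; first by rewrite /write.
    split=> //; first by do 3!(apply: eq_off_write; first by []).
    exists k.+1; split.
    + by rewrite /write /= h11' -PoszD addn1.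
    + by rewrite /write /= h12 expnS.
    + by rewrite kl'.
    + by [].
    + by right; rewrite kl'.
  case: (leqP (2 ^ k)%N n) => // hd _; apply: spec_skip.
  split=> //; split=> //; first by apply: eq_off_write.
  by exists k; split=> //; [exact: leqW|left].
move=> M' [o _ [k [h11' _ kn hk hor]]]; apply: (hQ _ k) => //; split=> //.
by case: hor => // ->; exact: ltn_expl.
Qed.

Section WithParams.
Variables t k : nat.
Hypothesis tm : (t <= m)%N.
Hypothesis kn : (k <= n)%N.
Local Notation E := (pE n m k).
Local Notation X := (pX n m k).
Local Notation c := (pc k).
Local Notation u := (pu t k).
Local Notation h := (ph n m t k).

Let lt_b e z : bits e z -> (e < b)%N -> (`|z| < 2 ^ b)%N.
Proof. by move=> h1 h2; exact: bits_lt h1. Qed.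

Lemma p_paramsP M Q : ctx0 M -> M 10%N 0 = t -> M 11%N 0 = k ->
  (forall j : 'I_n, M 2%N j = 0) ->
  (forall M', ctx sys t k (fun=> 0) M' -> Q M') ->
  spec p_params Q M.
Proof.
move=> C h10 h11 h2 hQ.
have es : Posz n + Posz m + 1 = s%:R by rewrite natz -!PoszD.
apply: spec_seq; apply: (spec_set b8 (v := E)) => //.
- rewrite /= (c_n C) (c_m C) h11 add2_nat es /pE -/s; ring.
- by apply: lt_b (bits_E tm kn) _; fit.
move=> M1 o1 e13; have C1 := ctx0_off o1 isT C.
apply: spec_seq; apply: (spec_set b8 (v := X)) => //.
- by rewrite /= (c_n C1) e13 /pX natz.
- by apply: lt_b (bits_X tm kn) _; fit.
move=> M2 o2 e14.
apply: spec_seq; apply: (spec_set b8 (v := c)) => //.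
- by rewrite /= (o2 11%N isT) (o1 11%N isT) h11 add2_nat /pc; ring.
- by apply: lt_b (bits_c tm kn) _; fit.
move=> M3 o3 e15.
apply: spec_seq; apply: (spec_set b8 (v := u)) => //.
- rewrite /= e15 (o3 10%N isT) (o2 10%N isT) (o1 10%N isT) h10.
  by rewrite /pu (natz t) expr2.
- by apply: lt_b (bits_u tm kn) _; fit.
move=> M4 o4 e16.
apply: spec_seq; apply: (spec_set b8 (v := u * X ^+ 2)) => //.
- by rewrite /= e16 (o4 14%N isT) (o3 14%N isT) e14 expr2.
- by apply: lt_b (bits_uX2 tm kn) _; fit.
move=> M5 o5 e18.
have bh l : (l <= k.+1)%N -> (`|((u * X ^+ 2) ^+ l * u)%R| < 2 ^ b)%N.
  by move=> lk; apply: lt_b (bits_h tm kn lk) _; fit.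
apply: spec_seq; apply: (spec_set b8 (v := (u * X ^+ 2) ^+ 1 * u)) => //.
- by rewrite /= e18 (o5 16%N isT) e16 expr1.
- exact: bh.
move=> M6 o6 e17.
have o06 : eq_off [:: 13; 14; 15; 16; 17; 18]%N M M6.
  apply: eq_off_chain o6 _ _ => //; apply: eq_off_chain o5 _ _ => //.
  apply: eq_off_chain o4 _ _ => //; apply: eq_off_chain o3 _ _ => //.
  by apply: eq_off_chain o2 _ _ => //; apply: eq_off_incl o1.
have C6 := ctx0_off o06 isT C.
apply: (@spec_for _ _ b8 Lb 4 _ _ k (fun l M' => [/\ eq_off [:: 17; 4]%N M6 M',
  M' 4%N 0 = l & M' 17%N 0 = (u * X ^+ 2) ^+ l.+1 * u])) => //.
- by apply: leq_trans kn _; exact: nL.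
- by move=> l M' [o e4 _]; split=> //; rewrite /= (o 11%N isT) (o06 11%N isT) h11.
- by split=> //; apply: eq_off_write.
- move=> l M' lk [o e4 e17'].
  apply: (spec_set b8 (v := (u * X ^+ 2) ^+ l.+2 * u)) => //.
  + by rewrite /= e17' (o 18%N isT) (o6 18%N isT) e18 [in RHS]exprSr; ring.
  + exact: bh.
  move=> M2' o2' g17; split; first by rewrite (o2' 4%N isT).
  split=> //.
  by apply: eq_off_write => //; apply: eq_off_chain o2' _ _.
move=> M' [o _ e17']; apply: hQ; split.
- exact: (ctx0_off o isT C6).
- by rewrite (o 10%N isT) (o06 10%N isT).
- by rewrite (o 11%N isT) (o06 11%N isT).
- by rewrite (o 13%N isT) (o6 13%N isT) (o5 13%N isT) (o4 13%N isT) (o3 13%N isT) (o2 13%N isT).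
- by rewrite (o 14%N isT) (o6 14%N isT) (o5 14%N isT) (o4 14%N isT) (o3 14%N isT).
- by rewrite (o 15%N isT) (o6 15%N isT) (o5 15%N isT) (o4 15%N isT).
- exact: e17'.
by move=> j; rewrite (o 2%N isT) (o06 2%N isT) h2.
Qed.

Hypothesis tS : sparse t sys.
Let P := concrete_params n m t k.
Let N := (2 * (n + 1) ^ 2 * (m + n) + 1)%N.

Lemma p_walkP M Q : ctx sys t k (fun=> 0) M ->
  (forall M' x, ctx sys t k x M' -> walk_inv sys t k E X c h N x -> Q M') ->
  spec (For 7 ((K 2 * ((vN + K 1) * (vN + K 1))) * (vM + vN) + K 1)%P p_step) Q M.
Proof.
move=> C hQ.
apply: (@spec_for _ _ b8 Lb 7 _ _ N (fun q M' => M' 7%N 0 = q /\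
  exists2 x, ctx sys t k x M' & walk_inv sys t k E X c h q x)) => //.
- exact: step_count.
- move=> q M' [h7 [x C' _]]; split=> //.
  by rewrite /= (c_n C') (c_m C') eval_steps.
- split=> //; exists (fun=> 0); last exact: (walk_inv0 sys P).
  by apply: (@ctx_off _ _ _ _ _ [:: 7]%N _ _ _ _ isT C); apply: eq_off_write.
- move=> q M' qN [h7 [x C' I]].
  apply: (p_stepP tm kn (wi_box I) tS C') => M2 x' o2 C2 st.
  split; first by rewrite (o2 7%N isT).
  split=> //; exists x'; last first.
    apply: (walk_inv_step P _ I st).
    (* As [X] is [n + 1] times [E], the drift stays below [X] if the number of steps is at most [E];
       the cube in [pE] ensures this. *)
    rewrite mulrC /pX; apply: ler_wpM2l; first by rewrite addr_ge0.
    apply: (@le_trans _ _ (2 * s ^ 3)%:R).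
      by rewrite ler_nat; apply: leq_trans (step_count n m).
    rewrite /pE natrM natrX; apply: ler_wpM2r; first exact: exprn_ge0.
    by rewrite -natrM ler_nat; lia.
  by apply: (@ctx_off _ _ _ _ _ [:: 7]%N _ _ _ _ isT C2); apply: eq_off_write.
by move=> M' [_ [x C' I]]; apply: hQ C' I.
Qed.

Lemma p_finalP x M Q : ctx sys t k x M ->
  (forall M' : memory, (forall j : 'I_n, M' 2%N j = sgn x j) -> Q M') ->
  spec p_final Q M.
Proof.
move=> C hQ.
apply: (@spec_fill _ _ b8 Lb 4 2 0 [::] _ _ n (fun j => sgn x j)) => //.
- by move=> M' o; rewrite /= (o 0%N isT) (c_n C).
- move=> j M' o e4 e2; apply: (spec_store b8) => //.
  + rewrite /= e4; have := c_x C j; rewrite -e2 => ->.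
    by rewrite /sgn; case: (0 <= x j).
  + by rewrite /sgn; case: (0 <= x j); apply: (@bits_lt 0); [fit| |fit|].
by move=> M' o [f1 _]; apply: hQ.
Qed.

End WithParams.
End Program.

(** * The running time and the final bound *)

Section Run.
Variables (n m : nat) (sys : m.-tuple {set 'I_n}).
Let s := (n + m + 1)%N.
Local Notation S := (tnth sys).

Definition bitwidth (q : nat) := (400 * q ^ 4)%N.
Definition max_loop (q : nat) := (2 * q ^ 3)%N.

Definition outcome (chi : 'I_n -> int) := exists t k q x,
  [/\ max_degree sys t, is_log n k,
      walk_inv sys t k (pE n m k) (pX n m k) (pc k) (ph n m t k) q x,
      forall j, ~~ alive (pE n m k) (pX n m k) x j & chi = sgn x].

Lemma ctx0_input : ctx0 sys (input_mem sys).
Proof. by split=> // i j; rewrite natz -input_mem_incidence PoszD PoszM. Qed.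

Lemma bounded_input : bounded (bitwidth s) (input_mem sys).
Proof.
have [s1 _ s4 _] := s4_facts n m; rewrite -/s in s1 s4.
have nat_b l : (l <= s)%N -> (`|Posz l| < 2 ^ bitwidth s)%N.
  move=> ls; apply: (@bits_lt s); first by rewrite /bitwidth; lia.
  by rewrite /bits /=; apply: leq_trans ls _; exact/ltnW/ltn_expl.
move=> [|[|a]] [[|[|i]]|i] /=; try exact: (nat_b 0%N); try by case: [exists _, _].
- by apply: nat_b; rewrite /s; lia.
- by apply: nat_b; rewrite /s; lia.
- by case: [exists _, _]; exact: nat_b.
- by case: [exists _, _]; exact: nat_b.
- by case: [exists _, _]; exact: nat_b.
Qed.

Lemma program_outcome : exists2 M',
  runs (bitwidth s) program (input_mem sys) M' (steps (max_loop s) program) &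
  outcome (@output_coloring n M').
Proof.
have C := ctx0_input.
apply: spec_seq; apply: (p_degreeP C) => // M1 t o1 h10 ht; have C1 := ctx0_off o1 isT C.
apply: spec_seq; apply: (p_logP C1) => [|M2 k o2 h11 hk]; first by rewrite (o1 11%N isT).
have C2 := ctx0_off o2 isT C1; have [tS tm _] := ht; have [_ kn _] := hk.
apply: spec_seq; apply: (p_paramsP tm kn C2) => // [|j|M3 C3].
- by rewrite (o2 10%N isT).
- by rewrite (o2 2%N isT) (o1 2%N isT).
apply: spec_seq; apply: (p_walkP tm kn tS C3) => M4 x C4 I.
apply: (p_finalP tm kn C4) => M5 h2; exists t, k, (2 * (n + 1) ^ 2 * (m + n) + 1)%N, x.
split=> //; last by apply/funext => j; exact: h2.
apply: (walk_frozen (concrete_params n m t k) _ I); by rewrite [ltnRHS]addn1.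
Qed.

Lemma sum_sgn_le chi (A : {set 'I_n}) : (forall j, chi j = 1 \/ chi j = -1) ->
  `|\sum_(j in A) chi j| <= n%:R :> int.
Proof.
move=> h; apply: le_trans (ler_norm_sum _ _ _) _.
apply: (@le_trans _ _ (\sum_(j in A) 1)).
  by apply: ler_sum => j _; case: (h j) => ->; rewrite ?normrN normr1.
by rewrite sumr_const ler_nat; apply: leq_trans (max_card _) _; rewrite card_ord.
Qed.

(** The constant is 2^25. With [p = k + 2 <= t], the bound [16 u + 2] has leading terms [2^24 p^2]
    and [2^17 p t]; in the Beck-Fiala case [(16 t + 2) ^ 2 <= 324 t ^ 2] suffices. *)
Lemma outcome_disc chi : outcome chi -> exists t k,
  [/\ max_degree sys t, is_log n k, is_coloring chi &
   forall i, (\sum_(j in S i) chi j) ^+ 2 <= 8192 * 4096 * (t%:R * k.+2%:R)].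
Proof.
move=> [t [k [q [x [ht hk I fr ->]]]]]; exists t, k.
have col : is_coloring (sgn x) by move=> j; rewrite /sgn; case: ifP; [left|right].
split=> // i.
have P := concrete_params n m t k.
have [tS tm _] := ht; have [nk kn _] := hk.
have p2 : (2 : int) <= k.+2%:R by rewrite ler_nat.
have [Si|Si] := eqVneq (S i) set0.
  rewrite Si big_set0 expr0n.
  exact: (mulr_ge0 (mulr_ge0 (ler0n _ _) (ler0n _ _)) (mulr_ge0 (ler0n _ _) (ler0n _ _))).
have t1 : (1 <= t)%N.
  have /set0Pn[j jS] := Si; apply: leq_trans (tS j).
  by rewrite -has_count; apply/hasP; exists (S i) => //; exact: mem_tnth.
have t1' : (1 : int) <= t%:R by rewrite ler1n.
have tp : t%:R <= t%:R * k.+2%:R :> int by rewrite ler_peMr //; lra.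
have [nt|tn] := leqP (n ^ 2) t.
  have h1 := sum_sgn_le (S i) col.
  rewrite -[X in X <= _](real_normK (num_real _)).
  apply: (@le_trans _ _ (n%:R ^+ 2)); first by rewrite ler_pXn2r ?nnegrE.
  rewrite -natrX; apply: (@le_trans _ _ t%:R); first by rewrite ler_nat.
  lra.
have [pt|tp'] := leqP k.+2 t.
  (* From [t < n ^ 2] and [n < 2 ^ k]: the product is at most [n ^ 3], hence at most [8 ^ k]. *)
  have hn : (n * (t + 1) <= 8 ^ k.+2)%N.
    apply: (@leq_trans (n ^ 3)%N).
      by rewrite (expnD n 1 2) expn1 leq_mul2l addn1 tn orbT.
    apply: (@leq_trans ((2 ^ k) ^ 3)%N); first by rewrite leq_exp2r // ltnW.
    by rewrite -expnM mulnC expnM leq_exp2l //; lia.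
  apply: le_trans (sharp_bound P tS I fr Si hn) _.
  have hpt : k.+2%:R * k.+2%:R <= t%:R * k.+2%:R :> int.
    by rewrite ler_wpM2r // ler_nat.
  rewrite /pu /pc; move: p2 hpt t1' tp; move: (k.+2%:R : int) (t%:R : int) => p T.
  move=> *.
  have pT : p <= T * p by rewrite ler_peMl //; lra.
  lra.
have h1 := beck_fiala P I fr i.
rewrite -[X in X <= _](real_normK (num_real _)).
have h2 : t%:R <= k.+2%:R :> int by rewrite ler_nat ltnW.
have h3 : t%:R * t%:R <= t%:R * k.+2%:R :> int by rewrite ler_wpM2l.
apply: (@le_trans _ _ ((16 * t%:R + 2) ^+ 2)).
  by rewrite ler_pXn2r ?nnegrE // addr_ge0 // mulr_ge0.
move: tp h3 t1'; move: (t%:R : int) (k.+2%:R : int) => T p *.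
lra.
Qed.
End Run.

(** One number is both coefficient and exponent, as in the time bound [T] of the theorem. *)
Definition poly_bounded (f : nat -> nat) :=
  exists d, forall q, (0 < q)%N -> (f q <= d * q ^ d)%N.

Lemma poly_const a : poly_bounded (fun=> a).
Proof. by exists a => q q0; rewrite leq_pmulr // expn_gt0 q0. Qed.

Lemma poly_id : poly_bounded id.
Proof. by exists 1%N => q q0; rewrite mul1n expn1. Qed.

Lemma poly_add f g : poly_bounded f -> poly_bounded g -> poly_bounded (fun q => f q + g q)%N.
Proof.
move=> [d hf] [e hg]; exists (d + e)%N => q q0; rewrite mulnDl leq_add //.
  by apply: leq_trans (hf q q0) _; rewrite leq_mul2l leq_pexp2l ?orbT // leq_addr.
by apply: leq_trans (hg q q0) _; rewrite leq_mul2l leq_pexp2l ?orbT // leq_addl.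
Qed.

Lemma poly_mul f g : poly_bounded f -> poly_bounded g -> poly_bounded (fun q => f q * g q)%N.
Proof.
move=> [d hf] [e hg]; exists (d * e + (d + e))%N => q q0.
apply: leq_trans (leq_mul (hf q q0) (hg q q0)) _.
rewrite mulnACA -expnD; apply: leq_mul; first exact: leq_addr.
by rewrite leq_pexp2l // leq_addl.
Qed.

Lemma poly_exp f k : poly_bounded f -> poly_bounded (fun q => f q ^ k)%N.
Proof.
move=> hf; elim: k => [|k ih]; first exact: (poly_const 1).
have [d hd] := poly_mul hf ih; exists d => q q0; rewrite expnS; exact: hd.
Qed.

Lemma poly_steps c : poly_bounded (fun q => steps (max_loop q) c).
Proof.
have one : poly_bounded (fun=> 1%N) := poly_const 1.
have pL : poly_bounded max_loop.
  by apply: poly_mul; [exact: poly_const|exact: (poly_exp 3 poly_id)].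
have succ f : poly_bounded f -> poly_bounded (fun q => (f q).+1).
  by move=> hf; have [d hd] := poly_add one hf; exists d => q /hd; rewrite add1n.
elim: c => //= [c1 h1 c2 h2|e c1 h1 c2 h2|e c h1]; try exact/succ/poly_add.
by apply: poly_add => //; apply: poly_mul => //; exact: succ.
Qed.

Lemma poly_time : poly_bounded (fun q => steps (max_loop q) program * unit_cost (bitwidth q))%N.
Proof.
apply: poly_mul; first exact: poly_steps.
have [d hd] : poly_bounded (fun q => bitwidth q * (60 ^ 2 * 2) + 2)%N.
  apply: poly_add; last exact: poly_const.
  apply: poly_mul; last exact: poly_const.
  by apply: poly_mul; [exact: poly_const|exact: (poly_exp 4 poly_id)].
by exists d => q /hd; rewrite /unit_cost mulnA addn2.
Qed.

(** * Passing to real logarithms and square roots *)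

Section Reals.
Variable R : realType.

Lemma log2_ge1 x : 1 <= log2 R x.
Proof. by rewrite /log2 le_max lexx. Qed.

Lemma is_log_le n k : is_log n k -> k.+2%:R <= 4 * log2 R n.
Proof.
move=> [_ _ hk]; have l1 := log2_ge1 n.
case: k hk => [|k] hk; first by lra.
have ln2 : 0 < ln (2 : R) by rewrite ln_gt0 // ltr1n.
have h1 : k%:R <= log2 R n.
  rewrite /log2 le_max; apply/orP; right.
  rewrite ler_pdivlMr // mulr_natl -lnXn // ler_ln ?posrE ?exprn_gt0 //.
    by rewrite -natrX ler_nat; exact: hk.
  by rewrite ltr0n; apply: leq_trans (hk isT); rewrite expn_gt0.
have -> : k.+3%:R = k%:R + 3 :> R by rewrite -(natrD _ _ 3) addn3.
lra.
Qed.

Definition big_const : R := 128 * 128.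

(** [k + 2] is at most 4 log n, so the square of the discrepancy is at most [2^27 t log n], below
    the square 2^28 of [big_const]. The factor [y] will be the logarithm of a set size. *)
Lemma disc_bound n m (sys : m.-tuple {set 'I_n}) chi (A : {set 'I_n}) t t' k y :
  is_log n k -> (t <= t')%N -> 1 <= y ->
  (\sum_(j in A) chi j) ^+ 2 <= 8192 * 4096 * (t%:R * k.+2%:R) :> int ->
  (set_disc chi A)%:R <= big_const * Num.sqrt (t'%:R * log2 R n * y).
Proof.
move=> hk tt y1 hd; have hl := is_log_le hk; have l1 := log2_ge1 n.
have B0 : 0 <= big_const by rewrite /big_const mulr_ge0.
have D2 : ((set_disc chi A)%:R : R) ^+ 2 <= 8192 * 4096 * (t%:R * k.+2%:R).
  have -> : (set_disc chi A)%:R = `|\sum_(j in A) chi j|%:~R :> R.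
    by rewrite /set_disc -abszE -pmulrn.
  rewrite -(ler_int R) in hd; move: hd.
  rewrite -[X in X%:~R <= _]real_normK ?num_real //.
  by rewrite rmorphXn /= 3!intrM 4!rmorph_nat.
have T0 : (0 : R) <= t'%:R * log2 R n by rewrite mulr_ge0 ?ler0n // (le_trans ler01).
have Ty : t'%:R * log2 R n <= t'%:R * log2 R n * y by rewrite ler_peMr.
rewrite -(ger0_norm (ler0n R _)) -sqrtr_sqr -(ger0_norm B0) -[`|big_const|]sqrtr_sqr.
rewrite -(sqrtrM _ (sqr_ge0 _)); apply: ler_wsqrtr.
apply: le_trans D2 _; rewrite /big_const.
have h1 : t%:R * k.+2%:R <= t'%:R * (4 * log2 R n) :> R.
  by apply: ler_pM; rewrite ?ler0n ?ler_nat.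
move: h1 Ty T0; rewrite (mulrCA _ 4); clear.
move: (t'%:R * log2 R n * y) (t'%:R * log2 R n) (t%:R * k.+2%:R) => a1 a2 a3 *.
lra.
Qed.
End Reals.

Theorem theorem1p1 (R : realType) :
  exists2 C : R, 0 < C &
  forall c : nat, exists (A : com) (d : nat),
  forall (n m : nat) (sys : m.-tuple {set 'I_n}),
    let T := (d * (n + m + 1) ^ d)%N in
    halts_within A (input_mem sys) T /\
    forall t : nat, sparse t sys ->
      1 - (n%:R ^+ c)^-1 <=
      Pr R A (input_mem sys) T (fun M =>
        let chi := @output_coloring n M in
        [/\ is_coloring chi,
            forall S : {set 'I_n}, S \in sys ->
              (set_disc chi S)%:R
                <= C * Num.sqrt (t%:R * log2 R n * log2 R #|S|) &
            (disc chi sys)%:R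
              <= C * Num.sqrt (t%:R * log2 R n * log2 R (max_set_card sys))]).
Proof.
exists (big_const R); first by rewrite /big_const mulr_gt0.
move=> c; have [d hd] := poly_time; exists program, d => n m sys T.
have [M' run out] := program_outcome sys.
have s0 : (0 < n + m + 1)%N by rewrite addn1.
have [_ ex] := run (bounded_input sys).
have exT r : exists2 q, (q <= T)%N & exec program (input_mem sys, r) q (M', r).
  by have [q hq e] := ex r; exists q => //; apply: leq_trans hq (hd _ s0).
split.
  by move=> r; have [q hq e] := exT r; exists q, (M', r : seq bool).
move=> t tS; apply: (@le_trans _ _ 1); first by rewrite gerBl invr_ge0 exprn_ge0.
rewrite /Pr; set Ev := [set r | _].
(* The final memory [M'] is the same for every tape, so the event is certain. *)
have -> : Ev = setT.
  apply/setP => r; rewrite !inE; apply/asboolP.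
  have [q _ e] := exT r; exists q, (M', r : seq bool); split=> //=.
  have [t0 [k [[_ _ tmin] hk col hdisc]]] := outcome_disc out.
  have bd (A : {set 'I_n}) y : A \in (sys : seq _) -> 1 <= y ->
      (set_disc (@output_coloring n M') A)%:R <= big_const R * Num.sqrt (t%:R * log2 R n * y).
    move=> /tnthP[i ->] y1; exact: (disc_bound sys hk (tmin t tS) y1 (hdisc i)).
  split=> // [A AS|]; first by apply: bd => //; exact: log2_ge1.
  rewrite /disc big_seq.
  elim/big_ind: _ => [|a1 a2 h1 h2|A AS].
  - by rewrite mulr_ge0 ?sqrtr_ge0 // /big_const mulr_ge0.
  - by case: (leqP a1 a2).
  by apply: bd => //; exact: log2_ge1.
by rewrite cardsT card_tuple card_bool natrX divff ?lexx ?expf_neq0 ?pnatr_eq0.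
Qed.
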